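(* Let $\alpha\in\mathbb{R}$ and let $\mathrm{Pf}\,x^{\alpha}$ be the tempered distribution generated (via Hadamard finite part) by the function $x\mapsto x^{\alpha}$. Then $$\mathscr{F}\,\mathrm{Pf}\,x^{\alpha}=\begin{cases} 2\pi \,i^{\alpha}\,\mathscr{D}^{\alpha}\delta&\text{if } \alpha\in\{0,1,2,3,\dots\},\\ T_{g}&\text{if } \alpha\in\{-1,-2,-3,\dots\},\\ \Gamma(\alpha+1)\left(\mathrm{e}^{-i\pi\alpha}\,\mathrm{Pf}\,\dfrac{1}{(-ix)^{\alpha+1}}+\mathrm{Pf}\,\dfrac{1}{(ix)^{\alpha+1}}\right)&\text{if } \alpha\in\mathbb{R}\setminus\mathbb{Z}, \end{cases}$$ where $T_g$ is the distribution generated by $$g(x)=\pi\frac{i^{\alpha}\,x^{-\alpha-1}}{(-\alpha-1)!}\,\mathrm{sgn}(x).$$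
   Context: $\mathscr{S}'(\mathbb{R})$ is the space of tempered distributions; the Fourier transform is $\mathscr{F}T[\varphi]:=T[\hat\varphi]$ with $\hat{\varphi}(k)=\int_{\mathbb{R}}\varphi(x)e^{-ikx}\,dx$. For a locally integrable, polynomially bounded $f$, $T_f[\varphi]=\int f\varphi$. For $n\in\mathbb{N}_0$, $\mathscr{D}^n$ is the $n$-th distributional derivative and $\delta[\varphi]=\varphi(0)$. For a function $f$ singular only at $0$, $\mathrm{Pf}\,f$ is the distribution $\varphi\mapsto$ finite part (constant term after discarding terms divergent as $\epsilon\to0^+$) of $\int_{|x|>\epsilon}f\varphi\,dx$. Complex powers use the branch $\log(re^{i\theta})=\log r+i\theta$, $r>0$, $-\pi\le\theta<\pi$, with $z^\beta:=e^{\beta\log z}$ (so $i^\beta=e^{i\pi\beta/2}$, $(-1)^\beta=e^{-i\pi\beta}$). $\Gamma$ is the Gamma function. *)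

(* Defs.v *)
From Stdlib Require Import Reals List.
From Coquelicot Require Import Coquelicot.
Open Scope R_scope.

Definition cexp (z : C) : C :=
  (exp (fst z) * cos (snd z), exp (fst z) * sin (snd z)).

(** argument in [-pi, pi) (branch -pi <= theta < pi, as in the paper) *)
Definition carg (z : C) : R :=
  let x := fst z in let y := snd z in
  if Rlt_dec 0 y then acos (x / Cmod z)
  else if Rlt_dec y 0 then - acos (x / Cmod z)
  else if Rlt_dec x 0 then - PI else 0.

Definition clog (z : C) : C := (ln (Cmod z), carg z).

Definition cpow (z : C) (beta : R) : C := cexp (Cmult (RtoC beta) (clog z)).

Definition xpow (alpha : R) (x : R) : C := cpow (RtoC x) alpha.

Definition sgn (x : R) : R :=
  if Rlt_dec 0 x then 1 else if Rlt_dec x 0 then -1 else 0.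

Definition Gamma_Euler (s : R) : R :=
  RInt_gen (fun t => Rpower t (s - 1) * exp (- t)) (at_right 0) (Rbar_locally p_infty).

Fixpoint shifted_prod (s : R) (n : nat) : R :=
  match n with O => 1 | S k => shifted_prod s k * (s + INR k) end.

(** Gamma(s) = Gamma(s+n) / (s (s+1) ... (s+n-1)) with n chosen so that s+n > 0
    (for s not a non-positive integer); for s > 0 this is the Euler integral *)
Definition Gamma (s : R) : R :=
  let n := Z.to_nat (- Int_part s) in
  Gamma_Euler (s + INR n) / shifted_prod s n.

Definition Dn (n : nat) (phi : R -> C) (x : R) : C :=
  (Derive_n (fun t => fst (phi t)) n x, Derive_n (fun t => snd (phi t)) n x).

Definition Schwartz (phi : R -> C) : Prop :=
  (forall (n : nat) (x : R),
      ex_derive (Derive_n (fun t => fst (phi t)) n) x /\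
      ex_derive (Derive_n (fun t => snd (phi t)) n) x) /\
  (forall m n : nat, exists M : R, forall x : R, Rabs x ^ m * Cmod (Dn n phi x) <= M).

Definition is_fourier (phi psi : R -> C) : Prop :=
  forall k : R,
    is_RInt_gen (fun x => Cmult (phi x) (cexp (0, - (k * x))))
      (Rbar_locally m_infty) (Rbar_locally p_infty) (psi k).

Definition T_val (f phi : R -> C) (L : C) : Prop :=
  is_RInt_gen (fun x => Cmult (f x) (phi x))
    (Rbar_locally m_infty) (Rbar_locally p_infty) L.

Definition Dn_delta (n : nat) (phi : R -> C) : C :=
  Cmult (RtoC ((-1) ^ n)) (Dn n phi 0).

Definition int_outside (g : R -> C) (eps : R) (I : C) : Prop :=
  exists I1 I2 : C,
    is_RInt_gen g (Rbar_locally m_infty) (at_point (- eps)) I1 /\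
    is_RInt_gen g (at_point eps) (Rbar_locally p_infty) I2 /\
    I = Cplus I1 I2.

Definition divergent_part (l : list (R * C)) (b : C) (eps : R) : C :=
  Cplus (fold_right (fun p acc => Cplus acc (Cmult (snd p) (RtoC (Rpower eps (- fst p)))))
           (RtoC 0) l)
        (Cmult b (RtoC (ln eps))).

(** L is the Hadamard finite part of F(eps) as eps -> 0+ : the constant term
    remaining after discarding terms divergent as eps -> 0+ *)
Definition finite_part (F : R -> C) (L : C) : Prop :=
  exists (l : list (R * C)) (b : C),
    List.Forall (fun p => 0 < fst p) l /\
    filterlim (fun eps => Cminus (F eps) (divergent_part l b eps)) (at_right 0) (locally L).

Definition Pf_val (f phi : R -> C) (L : C) : Prop :=
  exists F : R -> C,
    (forall eps, 0 < eps -> int_outside (fun x => Cmult (f x) (phi x)) eps (F eps)) /\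
    finite_part F L.

(* Main.v *)
(** A Schwartz function [phi] and its transform [psi] satisfy [psi' = F(-i x phi)] and
    [x psi = F(-i phi')].  Integrating by parts inside the finite part produces a boundary term
    whose expansion has no constant term (for integer exponents because the contributions of
    the two half-lines cancel), so these relations carry the formula from [alpha] to
    [alpha - 1] and [alpha + 1], and it suffices to treat [-2 <= alpha < -1].

    There, with [s = alpha + 1], the finite part is a convergent integral after subtracting
    [psi 0], and exchanging the integrals reduces the claim to
    [int_0^oo u^(s-1) (e^{-iu} - 1) du = Gamma(s) e^{-i pi s/2}] for [-1 < s < 0] and
    [int_0^oo (cos u - 1)/u^2 du = - pi/2] for [s = -1].  Both follow by rotating the contour
    of [z^(s-1) (e^{-z} - 1)] by a quarter turn.

    Integrals are increments of antiderivatives; the exchange of integrals is replaced by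
    differentiation under the integral sign of [int x^(-s) phi(x) rho(N x) dx], where [rho]
    is the tail of the kernel integral. *)

Require Import Defs.
From Stdlib Require Import Reals List Lra Lia ZArith ClassicalEpsilon.
From Coquelicot Require Import Coquelicot.
Open Scope R_scope.

(** * Limits and derivatives of complex-valued functions *)

(** The range [-2 <= alpha < -1] is where no conditional convergence occurs: [u^(s-1) (e^{-iu} - 1)]
    is absolutely integrable at infinity because [s < 0], and at 0 as long as [s > -1]. At [s = -1]
    it behaves like [1/u] near 0 and only the even combination [cos u - 1] survives. For this reason
    integer exponents are handled through sums over both half-lines with a fixed parity, while for
    the other exponents each half-line is handled alone. Parity is also what removes the constant
    term: [e^b W(e)] has one only if [b = -j], proportional to the derivative of order [j] of [W] at
    0, and this derivative is then an odd function. Integrals containing a test function are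
    dominated by [M / (1 + x^2)], so existence, uniqueness, bounds and differentiation under the
    integral sign all reduce to comparing an antiderivative with [M * atan]. The delta appears on
    passing from exponent -1 to 0: an integral of [phi'] over the two half-lines with opposite signs
    is a boundary value. *)

Definition Clim {T : Type} (F : (T -> Prop) -> Prop) (H : T -> C) (l : C) : Prop :=
  forall e : R, 0 < e -> F (fun x => Cmod (H x - l)%C < e).

(** Componentwise, so that real calculus ([auto_derive], [MVT_gen]) applies. The variable is real;
    holomorphy enters only through [arcint_der]. *)
Definition Cder (f : R -> C) (x : R) (l : C) : Prop :=
  is_derive (fun t => fst (f t)) x (fst l) /\ is_derive (fun t => snd (f t)) x (snd l).

Definition Ccont (f : R -> C) (x : R) : Prop :=
  continuous (fun t => fst (f t)) x /\ continuous (fun t => snd (f t)) x.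

Lemma Cmod_le_sum (z : C) : Cmod z <= Rabs (fst z) + Rabs (snd z).
Proof.
  replace z with (RtoC (fst z) + Ci * RtoC (snd z))%C at 1
    by (destruct z; apply injective_projections; simpl; ring).
  eapply Rle_trans; [apply Cmod_triangle|].
  rewrite Cmod_mult, Cmod_Ci, !Cmod_R; lra.
Qed.

Lemma fst_le_Cmod (z : C) : Rabs (fst z) <= Cmod z.
Proof. eapply Rle_trans; [apply Rmax_l|apply Rmax_Cmod]. Qed.

Lemma snd_le_Cmod (z : C) : Rabs (snd z) <= Cmod z.
Proof. eapply Rle_trans; [apply Rmax_r|apply Rmax_Cmod]. Qed.

Lemma Cmod_minus_sym (a b : C) : Cmod (a - b)%C = Cmod (b - a)%C.
Proof. rewrite <- Cmod_opp; f_equal; ring. Qed.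

Lemma Cmod_triangle_minus (a b : C) : Cmod (a - b)%C <= Cmod a + Cmod b.
Proof. rewrite <- (Cmod_opp b); apply Cmod_triangle. Qed.

Lemma Clim_filterlim {T} (F : (T -> Prop) -> Prop) {FF : Filter F} (H : T -> C) (l : C) :
  Clim F H l -> filterlim H F (locally l).
Proof.
  intros HL P [eps He].
  unfold filtermap.
  apply (filter_imp (fun x => Cmod (H x - l)%C < eps)).
  - intros x Hx; apply He; split.
    + apply (Rle_lt_trans _ _ _ (fst_le_Cmod (H x - l)%C) Hx).
    + apply (Rle_lt_trans _ _ _ (snd_le_Cmod (H x - l)%C) Hx).
  - apply HL, cond_pos.
Qed.

Lemma Clim_ext {T} (F : (T -> Prop) -> Prop) {FF : Filter F} (f g : T -> C) l :
  F (fun x => f x = g x) -> Clim F f l -> Clim F g l.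
Proof.
  intros E H e He.
  generalize (filter_and _ _ E (H e He)); apply filter_imp.
  intros x [<- Hx]; exact Hx.
Qed.

Lemma Clim_const {T} (F : (T -> Prop) -> Prop) {FF : Filter F} (c : C) :
  Clim F (fun _ => c) c.
Proof.
  intros e He; apply filter_forall; intros x.
  replace (c - c)%C with (RtoC 0) by ring; rewrite Cmod_0; exact He.
Qed.

Lemma Clim_plus {T} (F : (T -> Prop) -> Prop) {FF : Filter F} (f g : T -> C) a b :
  Clim F f a -> Clim F g b -> Clim F (fun x => f x + g x)%C (a + b)%C.
Proof.
  intros Hf Hg e He.
  generalize (filter_and (F:=F) _ _ (Hf (e / 2) ltac:(lra)) (Hg (e / 2) ltac:(lra))).
  apply filter_imp; intros x [H1 H2].
  replace (f x + g x - (a + b))%C with ((f x - a) + (g x - b))%C by ring.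
  eapply Rle_lt_trans; [apply Cmod_triangle|lra].
Qed.

Lemma Clim_scal {T} (F : (T -> Prop) -> Prop) {FF : Filter F} (c : C) (f : T -> C) a :
  Clim F f a -> Clim F (fun x => c * f x)%C (c * a)%C.
Proof.
  intros Hf e He.
  assert (Hc := Cmod_ge_0 c).
  generalize (Hf (e / (Cmod c + 1)) ltac:(apply Rdiv_lt_0_compat; lra)).
  apply filter_imp; intros x H1.
  replace (c * f x - c * a)%C with (c * (f x - a))%C by ring.
  rewrite Cmod_mult.
  apply Rle_lt_trans with ((Cmod c) * (e / (Cmod c + 1))).
  - apply Rmult_le_compat_l; lra.
  - apply Rlt_le_trans with ((Cmod c + 1) * (e / (Cmod c + 1))).
    + apply Rmult_lt_compat_r; [apply Rdiv_lt_0_compat|]; lra.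
    + apply Req_le; field; lra.
Qed.

Lemma Clim_unique {T} (F : (T -> Prop) -> Prop) {FF : ProperFilter F} (f : T -> C) a b :
  Clim F f a -> Clim F f b -> a = b.
Proof.
  intros Ha Hb.
  destruct (Req_dec (Cmod (a - b)%C) 0) as [E|E].
  - apply Cmod_eq_0 in E.
    replace a with (a - b + b)%C by ring; rewrite E; ring.
  - assert (P : 0 < Cmod (a - b)%C) by (generalize (Cmod_ge_0 (a - b)%C); lra).
    destruct (filter_ex _ (filter_and (F:=F) _ _ (Ha _ (Rdiv_lt_0_compat _ 2 P ltac:(lra)))
       (Hb _ (Rdiv_lt_0_compat _ 2 P ltac:(lra))))) as [x [H1 H2]].
    rewrite Cmod_minus_sym in H1.
    assert (Cmod (a - b)%C <= Cmod (a - f x)%C + Cmod (f x - b)%C).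
    { replace (a - b)%C with ((a - f x) + (f x - b))%C by ring; apply Cmod_triangle. }
    lra.
Qed.

Lemma Clim_le {T} (F : (T -> Prop) -> Prop) {FF : Filter F} (f : T -> C) (g : T -> R) l :
  F (fun x => Cmod (f x - l)%C <= g x) -> filterlim g F (locally 0) -> Clim F f l.
Proof.
  intros Hf Hg e He.
  generalize (filter_and _ _ Hf (proj1 (filterlim_locally g 0) Hg (mkposreal e He))).
  apply filter_imp; intros x [H1 H2].
  change (Rabs (g x - 0) < e) in H2; apply Rabs_def2 in H2; simpl in H2; lra.
Qed.

Lemma Clim_at_point (f : R -> C) a : Clim (at_point a) f (f a).
Proof.
  intros e He.
  unfold at_point.
  replace (f a - f a)%C with (RtoC 0) by ring; rewrite Cmod_0; exact He.
Qed.

Lemma Clim_cauchy {T} (F : (T -> Prop) -> Prop) {FF : ProperFilter F} (H : T -> C) :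
  (forall e, 0 < e ->
     exists P, F P /\ forall u v, P u -> P v -> Cmod (H u - H v)%C < e) ->
  exists l, Clim F H l.
Proof.
  intros HC.
  assert (A : exists l1, filterlim (fun x => fst (H x)) F (locally l1)).
  { apply (@filterlim_locally_cauchy T R_CompleteSpace F _).
    intros eps; destruct (HC eps (cond_pos eps)) as [P [HP HQ]].
    exists P; split; [exact HP|]; intros u v Hu Hv.
    eapply Rle_lt_trans; [|apply (HQ v u Hv Hu)].
    apply (fst_le_Cmod (H v - H u)%C). }
  assert (B : exists l1, filterlim (fun x => snd (H x)) F (locally l1)).
  { apply (@filterlim_locally_cauchy T R_CompleteSpace F _).
    intros eps; destruct (HC eps (cond_pos eps)) as [P [HP HQ]].
    exists P; split; [exact HP|]; intros u v Hu Hv.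
    eapply Rle_lt_trans; [|apply (HQ v u Hv Hu)].
    apply (snd_le_Cmod (H v - H u)%C). }
  destruct A as [l1 A], B as [l2 B]; exists (l1, l2).
  intros e He.
  assert (He2 : 0 < e / 2) by lra.
  generalize (filter_and _ _ (proj1 (filterlim_locally _ _) A (mkposreal _ He2))
                             (proj1 (filterlim_locally _ _) B (mkposreal _ He2))).
  apply filter_imp; intros x [H1 H2].
  eapply Rle_lt_trans; [apply Cmod_le_sum|].
  change (Rabs (fst (H x) - l1) < e / 2) in H1.
  change (Rabs (snd (H x) - l2) < e / 2) in H2.
  change (Rabs (fst (H x) - l1) + Rabs (snd (H x) - l2) < e).
  lra.
Qed.

Lemma Cder_eq f x l l' : Cder f x l -> l = l' -> Cder f x l'.
Proof. intros H <-; exact H. Qed.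

Lemma Cder_ext_loc f g x l : locally x (fun t => f t = g t) -> Cder f x l -> Cder g x l.
Proof.
  intros E [H1 H2]; split; (eapply is_derive_ext_loc; [|eassumption]);
  revert E; apply filter_imp; intros t ->; reflexivity.
Qed.

Lemma Cder_ext f g x l : (forall t, f t = g t) -> Cder f x l -> Cder g x l.
Proof. intros E; apply Cder_ext_loc, filter_forall, E. Qed.

Lemma locally_pos x : 0 < x -> locally x (fun t => 0 < t).
Proof. intros Hx; apply (open_gt 0 x Hx). Qed.

Lemma Cder_const c x : Cder (fun _ => c) x (RtoC 0).
Proof. split; simpl; apply (@is_derive_const R_AbsRing R_NormedModule). Qed.

Lemma Cder_RtoC (f : R -> R) x l : is_derive f x l -> Cder (fun t => RtoC (f t)) x (RtoC l).
Proof. split; simpl; [assumption|apply (@is_derive_const R_AbsRing R_NormedModule)]. Qed.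

Lemma Cder_plus f g x a b :
  Cder f x a -> Cder g x b -> Cder (fun t => f t + g t)%C x (a + b)%C.
Proof.
  intros [F1 F2] [G1 G2]; split; simpl;
  apply (@is_derive_plus R_AbsRing R_NormedModule); assumption.
Qed.

Lemma is_derive_mult_R (f g : R -> R) x a b :
  is_derive f x a -> is_derive g x b ->
  is_derive (fun t => f t * g t) x (a * g x + f x * b).
Proof.
  intros Hf Hg; auto_derive; [repeat split; eexists; eassumption|].
  replace (Derive (fun t : R => f t) x) with a by (symmetry; apply is_derive_unique, Hf);
    replace (Derive (fun t : R => g t) x) with b by (symmetry; apply is_derive_unique, Hg);
    ring.
Qed.

Lemma Cder_mult f g x a b :
  Cder f x a -> Cder g x b -> Cder (fun t => f t * g t)%C x (a * g x + f x * b)%C.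
Proof.
  intros [F1 F2] [G1 G2]; split; simpl.
  - evar_last;
      [apply (@is_derive_minus R_AbsRing R_NormedModule (fun t => fst (f t) * fst (g t)));
       apply is_derive_mult_R; eassumption|].
    unfold minus, plus, opp; simpl; ring.
  - evar_last;
      [apply (@is_derive_plus R_AbsRing R_NormedModule (fun t => fst (f t) * snd (g t)));
       apply is_derive_mult_R; eassumption|].
    unfold plus; simpl; ring.
Qed.

Lemma Cder_scal c f x a : Cder f x a -> Cder (fun t => c * f t)%C x (c * a)%C.
Proof.
  intros H; eapply Cder_eq; [apply Cder_mult; [apply Cder_const|exact H]|cbv beta; ring].
Qed.

Lemma Cder_opp f x a : Cder f x a -> Cder (fun t => - f t)%C x (- a)%C.
Proof.
  intros H; eapply Cder_ext; [|eapply Cder_eq; [apply (Cder_scal (-1)%C), H|ring]].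
  intros t; simpl; ring.
Qed.

Lemma Cder_minus f g x a b :
  Cder f x a -> Cder g x b -> Cder (fun t => f t - g t)%C x (a - b)%C.
Proof. intros H1 H2; apply Cder_plus, Cder_opp; assumption. Qed.

Lemma Cder_comp f (g : R -> R) x l r :
  Cder f (g x) l -> is_derive g x r -> Cder (fun t => f (g t)) x (RtoC r * l)%C.
Proof.
  intros [F1 F2] G; split.
  - evar_last; [apply (is_derive_comp (fun y => fst (f y))); eassumption|].
    simpl; unfold scal; simpl; unfold mult; simpl; ring.
  - evar_last; [apply (is_derive_comp (fun y => snd (f y))); eassumption|].
    simpl; unfold scal; simpl; unfold mult; simpl; ring.
Qed.

Lemma Cder_opp_arg f x l : Cder f (- x) l -> Cder (fun t => f (- t)) x (- l)%C.
Proof.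
  intros H; eapply Cder_eq.
  - apply (Cder_comp f Ropp x l (-1)); [exact H|].
    auto_derive; [exact I|ring].
  - apply injective_projections; simpl; ring.
Qed.

Lemma Cder_cexp z x l : Cder z x l -> Cder (fun t => cexp (z t)) x (l * cexp (z x))%C.
Proof.
  assert (W : forall f g : R -> R, forall a b, is_derive f x a -> is_derive g x b ->
    is_derive (fun t => exp (f t) * cos (g t)) x
      (a * (exp (f x) * cos (g x)) - b * (exp (f x) * sin (g x))) /\
    is_derive (fun t => exp (f t) * sin (g t)) x
      (a * (exp (f x) * sin (g x)) + b * (exp (f x) * cos (g x)))).
  { intros f g a b Hf Hg; split; (auto_derive; [repeat split; eexists; eassumption|]);
    replace (Derive (fun t : R => f t) x) with a by (symmetry; apply is_derive_unique, Hf);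
    replace (Derive (fun t : R => g t) x) with b by (symmetry; apply is_derive_unique, Hg);
    ring. }
  intros [H1 H2]; destruct (W _ _ _ _ H1 H2) as [W1 W2]; split; assumption.
Qed.

Lemma Cder_cont f x l : Cder f x l -> Ccont f x.
Proof.
  intros [H1 H2]; split.
  - apply (ex_derive_continuous (fun t => fst (f t))); eexists; eassumption.
  - apply (ex_derive_continuous (fun t => snd (f t))); eexists; eassumption.
Qed.

Lemma Cder_Clim f x l : Cder f x l -> Clim (locally x) f (f x).
Proof.
  intros H e He; destruct (Cder_cont _ _ _ H) as [A B].
  assert (He2 : 0 < e / 2) by lra.
  generalize (filter_and _ _ (proj1 (filterlim_locally _ _) A (mkposreal _ He2))
                             (proj1 (filterlim_locally _ _) B (mkposreal _ He2))).
  apply filter_imp; intros y [H1 H2].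
  eapply Rle_lt_trans; [apply Cmod_le_sum|].
  change (Rabs (fst (f y) - fst (f x)) < e / 2) in H1.
  change (Rabs (snd (f y) - snd (f x)) < e / 2) in H2.
  change (Rabs (fst (f y) - fst (f x)) + Rabs (snd (f y) - snd (f x)) < e).
  lra.
Qed.

Lemma is_derive_cont (f : R -> R) x l : is_derive f x l -> continuity_pt f x.
Proof.
  intros H; apply continuity_pt_filterlim, (ex_derive_continuous f); eexists; exact H.
Qed.

(* Apply the real mean value theorem to the projection of [f] on the direction [f b - f a]. *)
Lemma Cder_dom f f' (g g' : R -> R) a b :
  a <= b ->
  (forall t, a <= t <= b -> Cder f t (f' t)) ->
  (forall t, a <= t <= b -> is_derive g t (g' t)) ->
  (forall t, a <= t <= b -> Cmod (f' t) <= g' t) ->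
  Cmod (f b - f a)%C <= g b - g a.
Proof.
  intros Hab Hf Hg Hle.
  set (u := (f b - f a)%C).
  assert (Hm : Rmin a b = a) by (apply Rmin_left; lra).
  assert (HM : Rmax a b = b) by (apply Rmax_right; lra).
  destruct (MVT_gen g a b g') as [c [Hc Ec]].
  { rewrite Hm, HM; intros x Hx; apply Hg; lra. }
  { rewrite Hm, HM; intros x Hx; eapply is_derive_cont, Hg; lra. }
  rewrite Hm, HM in Hc.
  (* Excludes [u = 0] in the last line, where a factor [Cmod u] is cancelled. *)
  assert (Hpos : 0 <= g b - g a).
  { rewrite Ec; apply Rmult_le_pos; [|lra].
    eapply Rle_trans; [apply Cmod_ge_0|apply Hle; lra]. }
  pose (h := fun t => fst u * fst (f t) + snd u * snd (f t) - Cmod u * g t).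
  pose (h' := fun t => fst u * fst (f' t) + snd u * snd (f' t) - Cmod u * g' t).
  assert (Dh : forall t, a <= t <= b -> is_derive h t (h' t)).
  { intros t Ht; destruct (Hf t Ht) as [F1 F2]; assert (G := Hg t Ht).
    apply (@is_derive_minus R_AbsRing R_NormedModule
             (fun t => fst u * fst (f t) + snd u * snd (f t)) (fun t => Cmod u * g t)).
    - apply (@is_derive_plus R_AbsRing R_NormedModule
               (fun t => fst u * fst (f t)) (fun t => snd u * snd (f t)));
      apply is_derive_scal; assumption.
    - apply is_derive_scal; assumption. }
  destruct (MVT_gen h a b h') as [d [Hd Ed]].
  { rewrite Hm, HM; intros x Hx; apply Dh; lra. }
  { rewrite Hm, HM; intros x Hx; eapply is_derive_cont, Dh; lra. }
  rewrite Hm, HM in Hd.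
  assert (Hneg : h' d <= 0).
  { unfold h'.
    assert (fst u * fst (f' d) + snd u * snd (f' d) <= Cmod u * Cmod (f' d)).
    { rewrite <- (Cmod_conj u), <- Cmod_mult.
      eapply Rle_trans; [|apply re_le_Cmod].
      eapply Rle_trans; [|apply Rle_abs].
      apply Req_le; destruct u; simpl; ring. }
    assert (Cmod u * Cmod (f' d) <= Cmod u * g' d).
    { apply Rmult_le_compat_l; [apply Cmod_ge_0|apply Hle, Hd]. }
    lra. }
  assert (Eh : h b - h a = Cmod u * Cmod u - Cmod u * (g b - g a)).
  { unfold h.
    replace (Cmod u * Cmod u) with (fst u * fst u + snd u * snd u).
    - unfold u; simpl; ring.
    - unfold Cmod; rewrite sqrt_sqrt; [ring|nra]. }
  assert (h b - h a <= 0) by (rewrite Ed; nra).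
  assert (Hu := Cmod_ge_0 u).
  destruct (Rle_lt_dec (Cmod u) (g b - g a)) as [|Hlt]; [assumption|nra].
Qed.

Lemma Cder_lip f f' K a b :
  (forall t, Rmin a b <= t <= Rmax a b -> Cder f t (f' t)) ->
  (forall t, Rmin a b <= t <= Rmax a b -> Cmod (f' t) <= K) ->
  Cmod (f b - f a)%C <= K * Rabs (b - a).
Proof.
  assert (W : forall a b, a <= b ->
    (forall t, a <= t <= b -> Cder f t (f' t)) ->
    (forall t, a <= t <= b -> Cmod (f' t) <= K) ->
    Cmod (f b - f a)%C <= K * (b - a)).
  { clear a b; intros a b Hab H1 H2.
    replace (K * (b - a)) with (K * b - K * a) by ring.
    apply (Cder_dom f f' (fun t => K * t) (fun _ => K)); auto.
    intros t _; auto_derive; [exact I|ring]. }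
  destruct (Rle_dec a b) as [H|H].
  - rewrite Rmin_left, Rmax_right by lra; rewrite Rabs_pos_eq by lra; apply W; exact H.
  - rewrite Rmin_right, Rmax_left by lra.
    rewrite Cmod_minus_sym, Rabs_minus_sym, Rabs_pos_eq by lra; apply W; lra.
Qed.

(** A quadratic remainder is what differentiation under the integral sign produces directly, since
    pointwise bounds can be integrated. *)
Lemma Cder_quad (f : R -> C) t0 l r K :
  0 < r ->
  (forall h, Rabs h < r -> Cmod (f (t0 + h)%R - f t0 - RtoC h * l)%C <= K * h ^ 2) ->
  Cder f t0 l.
Proof.
  intros Hr H.
  assert (HK : 0 <= K).
  { assert (A := H (r / 2) ltac:(rewrite Rabs_pos_eq; lra)).
    assert (B := Rle_trans _ _ _ (Cmod_ge_0 _) A).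
    assert (0 < (r / 2) ^ 2) by (apply pow_lt; lra); nra. }
  assert (W : forall (g : R -> R) l1,
    (forall h, Rabs h < r -> Rabs (g (t0 + h) - g t0 - h * l1) <= K * h ^ 2) ->
    is_derive g t0 l1).
  { intros g l1 Hg; apply is_derive_Reals; intros eps He.
    assert (Hd : 0 < Rmin r (eps / (K + 1))).
    { apply Rmin_glb_lt; [exact Hr|apply Rdiv_lt_0_compat; lra]. }
    exists (mkposreal _ Hd); simpl; intros h Hh0 Hh.
    assert (H1 : Rabs h < r) by (eapply Rlt_le_trans; [exact Hh|apply Rmin_l]).
    assert (H2 : Rabs h < eps / (K + 1)) by (eapply Rlt_le_trans; [exact Hh|apply Rmin_r]).
    replace ((g (t0 + h) - g t0) / h - l1) with ((g (t0 + h) - g t0 - h * l1) / h)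
      by (field; exact Hh0).
    unfold Rdiv; rewrite Rabs_mult, Rabs_inv.
    assert (Hp : 0 < Rabs h) by (apply Rabs_pos_lt; exact Hh0).
    apply Rle_lt_trans with (K * h ^ 2 * / Rabs h).
    - apply Rmult_le_compat_r; [left; apply Rinv_0_lt_compat, Hp|apply Hg, H1].
    - rewrite <- pow2_abs; replace (K * Rabs h ^ 2 * / Rabs h) with (K * Rabs h)
        by (field; lra).
      apply Rle_lt_trans with ((K + 1) * Rabs h); [nra|].
      apply Rlt_le_trans with ((K + 1) * (eps / (K + 1))).
      + apply Rmult_lt_compat_l; lra.
      + apply Req_le; field; lra. }
  split; apply W; intros h Hh; eapply Rle_trans; try apply (H h Hh).
  - eapply Rle_trans; [|apply fst_le_Cmod]; apply Req_le; f_equal; simpl; ring.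
  - eapply Rle_trans; [|apply snd_le_Cmod]; apply Req_le; f_equal; simpl; ring.
Qed.

(** * Integrals as increments of antiderivatives *)

(** Follows from [atan x = PI/2 - atan (1/x)] and [atan y <= y]. The limit matters because [atan] is
    the reference antiderivative for convergence at infinity. *)
Lemma atan_lim_p : filterlim atan (Rbar_locally p_infty) (locally (PI / 2)).
Proof.
  apply filterlim_locally; intros [e He]; simpl.
  exists (/ e); intros x Hx.
  assert (H0 : 0 < / e) by (apply Rinv_0_lt_compat, He).
  assert (Hx0 : 0 < x) by lra.
  change (Rabs (atan x - PI / 2) < e).
  rewrite Rabs_minus_sym, <- (atan_inv x Hx0).
  assert (P : 0 < / x) by (apply Rinv_0_lt_compat, Hx0).
  assert (Q : / x < e).
  { rewrite <- (Rinv_inv e); apply Rinv_lt_contravar; [|exact Hx].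
    apply Rmult_lt_0_compat; assumption. }
  assert (L : atan (/ x) <= / x).
  { assert (K := Cder_dom (fun t => RtoC (atan t)) (fun t => RtoC (/ (1 + t²))) (fun t => t)
        (fun _ => 1) 0 (/ x) ltac:(lra)).
    cbv beta in K; rewrite atan_0, <- RtoC_minus, Cmod_R, !Rminus_0_r in K.
    eapply Rle_trans; [apply Rle_abs|apply K].
    - intros t _; apply Cder_RtoC, is_derive_atan.
    - intros t _; apply (@is_derive_id R_AbsRing).
    - intros t _; rewrite Cmod_R.
      assert (0 <= t²) by apply Rle_0_sqr.
      rewrite Rabs_pos_eq by (left; apply Rinv_0_lt_compat; lra).
      rewrite <- Rinv_1; apply Rinv_le_contravar; lra. }
  assert (0 < atan (/ x)) by (rewrite <- atan_0; apply atan_increasing, P).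
  rewrite Rabs_pos_eq; lra.
Qed.

Lemma atan_lim_m : filterlim atan (Rbar_locally m_infty) (locally (- (PI / 2))).
Proof.
  apply filterlim_locally; intros eps.
  destruct (proj1 (filterlim_locally _ _) atan_lim_p eps) as [M HM].
  exists (- M); intros x Hx.
  generalize (HM (- x) ltac:(lra)); unfold ball; simpl; unfold AbsRing_ball, abs, minus,
    plus, opp; simpl.
  rewrite atan_opp; intros H; rewrite <- Rabs_Ropp.
  replace (- (atan x + - - (PI / 2))) with (- atan x + - (PI / 2)) by ring; exact H.
Qed.

Definition convex (D : R -> Prop) : Prop :=
  forall a b x, D a -> D b -> a <= x <= b -> D x.

(* Antiderivatives live on the open set [O], while the integrand is dominated only on the
   interval [D], which contains the tails of both filters. *)
Record good (O D : R -> Prop) (Fa Fb : (R -> Prop) -> Prop) : Prop := {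
  good_open : forall x, O x -> locally x O;
  good_convO : convex O;
  good_sub : forall x, D x -> O x;
  good_conv : convex D;
  good_a : Fa D;
  good_b : Fb D;
  good_pa : ProperFilter Fa;
  good_pb : ProperFilter Fb;
  good_la : exists l, filterlim atan Fa (locally l);
  good_lb : exists l, filterlim atan Fb (locally l) }.

(** With filters as endpoints, a single notion covers proper endpoints ([at_point]), [0+] and
    infinity; linearity, reflection and integration by parts become operations on [H]. *)
Definition IntD (O : R -> Prop) (Fa Fb : (R -> Prop) -> Prop) (f : R -> C) (l : C) : Prop :=
  exists H la lb, (forall x, O x -> Cder H x (f x)) /\ Clim Fa H la /\ Clim Fb H lb /\
    l = (lb - la)%C.

Definition allR (x : R) : Prop := True.
Definition posR (x : R) : Prop := 0 < x.

Lemma good_R : good allR allR (Rbar_locally m_infty) (Rbar_locally p_infty).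
Proof.
  split; try (unfold convex; intros; exact I); try apply Rbar_locally_filter;
    try (intros; apply filter_forall; intros; exact I).
  - eexists; apply atan_lim_m.
  - eexists; apply atan_lim_p.
Qed.

Lemma filterlim_atan_loc a : filterlim atan (locally a) (locally (atan a)).
Proof.
  apply (ex_derive_continuous atan); eexists; apply is_derive_atan.
Qed.

Lemma good_pos : good posR posR (at_right 0) (Rbar_locally p_infty).
Proof.
  split; unfold posR; try apply Rbar_locally_filter; try apply at_right_proper_filter.
  - apply locally_pos.
  - intros a b x; lra.
  - auto.
  - intros a b x; lra.
  - exists (mkposreal 1 Rlt_0_1); auto.
  - exists 0; auto.
  - exists (atan 0).
    eapply filterlim_filter_le_1; [|apply filterlim_atan_loc].
    apply filter_le_within.
  - eexists; apply atan_lim_p.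
Qed.

Lemma filterlim_at_point (g : R -> R) a : filterlim g (at_point a) (locally (g a)).
Proof. intros P HP; apply (locally_singleton _ _ HP). Qed.

(** Antiderivatives live on all of [x > 0], where [Rpower x b] is smooth, and so are differentiable
    at the endpoint [a]; domination is asked only from [a] on, since it may fail near 0. *)
Lemma good_from a : 0 < a ->
  good posR (fun x => a <= x) (at_point a) (Rbar_locally p_infty).
Proof.
  intros Ha.
  split; unfold posR; try apply Rbar_locally_filter; try apply (@at_point_filter R_UniformSpace).
  - apply locally_pos.
  - intros b c x; lra.
  - intros; lra.
  - intros b c x; lra.
  - unfold at_point; lra.
  - exists a; intros; lra.
  - eexists; apply filterlim_at_point.
  - eexists; apply atan_lim_p.
Qed.

Lemma good_seg a b : a <= b -> good allR (fun x => a <= x <= b) (at_point a) (at_point b).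
Proof.
  intros Hab.
  split; try (unfold convex; intros; exact I); try apply (@at_point_filter R_UniformSpace).
  - intros; apply filter_forall; intros; exact I.
  - intros c d x; lra.
  - unfold at_point; lra.
  - unfold at_point; lra.
  - unfold at_point; lra.
  - unfold at_point; lra.
  - eexists; apply filterlim_at_point.
  - eexists; apply filterlim_at_point.
Qed.

Section Integral.

Context {O D : R -> Prop} {Fa Fb : (R -> Prop) -> Prop} (G : good O D Fa Fb).

Let PFa : ProperFilter Fa := good_pa _ _ _ _ G.
Let PFb : ProperFilter Fb := good_pb _ _ _ _ G.
#[local] Existing Instance PFa.
#[local] Existing Instance PFb.

Lemma IntD_prim H f la lb : (forall x, O x -> Cder H x (f x)) ->
  Clim Fa H la -> Clim Fb H lb -> IntD O Fa Fb f (lb - la)%C.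
Proof. intros; exists H, la, lb; auto. Qed.

Lemma IntD_plus f g a b : IntD O Fa Fb f a -> IntD O Fa Fb g b ->
  IntD O Fa Fb (fun x => f x + g x)%C (a + b)%C.
Proof.
  intros (H & la & lb & D1 & A1 & B1 & ->) (H' & la' & lb' & D2 & A2 & B2 & ->).
  replace (lb - la + (lb' - la'))%C with ((lb + lb') - (la + la'))%C by ring.
  apply IntD_prim with (fun x => H x + H' x)%C.
  - intros x Hx; apply Cder_plus; auto.
  - apply Clim_plus; auto; apply PFa.
  - apply Clim_plus; auto; apply PFb.
Qed.

Lemma IntD_scal c f a : IntD O Fa Fb f a -> IntD O Fa Fb (fun x => c * f x)%C (c * a)%C.
Proof.
  intros (H & la & lb & D1 & A1 & B1 & ->).
  replace (c * (lb - la))%C with (c * lb - c * la)%C by ring.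
  apply IntD_prim with (fun x => c * H x)%C.
  - intros x Hx; apply Cder_scal; auto.
  - apply Clim_scal; auto; apply PFa.
  - apply Clim_scal; auto; apply PFb.
Qed.

Lemma IntD_ext f g a : (forall x, O x -> f x = g x) -> IntD O Fa Fb f a -> IntD O Fa Fb g a.
Proof.
  intros E (H & la & lb & D1 & A1 & B1 & ->).
  apply IntD_prim with H; auto.
  intros x Hx; rewrite <- E; auto.
Qed.

(** [M * atan] is an antiderivative of the dominating function, so [Cder_dom] compares the
    increments. *)
Lemma antiderivative_le H f M u v : (forall x, O x -> Cder H x (f x)) ->
  (forall x, D x -> Cmod (f x) <= M / (1 + x²)) -> D u -> D v ->
  Cmod (H v - H u)%C <= M * Rabs (atan v - atan u).
Proof.
  intros DH B.
  assert (W : forall u v, u <= v -> D u -> D v -> Cmod (H v - H u)%C <= M * (atan v - atan u)).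
  { clear u v; intros u v Huv Du Dv.
    replace (M * (atan v - atan u)) with (M * atan v - M * atan u) by ring.
    apply (Cder_dom H f (fun t => M * atan t) (fun t => M / (1 + t²)));
      [exact Huv| | |].
    - intros t Ht; apply DH, (good_sub _ _ _ _ G), (good_conv _ _ _ _ G u v); auto.
    - intros t _; apply is_derive_scal, is_derive_atan.
    - intros t Ht; apply B, (good_conv _ _ _ _ G u v); auto. }
  intros Du Dv; destruct (Rle_dec u v) as [L|L].
  - rewrite Rabs_pos_eq; auto.
    destruct (Req_dec u v) as [->|N]; [lra|].
    generalize (atan_increasing u v ltac:(lra)); lra.
  - assert (L' : v < u) by lra.
    rewrite Cmod_minus_sym, Rabs_minus_sym, Rabs_pos_eq; [apply W; auto; lra|].
    generalize (atan_increasing v u L'); lra.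
Qed.

(** [PI] bounds every increment of [atan]; the estimate then passes to the limit at both ends. *)
Lemma IntD_bound f l M : 0 <= M -> IntD O Fa Fb f l ->
  (forall x, D x -> Cmod (f x) <= M / (1 + x²)) -> Cmod l <= M * PI.
Proof.
  intros HM (H & la & lb & D1 & A1 & B1 & ->) B.
  apply le_epsilon; intros e He.
  destruct (filter_ex (F:=Fa) _ (filter_and (F:=Fa) _ _ (good_a _ _ _ _ G) (A1 (e / 2) ltac:(lra))))
    as [u [Du Hu]].
  destruct (filter_ex (F:=Fb) _ (filter_and (F:=Fb) _ _ (good_b _ _ _ _ G) (B1 (e / 2) ltac:(lra))))
    as [v [Dv Hv]].
  rewrite Cmod_minus_sym in Hv.
  replace (lb - la)%C with ((lb - H v) + (H v - H u) + (H u - la))%C by ring.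
  assert (X := antiderivative_le H f M u v D1 B Du Dv).
  assert (Rabs (atan v - atan u) <= PI).
  { generalize (atan_bound u) (atan_bound v); intros; apply Rabs_le; lra. }
  assert (M * Rabs (atan v - atan u) <= M * PI) by (apply Rmult_le_compat_l; auto).
  eapply Rle_trans; [apply Cmod_triangle|].
  assert (Y := Cmod_triangle (lb - H v)%C (H v - H u)%C).
  lra.
Qed.

(** The difference of the two values is an integral of the zero function, so [IntD_bound] applies
    with constant 0. *)
Lemma IntD_unique f a b : IntD O Fa Fb f a -> IntD O Fa Fb f b -> a = b.
Proof.
  intros Ha Hb.
  assert (X := IntD_plus _ _ _ _ Ha (IntD_scal (-1)%C _ _ Hb)).
  apply (IntD_bound _ _ 0) in X; [|lra|].
  - assert (E : (a + -1 * b)%C = RtoC 0).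
    { apply Cmod_eq_0; generalize (Cmod_ge_0 (a + -1 * b)%C); lra. }
    replace a with ((a + -1 * b) + b)%C by ring; rewrite E; ring.
  - intros x _; replace (f x + -1 * f x)%C with (RtoC 0) by ring.
    rewrite Cmod_0; unfold Rdiv; lra.
Qed.

Lemma antiderivative_ex f : (forall x, O x -> Ccont f x) ->
  exists H, forall x, O x -> Cder H x (f x).
Proof.
  intros Hc.
  destruct (filter_ex (F:=Fa) _ (good_a _ _ _ _ G)) as [x0 Hx0].
  apply (good_sub _ _ _ _ G) in Hx0.
  assert (W : forall g : R -> R, (forall x, O x -> continuous g x) ->
     forall x, O x -> is_derive (fun y => RInt g x0 y) x (g x)).
  { intros g Hg x Hx; apply (is_derive_RInt g _ x0); [|apply Hg, Hx].
    generalize (good_open _ _ _ _ G x Hx); apply filter_imp; intros y Hy.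
    apply (@RInt_correct R_CompleteNormedModule), ex_RInt_continuous.
    intros z Hz; apply Hg.
    destruct (Rle_dec x0 y).
    - rewrite Rmin_left, Rmax_right in Hz by lra.
      apply (good_convO _ _ _ _ G x0 y); auto.
    - rewrite Rmin_right, Rmax_left in Hz by lra.
      apply (good_convO _ _ _ _ G y x0); auto. }
  exists (fun y => (RInt (fun t => fst (f t)) x0 y, RInt (fun t => snd (f t)) x0 y)).
  intros x Hx; split; simpl.
  - apply (W (fun t => fst (f t))); auto; intros; apply Hc; auto.
  - apply (W (fun t => snd (f t))); auto; intros; apply Hc; auto.
Qed.

(** Increments of an antiderivative are controlled by those of [atan], which converges along both
    filters; hence the antiderivative is Cauchy there. *)
Lemma IntD_ex f M : (forall x, O x -> Ccont f x) ->
  (forall x, D x -> Cmod (f x) <= M / (1 + x²)) -> exists l, IntD O Fa Fb f l.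
Proof.
  intros Hc B.
  assert (HM : 0 <= M).
  { destruct (filter_ex (F:=Fa) _ (good_a _ _ _ _ G)) as [x Hx].
    assert (Y := Rle_trans _ _ _ (Cmod_ge_0 _) (B x Hx)).
    assert (0 <= x²) by apply Rle_0_sqr.
    replace M with (M / (1 + x²) * (1 + x²)) by (field; lra).
    apply Rmult_le_pos; lra. }
  destruct (antiderivative_ex f Hc) as [H DH].
  assert (W : forall F : (R -> Prop) -> Prop, ProperFilter F -> F D ->
     (exists l, filterlim atan F (locally l)) -> exists l, Clim F H l).
  { intros F PF FD Hl; apply (Clim_cauchy F); intros e He.
    assert (He2 : 0 < e / (M + 1)) by (apply Rdiv_lt_0_compat; lra).
    destruct (proj2 (@filterlim_locally_cauchy R R_CompleteSpace F _ atan) Hl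
                (mkposreal _ He2)) as [P [FP HP]].
    exists (fun x => P x /\ D x); split; [apply filter_and; auto|].
    intros u v [Pu Du] [Pv Dv].
    eapply Rle_lt_trans; [apply (antiderivative_le H f M v u); auto|].
    assert (X : Rabs (atan u - atan v) < e / (M + 1)) by exact (HP v u Pv Pu).
    apply Rle_lt_trans with (M * (e / (M + 1))); [apply Rmult_le_compat_l; lra|].
    apply Rlt_le_trans with ((M + 1) * (e / (M + 1))).
    - apply Rmult_lt_compat_r; lra.
    - apply Req_le; field; lra. }
  destruct (W Fa PFa (good_a _ _ _ _ G) (good_la _ _ _ _ G)) as [la HA].
  destruct (W Fb PFb (good_b _ _ _ _ G) (good_lb _ _ _ _ G)) as [lb HB].
  exists (lb - la)%C; apply IntD_prim with H; auto.
Qed.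

(** Dominating the second parameter derivative bounds the first-order Taylor remainder pointwise by
    [M d^2 / (1 + x^2)]; integrated, it is a quadratic remainder for [Phi], and [Cder_quad]
    concludes. *)
Lemma IntD_param (f g h : R -> R -> C) t0 r M (Phi : R -> C) l :
  0 < r -> 0 <= M ->
  (forall t x, Rabs (t - t0) < r -> O x -> Cder (fun t => f t x) t (g t x)) ->
  (forall t x, Rabs (t - t0) < r -> O x -> Cder (fun t => g t x) t (h t x)) ->
  (forall t x, Rabs (t - t0) < r -> D x -> Cmod (h t x) <= M / (1 + x²)) ->
  (forall t, Rabs (t - t0) < r -> IntD O Fa Fb (f t) (Phi t)) ->
  IntD O Fa Fb (g t0) l -> Cder Phi t0 l.
Proof.
  intros Hr HM Hf Hg Hh HP Hl.
  apply (Cder_quad _ _ _ r (M * PI) Hr).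
  intros d Hd.
  assert (X : IntD O Fa Fb (fun x => f (t0 + d)%R x + -1 * f t0 x + (- RtoC d) * g t0 x)%C
                (Phi (t0 + d)%R + -1 * Phi t0 + (- RtoC d) * l)%C).
  { apply (IntD_plus (fun x => f (t0 + d)%R x + -1 * f t0 x)%C).
    - apply IntD_plus; [|apply IntD_scal]; apply HP.
      + replace (t0 + d - t0) with d by ring; exact Hd.
      + rewrite Rminus_diag, Rabs_R0; exact Hr.
    - apply IntD_scal, Hl. }
  apply (IntD_bound _ _ (M * d ^ 2)) in X.
  - replace (M * PI * d ^ 2) with (M * d ^ 2 * PI) by ring.
    eapply Rle_trans; [|exact X]; apply Req_le; f_equal; ring.
  - apply Rmult_le_pos; [exact HM|apply pow2_ge_0].
  - intros x Dx.
    assert (Ox := good_sub _ _ _ _ G x Dx).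
    set (m := M / (1 + x²)).
    assert (near : forall t, Rmin t0 (t0 + d) <= t <= Rmax t0 (t0 + d) ->
                     Rabs (t - t0) <= Rabs d).
    { intros t; unfold Rmin, Rmax; destruct (Rle_dec t0 (t0 + d)); intros Ht;
      unfold Rabs; destruct (Rcase_abs (t - t0)), (Rcase_abs d); lra. }
    assert (Lg : forall t, Rmin t0 (t0 + d) <= t <= Rmax t0 (t0 + d) ->
                   Cmod (g t x - g t0 x)%C <= m * Rabs d).
    { intros t Ht; apply Rle_trans with (m * Rabs (t - t0)).
      - assert (Y : forall y, Rmin t0 t <= y <= Rmax t0 t -> Rabs (y - t0) < r).
        { intros y Hy; apply near in Ht.
          apply Rle_lt_trans with (Rabs (t - t0)); [|lra].
          revert Hy; unfold Rmin, Rmax; destruct (Rle_dec t0 t); intros Hy;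
          unfold Rabs; destruct (Rcase_abs (t - t0)), (Rcase_abs (y - t0)); lra. }
        apply (Cder_lip (fun t => g t x) (fun t => h t x)).
        + intros y Hy; apply Hg; auto.
        + intros y Hy; apply Hh; auto.
      - apply Rmult_le_compat_l; [|apply near, Ht].
        eapply Rle_trans; [apply Cmod_ge_0|apply (Hh t0 x); auto].
        rewrite Rminus_diag, Rabs_R0; exact Hr. }
    (* Without its linear part [t * g t0 x], the function of [t] has derivative [g t x - g t0 x],
       which is [O(d)], and hence an increment that is [O(d^2)]. *)
    assert (Z := Cder_lip (fun t => f t x - RtoC t * g t0 x)%C
                  (fun t => g t x - g t0 x)%C (m * Rabs d) t0 (t0 + d)).
    replace (M * d ^ 2 / (1 + x²)) with (m * Rabs d * Rabs (t0 + d - t0)).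
    + eapply Rle_trans; [|apply Z].
      * apply Req_le; f_equal; rewrite RtoC_plus; ring.
      * intros t Ht; apply Cder_minus.
        -- apply Hf; auto; apply near in Ht; lra.
        -- eapply Cder_eq; [apply Cder_mult; [|apply Cder_const]|].
           ++ apply Cder_RtoC, (@is_derive_id R_AbsRing).
           ++ cbv beta; change one with 1; ring.
      * exact Lg.
    + replace (t0 + d - t0) with d by ring.
      unfold m, Rdiv; rewrite <- (pow2_abs d); ring.
Qed.

(** Agreement of [f0] and [f] is asked only strictly between points of [D]: the actual integrand may
    take another value at an endpoint, as [sgn] and the powers do at 0. *)
Lemma IntD_RInt_gen f f0 l :
  IntD O Fa Fb f l -> (forall x, O x -> Ccont f x) ->
  (forall a b x, D a -> D b -> a < x < b -> f0 x = f x) ->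
  is_RInt_gen f0 Fa Fb l.
Proof.
  intros (H & la & lb & D1 & A1 & B1 & ->) Hc E P [eps HP].
  assert (He2 : 0 < eps / 2) by (generalize (cond_pos eps); lra).
  unfold filtermapi.
  exists (fun a => D a /\ Cmod (H a - la)%C < eps / 2)
         (fun b => D b /\ Cmod (H b - lb)%C < eps / 2).
  - apply filter_and; [apply (good_a _ _ _ _ G)|apply A1, He2].
  - apply filter_and; [apply (good_b _ _ _ _ G)|apply B1, He2].
  - intros a b [Da Ha] [Db Hb]; simpl.
    exists (H b - H a)%C.
    assert (IN : forall x, Rmin a b <= x <= Rmax a b -> O x).
    { intros x Hx; apply (good_sub _ _ _ _ G).
      destruct (Rle_dec a b).
      - rewrite Rmin_left, Rmax_right in Hx by lra.
        apply (good_conv _ _ _ _ G a b); auto.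
      - rewrite Rmin_right, Rmax_left in Hx by lra.
        apply (good_conv _ _ _ _ G b a); auto. }
    split.
    + apply is_RInt_ext with f.
      { intros x Hx; symmetry; destruct (Rle_dec a b).
        - rewrite Rmin_left, Rmax_right in Hx by lra; apply (E a b); auto.
        - rewrite Rmin_right, Rmax_left in Hx by lra; apply (E b a); auto. }
      apply (is_RInt_fct_extend_pair f a b (fst (H b) - fst (H a)) (snd (H b) - snd (H a))).
      * apply (@is_RInt_derive R_CompleteNormedModule (fun t => fst (H t))
                (fun t => fst (f t))); intros x Hx.
        -- apply D1, IN, Hx.
        -- apply Hc, IN, Hx.
      * apply (@is_RInt_derive R_CompleteNormedModule (fun t => snd (H t))
                (fun t => snd (f t))); intros x Hx.
        -- apply D1, IN, Hx.
        -- apply Hc, IN, Hx.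
    + apply HP.
      assert (K : Cmod ((H b - H a) - (lb - la))%C < eps).
      { replace ((H b - H a) - (lb - la))%C with ((H b - lb) - (H a - la))%C by ring.
        eapply Rle_lt_trans; [apply Cmod_triangle_minus|lra]. }
      split; eapply Rle_lt_trans; try exact K.
      * apply (fst_le_Cmod ((H b - H a) - (lb - la))%C).
      * apply (snd_le_Cmod ((H b - H a) - (lb - la))%C).
Qed.

End Integral.

(** * Schwartz functions and their Fourier transforms *)

(** The successive derivatives are carried along as a sequence, so that products with [x],
    reflections and Fourier transforms can exhibit theirs explicitly instead of computing
    [Derive_n]. *)
Definition sch (F : nat -> R -> C) : Prop :=
  (forall n x, Cder (F n) x (F (S n) x)) /\
  (forall m n : nat, exists M, forall x, Rabs x ^ m * Cmod (F n x) <= M).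

Definition Sch (f : R -> C) : Prop := exists F, sch F /\ forall x, F 0%nat x = f x.

Lemma Schwartz_sch phi : Schwartz phi -> sch (fun n => Dn n phi).
Proof.
  intros [H1 H2]; split; [|exact H2].
  intros n x; destruct (H1 n x) as [A B]; split; apply Derive_correct; assumption.
Qed.

Lemma sch_shift F : sch F -> sch (fun n => F (S n)).
Proof. intros [H1 H2]; split; intros; auto. Qed.

Lemma sch_Sch F : sch F -> Sch (F 0%nat).
Proof. intros H; exists F; auto. Qed.

Lemma Sch_ext f g : (forall x, f x = g x) -> Sch f -> Sch g.
Proof. intros E (F & HF & H0); exists F; split; auto; intros; rewrite H0; auto. Qed.

Lemma Sch_der f : Sch f -> exists f', Sch f' /\ forall x, Cder f x (f' x).
Proof.
  intros (F & HF & H0); exists (F 1%nat); split.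
  - exists (fun n => F (S n)); split; [apply sch_shift, HF|reflexivity].
  - intros x; apply (Cder_ext (F 0%nat)); [exact H0|apply HF].
Qed.

Lemma Sch_cont f x : Sch f -> Ccont f x.
Proof. intros H; destruct (Sch_der f H) as (f' & _ & D); eapply Cder_cont, D. Qed.

Lemma Sch_bound f m : Sch f ->
  exists M, 0 <= M /\ forall x, Rabs x ^ m * Cmod (f x) <= M.
Proof.
  intros (F & [_ HF] & H0); destruct (HF m 0%nat) as [M HM]; exists M; split.
  - eapply Rle_trans; [|apply (HM 0)].
    apply Rmult_le_pos; [apply pow_le, Rabs_pos|apply Cmod_ge_0].
  - intros x; rewrite <- H0; apply HM.
Qed.

Lemma one_plus_sqr_pos x : 0 < 1 + x².
Proof. generalize (Rle_0_sqr x); lra. Qed.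

Lemma Sch_decay f m : Sch f ->
  exists M, 0 <= M /\ forall x, Rabs x ^ m * Cmod (f x) <= M / (1 + x²).
Proof.
  intros H; destruct (Sch_bound f m H) as (M1 & P1 & H1).
  destruct (Sch_bound f (m + 2) H) as (M2 & P2 & H2).
  exists (M1 + M2); split; [lra|]; intros x.
  apply Rmult_le_reg_r with (1 + x²); [apply one_plus_sqr_pos|].
  replace ((M1 + M2) / (1 + x²) * (1 + x²)) with (M1 + M2)
    by (field; apply Rgt_not_eq, one_plus_sqr_pos).
  rewrite Rmult_plus_distr_l, Rmult_1_r.
  apply Rplus_le_compat; [apply H1|].
  eapply Rle_trans; [|apply (H2 x)].
  rewrite pow_add, (pow2_abs x); unfold Rsqr; apply Req_le; ring.
Qed.

Lemma sch_scal c F : sch F -> sch (fun n x => c * F n x)%C.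
Proof.
  intros [D HF]; split.
  - intros n x; apply Cder_scal, D.
  - intros m n; destruct (HF m n) as [M HM]; exists (Cmod c * M); intros x.
    rewrite Cmod_mult.
    replace (Rabs x ^ m * (Cmod c * Cmod (F n x)))
      with (Cmod c * (Rabs x ^ m * Cmod (F n x))) by ring.
    apply Rmult_le_compat_l; [apply Cmod_ge_0|apply HM].
Qed.

Lemma Sch_scal c f : Sch f -> Sch (fun x => c * f x)%C.
Proof.
  intros (F & HF & H0); exists (fun n x => c * F n x)%C; split; [apply sch_scal, HF|].
  intros x; cbv beta; rewrite H0; reflexivity.
Qed.

Lemma sch_plus F G : sch F -> sch G -> sch (fun n x => F n x + G n x)%C.
Proof.
  intros [D HF] [D' HG]; split.
  - intros n x; apply Cder_plus; auto.
  - intros m n; destruct (HF m n) as [M HM], (HG m n) as [M' HM'].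
    exists (M + M'); intros x.
    apply Rle_trans with (Rabs x ^ m * (Cmod (F n x) + Cmod (G n x))).
    + apply Rmult_le_compat_l; [apply pow_le, Rabs_pos|apply Cmod_triangle].
    + rewrite Rmult_plus_distr_l; apply Rplus_le_compat; auto.
Qed.

Lemma Sch_plus f g : Sch f -> Sch g -> Sch (fun x => f x + g x)%C.
Proof.
  intros (F & HF & H0) (G & HG & H0'); exists (fun n x => F n x + G n x)%C; split;
    [apply sch_plus; assumption|].
  intros x; cbv beta; rewrite H0, H0'; reflexivity.
Qed.

Lemma sch_refl F : sch F -> sch (fun n x => RtoC ((-1) ^ n) * F n (- x)%R)%C.
Proof.
  intros [D HF]; split.
  - intros n x; eapply Cder_eq.
    + apply Cder_scal, Cder_opp_arg, D.
    + simpl; rewrite RtoC_mult; ring.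
  - intros m n; destruct (HF m n) as [M HM]; exists M; intros x.
    rewrite Cmod_mult, Cmod_R, pow_1_abs, Rmult_1_l, <- (Rabs_Ropp x); apply HM.
Qed.

Lemma Sch_refl f : Sch f -> Sch (fun x => f (- x)).
Proof.
  intros (F & HF & H0); eexists; split; [apply sch_refl, HF|].
  intros x; simpl; rewrite H0; ring.
Qed.

Lemma Sch_mulx f : Sch f -> Sch (fun x => RtoC x * f x)%C.
Proof.
  intros (F & [D HF] & H0).
  (* Leibniz rule for [x f]. At [n = 0] the value [pred 0 = 0] is harmless because its coefficient
     [INR 0] vanishes. *)
  exists (fun n x => RtoC x * F n x + RtoC (INR n) * F (pred n) x)%C; split; [split|].
  - intros n x; eapply Cder_eq.
    + apply Cder_plus; [apply Cder_mult; [|apply D]|apply Cder_scal, D].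
      apply Cder_RtoC, (@is_derive_id R_AbsRing).
    + cbv beta; change one with 1; destruct n.
      * simpl; ring.
      * rewrite (S_INR (S n)); simpl pred; rewrite RtoC_plus; ring.
  - intros m n; destruct (HF (S m) n) as [M HM], (HF m (pred n)) as [M' HM'].
    exists (M + INR n * M'); intros x.
    apply Rle_trans with (Rabs x ^ m * (Rabs x * Cmod (F n x) + INR n * Cmod (F (pred n) x))).
    + apply Rmult_le_compat_l; [apply pow_le, Rabs_pos|].
      eapply Rle_trans; [apply Cmod_triangle|].
      rewrite !Cmod_mult, !Cmod_R, (Rabs_pos_eq (INR n)) by apply pos_INR; lra.
    + replace (Rabs x ^ m * (Rabs x * Cmod (F n x) + INR n * Cmod (F (pred n) x)))
        with (Rabs x ^ (S m) * Cmod (F n x) + INR n * (Rabs x ^ m * Cmod (F (pred n) x)))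
        by (simpl; ring).
      apply Rplus_le_compat; [apply HM|].
      apply Rmult_le_compat_l; [apply pos_INR|apply HM'].
  - intros x; simpl; rewrite H0; ring.
Qed.

Lemma Cmod_cexp z : Cmod (cexp z) = exp (fst z).
Proof.
  unfold cexp, Cmod; simpl.
  replace (_ + _) with (exp (fst z) * exp (fst z) * ((sin (snd z))² + (cos (snd z))²))
    by (unfold Rsqr; ring).
  rewrite sin2_cos2, Rmult_1_r; apply sqrt_square; left; apply exp_pos.
Qed.

Lemma Cmod_cexp_i y : Cmod (cexp (0, y)) = 1.
Proof. rewrite Cmod_cexp; apply exp_0. Qed.

Lemma cexp_plus a b : cexp (a + b)%C = (cexp a * cexp b)%C.
Proof.
  unfold cexp; apply injective_projections; simpl;
  rewrite exp_plus, ?cos_plus, ?sin_plus; ring.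
Qed.

Lemma cexp_0 : cexp 0%C = 1%C.
Proof.
  unfold cexp; simpl; rewrite exp_0, cos_0, sin_0.
  apply injective_projections; simpl; ring.
Qed.

Lemma Cder_eix (y : R -> R) (x l : R) : is_derive y x l ->
  Cder (fun t => cexp (0, y t)) x (Ci * RtoC l * cexp (0, y x)%R)%C.
Proof.
  intros H; apply (Cder_eq _ _ ((0, l) * cexp (0, y x))%C).
  - apply (Cder_cexp (fun t => (0, y t))); split; simpl; [|exact H].
    apply (@is_derive_const R_AbsRing R_NormedModule).
  - f_equal; apply injective_projections; simpl; ring.
Qed.

Notation IntR := (IntD allR (Rbar_locally m_infty) (Rbar_locally p_infty)).
Notation Int0 := (IntD posR (at_right 0) (Rbar_locally p_infty)).

(** A choice makes the transform a total function; on Schwartz functions the integral exists, and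
    [IntD_unique] pins its value down ([Four_eq]). *)
Definition Four (f : R -> C) (k : R) : C :=
  epsilon (inhabits (RtoC 0)) (IntR (fun x => f x * cexp (0, (- (k * x))%R))%C).

Lemma eikx_cont k x : Ccont (fun x => cexp (0, - (k * x))) x.
Proof.
  eapply Cder_cont, (Cder_eix (fun x => - (k * x))).
  auto_derive; [exact I|reflexivity].
Qed.

Lemma Ccont_mult f g x : Ccont f x -> Ccont g x -> Ccont (fun x => f x * g x)%C x.
Proof.
  intros [F1 F2] [G1 G2]; split; simpl.
  - apply (continuous_minus (fun t => fst (f t) * fst (g t)) (fun t => snd (f t) * snd (g t)));
      apply (continuous_mult (K := R_AbsRing)); assumption.
  - apply (continuous_plus (fun t => fst (f t) * snd (g t)) (fun t => snd (f t) * fst (g t)));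
      apply (continuous_mult (K := R_AbsRing)); assumption.
Qed.

Lemma Four_spec f k : Sch f -> IntR (fun x => f x * cexp (0, (- (k * x))%R))%C (Four f k).
Proof.
  intros H; unfold Four; apply epsilon_spec.
  destruct (Sch_decay f 0 H) as (M & PM & HM).
  apply (IntD_ex good_R _ M).
  - intros x _; apply Ccont_mult; [apply Sch_cont, H|apply eikx_cont].
  - intros x _; rewrite Cmod_mult, Cmod_cexp_i, Rmult_1_r.
    generalize (HM x); simpl; lra.
Qed.

Lemma Four_eq f k l : Sch f ->
  IntR (fun x => f x * cexp (0, (- (k * x))%R))%C l -> Four f k = l.
Proof. intros H; apply (IntD_unique good_R), Four_spec, H. Qed.

Lemma Four_ext f g k : (forall x, f x = g x) -> Sch f -> Four f k = Four g k.
Proof.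
  intros E H; symmetry; apply Four_eq; [apply (Sch_ext f); auto|].
  eapply IntD_ext; [|apply (Four_spec f), H].
  intros x _; simpl; rewrite E; reflexivity.
Qed.

Lemma Four_scal c f k : Sch f -> Four (fun x => c * f x)%C k = (c * Four f k)%C.
Proof.
  intros H; apply Four_eq; [apply Sch_scal, H|].
  eapply IntD_ext; [|apply (IntD_scal good_R c), (Four_spec f k), H].
  intros x _; simpl; ring.
Qed.

Lemma Clim_comp_opp_p H l : Clim (Rbar_locally p_infty) H l ->
  Clim (Rbar_locally m_infty) (fun x => H (- x)) l.
Proof.
  intros A e He; destruct (A e He) as [M HM]; exists (- M); intros x Hx; apply HM; lra.
Qed.

Lemma Clim_comp_opp_m H l : Clim (Rbar_locally m_infty) H l ->
  Clim (Rbar_locally p_infty) (fun x => H (- x)) l.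
Proof.
  intros A e He; destruct (A e He) as [M HM]; exists (- M); intros x Hx; apply HM; lra.
Qed.

Lemma Clim_opp {T} (F : (T -> Prop) -> Prop) {FF : Filter F} f l :
  Clim F f l -> Clim F (fun x => - f x)%C (- l)%C.
Proof.
  intros H e He; generalize (H e He); apply filter_imp; intros x Hx.
  rewrite <- Cmod_opp; replace (- (- f x - - l))%C with (f x - l)%C by ring; exact Hx.
Qed.

Lemma IntR_refl f l : IntR f l -> IntR (fun x => f (- x)) l.
Proof.
  intros (H & la & lb & D & A & B & ->).
  replace (lb - la)%C with (- la - - lb)%C by ring.
  apply IntD_prim with (fun x => - H (- x)%R)%C.
  - intros x _; eapply Cder_eq; [apply Cder_opp, Cder_opp_arg, D, I|ring].
  - apply (Clim_opp _ (fun x => H (- x))), Clim_comp_opp_p, B.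
  - apply (Clim_opp _ (fun x => H (- x))), Clim_comp_opp_m, A.
Qed.

Lemma Four_refl f k : Sch f -> Four (fun x => f (- x)) k = Four f (- k).
Proof.
  intros H; apply Four_eq; [apply Sch_refl, H|].
  eapply IntD_ext; [|apply IntR_refl, (Four_spec f (- k)), H].
  intros x _; simpl; f_equal; f_equal; f_equal; ring.
Qed.

Lemma Four_der f k : Sch f -> Cder (Four f) k (Four (fun x => - Ci * (RtoC x * f x))%C k).
Proof.
  intros H.
  (* Order 2, because [IntD_param] requires domination of the second derivative in [k], which brings
     down [x^2]. *)
  destruct (Sch_decay f 2 H) as (M & PM & HM).
  apply (IntD_param good_R (fun t x => f x * cexp (0, (- (t * x))%R))%C
    (fun t x => - Ci * (RtoC x * f x) * cexp (0, (- (t * x))%R))%C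
    (fun t x => - Ci * RtoC x * (- Ci * (RtoC x * f x)) * cexp (0, (- (t * x))%R))%C
    k 1 M); auto using Rlt_0_1.
  - intros t x _ _; eapply Cder_eq.
    + apply Cder_scal, (Cder_eix (fun t => - (t * x))).
      auto_derive; [exact I|reflexivity].
    + rewrite Rmult_1_l, RtoC_opp; ring.
  - intros t x _ _; eapply Cder_eq.
    + apply Cder_scal, (Cder_eix (fun t => - (t * x))).
      auto_derive; [exact I|reflexivity].
    + rewrite Rmult_1_l, RtoC_opp; ring.
  - intros t x _ _.
    rewrite !Cmod_mult, Cmod_cexp_i, Cmod_opp, Cmod_Ci, !Cmod_R.
    eapply Rle_trans; [|apply (HM x)]; apply Req_le; simpl; ring.
  - intros t _; apply Four_spec, H.
  - apply (Four_spec (fun x => - Ci * (RtoC x * f x))%C), Sch_scal, Sch_mulx, H.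
Qed.

Lemma Sch_Clim_p f : Sch f -> Clim (Rbar_locally p_infty) f 0%C.
Proof.
  intros H; destruct (Sch_bound f 1 H) as (M & PM & HM).
  intros e He; exists (M / e); intros x Hx.
  assert (P : 0 <= M / e) by (apply Rdiv_le_0_compat; lra).
  replace (f x - 0)%C with (f x) by ring.
  assert (X := HM x); simpl in X; rewrite Rabs_pos_eq in X by lra.
  apply Rmult_lt_reg_l with x; [lra|].
  apply Rle_lt_trans with M; [lra|].
  apply Rmult_lt_compat_r with (r := e) in Hx; [|exact He].
  unfold Rdiv in Hx; rewrite Rmult_assoc, Rinv_l, Rmult_1_r in Hx; lra.
Qed.

Lemma Sch_Clim_m f : Sch f -> Clim (Rbar_locally m_infty) f 0%C.
Proof.
  intros H; apply (Clim_ext _ (fun x => f (- - x))).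
  - apply filter_forall; intros x; rewrite Ropp_involutive; reflexivity.
  - apply Clim_comp_opp_p with (H := fun x => f (- x)), Sch_Clim_p, Sch_refl, H.
Qed.

(** Integration by parts: the derivative of [f(x) e^{-ikx}] integrates to 0, since [f] vanishes at
    both ends and the exponential has modulus 1. *)
Lemma Four_derivative f f' k : Sch f -> Sch f' -> (forall x, Cder f x (f' x)) ->
  Four f' k = (Ci * RtoC k * Four f k)%C.
Proof.
  intros H H' D; apply Four_eq; [exact H'|].
  replace (Ci * RtoC k * Four f k)%C with ((0 - 0) + (Ci * RtoC k) * Four f k)%C by ring.
  apply IntD_ext with (fun x =>
    (f' x * cexp (0, (- (k * x))%R) + f x * (Ci * RtoC (- k) * cexp (0, (- (k * x))%R)))
    + (Ci * RtoC k) * (f x * cexp (0, (- (k * x))%R)))%C.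
  { intros x _; rewrite RtoC_opp; ring. }
  apply (IntD_plus good_R); [|apply (IntD_scal good_R), Four_spec, H].
  apply IntD_prim with (fun x => f x * cexp (0, (- (k * x))%R))%C.
  - intros x _; apply Cder_mult; [apply D|].
    apply (Cder_eix (fun x => - (k * x))); auto_derive; [exact I|ring].
  - intros e He; generalize (Sch_Clim_m f H e He); apply filter_imp; intros x.
    replace (f x - 0)%C with (f x) by ring.
    match goal with |- _ -> Cmod ?a < _ =>
      replace a with (f x * cexp (0, (- (k * x))%R))%C by ring end.
    rewrite Cmod_mult, Cmod_cexp_i; lra.
  - intros e He; generalize (Sch_Clim_p f H e He); apply filter_imp; intros x.
    replace (f x - 0)%C with (f x) by ring.
    match goal with |- _ -> Cmod ?a < _ =>
      replace a with (f x * cexp (0, (- (k * x))%R))%C by ring end.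
    rewrite Cmod_mult, Cmod_cexp_i; lra.
Qed.

(** Each power of [k] is traded for a derivative of [f], down to the trivial bound of an absolutely
    convergent integral. *)
Lemma Four_bound f m : Sch f -> exists M, forall k, Rabs k ^ m * Cmod (Four f k) <= M.
Proof.
  revert f; induction m as [|m IH]; intros f H.
  - destruct (Sch_decay f 0 H) as (M & PM & HM); exists (M * PI); intros k.
    rewrite pow_O, Rmult_1_l.
    apply (IntD_bound good_R _ _ M PM (Four_spec f k H)).
    intros x _; rewrite Cmod_mult, Cmod_cexp_i, Rmult_1_r; generalize (HM x); simpl; lra.
  - destruct (Sch_der f H) as (f' & H' & D).
    destruct (IH f' H') as [M HM]; exists M; intros k.
    eapply Rle_trans; [|apply (HM k)].
    rewrite (Four_derivative f f' k H H' D), !Cmod_mult, Cmod_Ci, Cmod_R.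
    apply Req_le; simpl; ring.
Qed.

(** This is [(-i x)^n f], whose transform is the derivative of order [n] of the transform of [f]. *)
Fixpoint mulix (n : nat) (f : R -> C) : R -> C :=
  match n with
  | 0%nat => f
  | S n => fun x => (- Ci * (RtoC x * mulix n f x))%C
  end.

Lemma Sch_mulix n f : Sch f -> Sch (mulix n f).
Proof.
  intros H; induction n; simpl; [exact H|apply Sch_scal, Sch_mulx, IHn].
Qed.

Lemma sch_Four f : Sch f -> sch (fun n => Four (mulix n f)).
Proof.
  intros H; split.
  - intros n x; apply Four_der, Sch_mulix, H.
  - intros m n; apply Four_bound, Sch_mulix, H.
Qed.

Lemma Sch_Four f : Sch f -> Sch (Four f).
Proof. intros H; apply (sch_Sch _ (sch_Four f H)). Qed.

(** * Finite parts *)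

Lemma is_derive_Rpower b x : 0 < x ->
  is_derive (fun t => Rpower t b) x (b * Rpower x (b - 1)).
Proof. intros H; apply is_derive_Reals, derivable_pt_lim_power, H. Qed.

Lemma Cder_Rpower b x : 0 < x ->
  Cder (fun t => RtoC (Rpower t b)) x (RtoC (b * Rpower x (b - 1))).
Proof. intros H; apply Cder_RtoC, is_derive_Rpower, H. Qed.

Lemma Rpower_pos x b : 0 < Rpower x b.
Proof. apply exp_pos. Qed.

Lemma Cmod_Rpower x b : Cmod (RtoC (Rpower x b)) = Rpower x b.
Proof. rewrite Cmod_R; apply Rabs_pos_eq; left; apply Rpower_pos. Qed.

Lemma Rpower_le_neg a x p : 0 < a -> a <= x -> p <= 0 -> Rpower x p <= Rpower a p.
Proof.
  intros Ha Hx Hp; unfold Rpower.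
  assert (L : ln a <= ln x) by (apply ln_le; assumption).
  destruct (Req_dec (p * ln x) (p * ln a)) as [->|N]; [lra|].
  left; apply exp_increasing; nra.
Qed.

Lemma Rpower_shift x b (n : nat) : 0 < x -> Rpower x (b + INR n) = Rpower x b * x ^ n.
Proof. intros H; rewrite Rpower_plus, Rpower_pow; auto. Qed.

Lemma Rpower_shift1 x b : 0 < x -> Rpower x (b + 1) = Rpower x b * x.
Proof. intros H; rewrite Rpower_plus, Rpower_1; auto. Qed.

Lemma Rpower_le_pow a x b n : 0 < a -> a <= x -> b <= INR n ->
  Rpower x b <= Rpower a (b - INR n) * x ^ n.
Proof.
  intros Ha Hx Hb.
  replace b with ((b - INR n) + INR n) at 1 by ring.
  rewrite Rpower_shift by lra.
  apply Rmult_le_compat_r; [apply pow_le; lra|].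
  apply Rpower_le_neg; lra.
Qed.

Lemma INR_ge_ex b : exists n, b <= INR n.
Proof.
  destruct (archimed b) as [H _].
  exists (Z.to_nat (up b)).
  destruct (Z_le_gt_dec 0 (up b)) as [Hz|Hz].
  - rewrite INR_IZR_INZ, Z2Nat.id by lia; lra.
  - apply Rle_trans with 0; [|apply pos_INR].
    assert (IZR (up b) <= 0) by (apply IZR_le; lia); lra.
Qed.

Lemma Rpower_lim0 q : 0 < q -> filterlim (fun e => Rpower e q) (at_right 0) (locally 0).
Proof.
  intros Hq; apply filterlim_locally; intros [e He].
  assert (Hd : 0 < Rpower e (/ q)) by apply Rpower_pos.
  exists (mkposreal _ Hd); intros x Hx Hx0.
  change (Rabs (x - 0) < Rpower e (/ q)) in Hx.
  change (Rabs (Rpower x q - 0) < e).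
  rewrite Rminus_0_r, Rabs_pos_eq in * by (first [lra | left; apply Rpower_pos]).
  assert (X := Rlt_Rpower_l x (Rpower e (/ q)) q Hq (conj Hx0 Hx)).
  rewrite Rpower_mult, Rinv_l, Rpower_1 in X by lra; exact X.
Qed.

Lemma Rpower_lim_infty p : p < 0 ->
  filterlim (fun e => Rpower e p) (Rbar_locally p_infty) (locally 0).
Proof.
  intros Hp; apply filterlim_locally; intros [e He].
  exists (Rpower e (/ p)); intros x Hx.
  assert (Hd : 0 < Rpower e (/ p)) by apply Rpower_pos.
  change (Rabs (Rpower x p - 0) < e).
  rewrite Rminus_0_r, Rabs_pos_eq by (left; apply Rpower_pos).
  assert (X : Rpower (Rpower e (/ p)) p = e).
  { rewrite Rpower_mult, Rinv_l, Rpower_1 by lra; reflexivity. }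
  rewrite <- X; unfold Rpower at 1 2; apply exp_increasing.
  assert (ln (Rpower e (/ p)) < ln x) by (apply ln_increasing; assumption).
  nra.
Qed.

Lemma filterlim_Rscal0 {T} (F : (T -> Prop) -> Prop) {FF : Filter F} (g : T -> R) c :
  filterlim g F (locally 0) -> filterlim (fun x => c * g x) F (locally 0).
Proof.
  intros H.
  assert (X : filterlim (fun x => c * g x) F (locally (c * 0))).
  { eapply filterlim_comp; [exact H|apply (filterlim_scal_r (V := R_NormedModule) c 0)]. }
  rewrite Rmult_0_r in X; exact X.
Qed.

Definition FP (F : R -> C) (L : C) : Prop :=
  exists (l : list (R * C)) (b : C), List.Forall (fun p => 0 < fst p) l /\
    Clim (at_right 0) (fun e => F e - divergent_part l b e)%C L.

Lemma FP_finite_part F L : FP F L -> finite_part F L.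
Proof.
  intros (l & b & H1 & H2); exists l, b; split; [exact H1|].
  apply Clim_filterlim; [apply at_right_proper_filter|exact H2].
Qed.

Lemma at_right_pos (P : R -> Prop) : (forall e, 0 < e -> P e) -> at_right 0 P.
Proof. intros H; exists (mkposreal 1 Rlt_0_1); auto. Qed.

Lemma FP_ext F G L : (forall e, 0 < e -> F e = G e) -> FP F L -> FP G L.
Proof.
  intros E (l & b & H1 & H2); exists l, b; split; [exact H1|].
  eapply Clim_ext; [| |exact H2]; [apply at_right_proper_filter|].
  apply at_right_pos; intros e He; rewrite E; auto.
Qed.

Lemma FP_lim F L : Clim (at_right 0) F L -> FP F L.
Proof.
  intros H; exists nil, 0%C; split; [constructor|].
  eapply Clim_ext; [| |exact H]; [apply at_right_proper_filter|].
  apply at_right_pos; intros e _; unfold divergent_part; simpl; ring.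
Qed.

Lemma divergent_part_app l1 l2 b1 b2 e :
  divergent_part (l1 ++ l2) (b1 + b2)%C e =
  (divergent_part l1 b1 e + divergent_part l2 b2 e)%C.
Proof.
  induction l1 as [|p l1 IH]; unfold divergent_part in *; simpl in *; [ring|].
  match goal with |- (?a + ?u + ?w = _)%C =>
    transitivity ((a + w) + u)%C; [ring|rewrite IH; ring] end.
Qed.

Lemma divergent_part_scal c l b e :
  divergent_part (map (fun p => (fst p, c * snd p)%C) l) (c * b)%C e =
  (c * divergent_part l b e)%C.
Proof.
  induction l as [|p l1 IH]; unfold divergent_part in *; simpl in *; [ring|].
  match goal with |- (?a + ?u + ?w = _)%C =>
    transitivity ((a + w) + u)%C; [ring|rewrite IH; ring] end.
Qed.

Lemma FP_plus F G a b : FP F a -> FP G b -> FP (fun e => F e + G e)%C (a + b)%C.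
Proof.
  intros (l1 & b1 & A1 & B1) (l2 & b2 & A2 & B2).
  exists (l1 ++ l2), (b1 + b2)%C; split; [apply Forall_app; auto|].
  eapply Clim_ext; [| |apply Clim_plus; [|exact B1|exact B2]];
    try apply at_right_proper_filter.
  apply at_right_pos; intros e _; simpl; rewrite divergent_part_app; ring.
Qed.

Lemma FP_scal c F a : FP F a -> FP (fun e => c * F e)%C (c * a)%C.
Proof.
  intros (l1 & b1 & A1 & B1).
  exists (map (fun p => (fst p, c * snd p)%C) l1), (c * b1)%C; split.
  - apply Forall_map; simpl; exact A1.
  - eapply Clim_ext; [| |apply (Clim_scal _ c), B1]; try apply at_right_proper_filter.
    apply at_right_pos; intros e _; simpl; rewrite divergent_part_scal; ring.
Qed.

(** A positive power tends to 0 and a negative one is a divergent term to be discarded; [q = 0] is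
    excluded because it would be the constant term itself. *)
Lemma FP_pow c q : q <> 0 -> FP (fun e => c * RtoC (Rpower e q))%C 0%C.
Proof.
  intros Hq; destruct (Rlt_dec 0 q) as [H|H].
  - apply FP_lim, (Clim_le _ _ (fun e => Cmod c * Rpower e q)).
    + apply at_right_pos; intros e _.
      replace (c * Rpower e q - 0)%C with (c * Rpower e q)%C by ring.
      rewrite Cmod_mult, Cmod_Rpower; lra.
    + apply filterlim_Rscal0, Rpower_lim0, H.
      apply at_right_proper_filter.
  - exists ((- q, c) :: nil), 0%C; split; [repeat constructor; simpl; lra|].
    eapply Clim_ext; [| |apply (Clim_const _ 0%C)]; try apply at_right_proper_filter.
    apply at_right_pos; intros e _; unfold divergent_part; simpl.
    rewrite Ropp_involutive; ring.
Qed.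

(** * Taylor expansion at 0 and boundary terms *)

Fixpoint tay (N : nat) (F : nat -> R -> C) (x : R) : C :=
  match N with
  | 0%nat => 0%C
  | S n => (tay n F x + F n 0%R * RtoC (x ^ n / INR (fact n)))%C
  end.

Lemma is_derive_pow_scal n c x :
  is_derive (fun t => t ^ S n / c) x (INR (S n) * x ^ n / c).
Proof.
  apply is_derive_ext with (fun t => / c * t ^ S n);
    [intros t; change (/ c * t ^ S n = t ^ S n / c); unfold Rdiv; ring|].
  replace (INR (S n) * x ^ n / c) with (/ c * (INR (S n) * x ^ n)) by (unfold Rdiv; ring).
  apply is_derive_scal, is_derive_Reals, (derivable_pt_lim_pow x (S n)).
Qed.

Lemma tay_der N F x : Cder (tay (S N) F) x (tay N (fun n => F (S n)) x).
Proof.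
  induction N as [|n IH].
  - eapply Cder_ext; [|apply (Cder_const (F 0%nat 0))].
    intros t; simpl; replace (1 / 1) with 1 by field; ring.
  - change (tay (S (S n)) F) with (fun x => tay (S n) F x +
      F (S n) 0%R * RtoC (x ^ (S n) / INR (fact (S n))))%C.
    change (tay (S n) (fun n => F (S n)) x) with (tay n (fun n => F (S n)) x +
      F (S n) 0%R * RtoC (x ^ n / INR (fact n)))%C.
    apply Cder_plus; [exact IH|]; apply Cder_scal, Cder_RtoC.
    evar_last; [apply is_derive_pow_scal|].
    rewrite fact_simpl, mult_INR; field.
    split; [apply INR_fact_neq_0|apply not_0_INR; lia].
Qed.

Lemma tay_0 N F : tay (S N) F 0 = F 0%nat 0.
Proof.
  induction N as [|n IH].
  - simpl; replace (1 / 1) with 1 by field; ring.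
  - change (tay (S (S n)) F 0%R) with (tay (S n) F 0%R +
      F (S n) 0%R * RtoC (0 ^ (S n) / INR (fact (S n))))%C.
    rewrite IH, pow_i by lia; unfold Rdiv; rewrite Rmult_0_l; ring.
Qed.

(** Integrating the estimate of order [N] for the derivative from 0, where the remainder vanishes,
    gains one power of [x]. The gained factor [1 / (N + 1)] is dropped, so the constant stays the
    same along the induction. *)
Lemma taylor N F : sch F ->
  exists M, 0 <= M /\ forall x, 0 <= x <= 1 -> Cmod (F 0%nat x - tay N F x)%C <= M * x ^ N.
Proof.
  revert F; induction N as [|N IH]; intros F HF.
  - destruct (Sch_bound _ 0 (sch_Sch F HF)) as (M & PM & HM); exists M; split; [exact PM|].
    intros x _; simpl; replace (F 0%nat x - 0)%C with (F 0%nat x) by ring.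
    generalize (HM x); simpl; lra.
  - destruct (IH _ (sch_shift F HF)) as (M & PM & HM); exists M; split; [exact PM|].
    intros x Hx.
    assert (X := Cder_dom (fun x => F 0%nat x - tay (S N) F x)%C
      (fun x => F 1%nat x - tay N (fun n => F (S n)) x)%C
      (fun x => M * x ^ S N / INR (S N)) (fun x => M * x ^ N) 0 x).
    cbv beta in X; rewrite tay_0, pow_i in X by lia.
    assert (PS : 0 < INR (S N)) by (apply lt_0_INR; lia).
    assert (P1 : 1 <= INR (S N)) by (apply (le_INR 1); lia).
    eapply Rle_trans; [|eapply Rle_trans; [apply X|]].
    + apply Req_le; f_equal; ring.
    + lra.
    + intros t Ht; apply Cder_minus; [apply HF|apply tay_der].
    (* Dividing by [INR (S N) / M] is multiplying by [M / INR (S N)], even for [M = 0], since the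
       inverse of 0 is 0; this brings the function to the shape of [is_derive_pow_scal]. *)
    + intros t Ht; apply is_derive_ext with (fun x => x ^ S N / (INR (S N) / M)).
      { intros y; change (y ^ S N / (INR (S N) / M) = M * y ^ S N / INR (S N)).
        unfold Rdiv; rewrite Rinv_mult, Rinv_inv; ring. }
      evar_last; [apply is_derive_pow_scal|].
      unfold Rdiv; rewrite Rinv_mult, Rinv_inv; field; lra.
    + intros t Ht; apply HM; lra.
    + assert (0 <= M * x ^ S N) by (apply Rmult_le_pos; [|apply pow_le]; lra).
      unfold Rdiv; rewrite Rmult_0_r, Rmult_0_l, Rminus_0_r.
      rewrite <- (Rmult_1_r (M * x ^ S N)) at 2.
      apply Rmult_le_compat_l; [assumption|].
      rewrite <- Rinv_1; apply Rinv_le_contravar; lra.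
Qed.

(** The Taylor term of order [j] contributes a multiple of [e^(b + j)], which has no constant term
    by [FP_pow] unless [b = -j]; there the hypothesis makes the coefficient 0. *)
Lemma FP_boundary F b : sch F -> (forall j, b = - INR j -> F j 0 = 0%C) ->
  FP (fun e => RtoC (Rpower e b) * F 0%nat e)%C 0%C.
Proof.
  intros HF Hb.
  assert (T : forall N, FP (fun e => RtoC (Rpower e b) * tay N F e)%C 0%C).
  { induction N as [|N IH].
    - eapply FP_ext; [|apply FP_lim, (Clim_const _ 0%C)].
      intros e _; simpl; ring.
    - replace (RtoC 0) with (0 + 0)%C by ring.
      apply FP_ext with (fun e => RtoC (Rpower e b) * tay N F e +
        RtoC (Rpower e b) * (F N 0%R * RtoC (e ^ N / INR (fact N))))%C.
      + intros e _; simpl; ring.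
      + apply FP_plus; [exact IH|].
        destruct (Req_dec (b + INR N) 0) as [E|E].
        * rewrite (Hb N) by lra.
          eapply FP_ext; [|apply FP_lim, (Clim_const _ 0%C)].
          intros e _; simpl; ring.
        * eapply FP_ext; [|apply (FP_pow (F N 0%R * RtoC (/ INR (fact N)))%C _ E)].
          intros e He; simpl; rewrite Rpower_shift by exact He.
          unfold Rdiv; rewrite !RtoC_mult; ring. }
  (* Enough Taylor terms for [b + N >= 1], so that the remainder tends to 0. *)
  destruct (INR_ge_ex (1 - b)) as [N HN].
  destruct (taylor N F HF) as (M & PM & HM).
  replace (RtoC 0) with (0 + 0)%C by ring.
  apply FP_ext with (fun e => RtoC (Rpower e b) * tay N F e +
    RtoC (Rpower e b) * (F 0%nat e - tay N F e))%C; [intros e _; ring|].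
  apply FP_plus; [apply (T N)|].
  apply FP_lim, (Clim_le _ _ (fun e => M * Rpower e (b + INR N))).
  - exists (mkposreal 1 Rlt_0_1); intros e He He0.
      change (Rabs (e - 0) < 1) in He; rewrite Rminus_0_r, Rabs_pos_eq in He by lra.
      replace (Rpower e b * (F 0%nat e - tay N F e) - 0)%C
        with (Rpower e b * (F 0%nat e - tay N F e))%C by ring.
      rewrite Cmod_mult, Cmod_Rpower, Rpower_shift by exact He0.
      replace (M * (Rpower e b * e ^ N)) with (Rpower e b * (M * e ^ N)) by ring.
      apply Rmult_le_compat_l; [left; apply Rpower_pos|apply HM; lra].
  - apply filterlim_Rscal0, Rpower_lim0; [apply at_right_proper_filter|lra].
Qed.

(** * Finite parts on the positive half-line *)

Notation IntFrom e := (IntD posR (at_point e) (Rbar_locally p_infty)).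

(** The negative half-line is folded into [w], so that a cancellation between the two sides becomes
    a parity property of [w] at 0. *)
Definition FP1 (b : R) (w : R -> C) (L : C) : Prop :=
  exists F, (forall e, 0 < e -> IntFrom e (fun x => RtoC (Rpower x b) * w x)%C (F e)) /\
    FP F L.

Lemma FP1_ext b b' w w' L :
  (forall x, 0 < x -> (RtoC (Rpower x b) * w x = RtoC (Rpower x b') * w' x)%C) ->
  FP1 b w L -> FP1 b' w' L.
Proof.
  intros E (F & H1 & H2); exists F; split; [|exact H2].
  intros e He; eapply IntD_ext; [|apply H1, He]; exact E.
Qed.

Lemma FP1_plus b w w' L L' : FP1 b w L -> FP1 b w' L' ->
  FP1 b (fun x => w x + w' x)%C (L + L')%C.
Proof.
  intros (F & H1 & H2) (F' & H1' & H2'); exists (fun e => F e + F' e)%C; split;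
    [|apply FP_plus; assumption].
  intros e He; eapply IntD_ext;
    [|apply (IntD_plus (good_from e He)); [apply H1, He|apply H1', He]].
  intros x _; simpl; ring.
Qed.

Lemma FP1_scal b c w L : FP1 b w L -> FP1 b (fun x => c * w x)%C (c * L)%C.
Proof.
  intros (F & H1 & H2); exists (fun e => c * F e)%C; split; [|apply FP_scal; assumption].
  intros e He; eapply IntD_ext; [|apply (IntD_scal (good_from e He)), H1, He].
  intros x _; simpl; ring.
Qed.

Lemma Rpower_Sch_cont b w x : Sch w -> 0 < x ->
  Ccont (fun x => RtoC (Rpower x b) * w x)%C x.
Proof.
  intros Hw Hx; apply Ccont_mult; [eapply Cder_cont, Cder_Rpower, Hx|apply Sch_cont, Hw].
Qed.

Lemma IntFrom_ex b w e : Sch w -> 0 < e ->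
  exists l, IntFrom e (fun x => RtoC (Rpower x b) * w x)%C l.
Proof.
  intros Hw He; destruct (INR_ge_ex b) as [n Hn].
  destruct (Sch_decay w n Hw) as (M & PM & HM).
  apply (IntD_ex (good_from e He) _ (Rpower e (b - INR n) * M)).
  - intros x Hx; apply Rpower_Sch_cont; assumption.
  - intros x Hx; rewrite Cmod_mult, Cmod_Rpower.
    assert (0 <= Cmod (w x)) by apply Cmod_ge_0.
    apply Rle_trans with (Rpower e (b - INR n) * x ^ n * Cmod (w x)).
    + apply Rmult_le_compat_r; [assumption|apply Rpower_le_pow; assumption].
    + unfold Rdiv; rewrite !Rmult_assoc.
      apply Rmult_le_compat_l; [left; apply Rpower_pos|].
      generalize (HM x); rewrite Rabs_pos_eq by lra; auto.
Qed.

Lemma Rpower_Sch_Clim b w : Sch w ->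
  Clim (Rbar_locally p_infty) (fun x => RtoC (Rpower x b) * w x)%C 0%C.
Proof.
  intros Hw; destruct (INR_ge_ex (b + 1)) as [n Hn].
  destruct (Sch_bound w n Hw) as (M & PM & HM).
  apply (Clim_le _ _ (fun x => M * Rpower x (-1))).
  - exists 1; intros x Hx.
    replace (Rpower x b * w x - 0)%C with (Rpower x b * w x)%C by ring.
    rewrite Cmod_mult, Cmod_Rpower.
    replace (Rpower x b) with (Rpower x (b + 1) * Rpower x (-1))
      by (rewrite <- Rpower_plus; f_equal; ring).
    replace (Rpower x (b + 1) * Rpower x (-1) * Cmod (w x)) with
      (Rpower x (b + 1) * Cmod (w x) * Rpower x (-1)) by ring.
    apply Rmult_le_compat_r; [left; apply Rpower_pos|].
    eapply Rle_trans; [|apply (HM x)]; rewrite Rabs_pos_eq by lra.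
    apply Rmult_le_compat_r; [apply Cmod_ge_0|].
    generalize (Rpower_le_pow 1 x (b + 1) n Rlt_0_1 ltac:(lra) Hn).
    unfold Rpower at 2; rewrite ln_1, Rmult_0_r, exp_0, Rmult_1_l; auto.
  - apply filterlim_Rscal0, Rpower_lim_infty; [apply Rbar_locally_filter|lra].
Qed.

(* Integration by parts: the boundary term has no constant term in its expansion. *)
Lemma FP1_down b W L : sch W -> b <> 0 -> (forall j, b = - INR j -> W j 0 = 0%C) ->
  FP1 b (W 1%nat) L -> FP1 (b - 1) (W 0%nat) (RtoC (- / b) * L)%C.
Proof.
  intros HW Hb Hj (F & H1 & H2).
  exists (fun e => RtoC (- / b) * F e + RtoC (- / b) * (RtoC (Rpower e b) * W 0%nat e))%C; split.
  - intros e He; destruct (H1 e He) as (H & la & lb & DH & A & B & E).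
    assert (Ela : la = H e).
    { apply (Clim_unique (at_point e) H); [exact A|apply Clim_at_point]. }
    rewrite E, Ela.
    (* An antiderivative of [x^(b-1) W 0]: [H] is one of [x^b W 1], and subtracting it from
       [x^b W 0] leaves the derivative [b x^(b-1) W 0]. *)
    set (K := fun x => (RtoC (/ b) * (RtoC (Rpower x b) * W 0%nat x + (-1) * H x))%C).
    replace (RtoC (- / b) * (lb - H e) + RtoC (- / b) * (Rpower e b * W 0%nat e))%C
      with (RtoC (/ b) * (0 + (-1) * lb) - K e)%C by (unfold K; rewrite RtoC_opp; ring).
    apply IntD_prim with K; [|apply Clim_at_point|].
    + intros x Hx; eapply Cder_eq.
      * unfold K; apply Cder_scal, Cder_plus.
        -- apply Cder_mult; [apply Cder_Rpower, Hx|apply HW].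
        -- apply Cder_scal, DH, Hx.
      * rewrite RtoC_mult.
        replace (RtoC (/ b) * (b * Rpower x (b - 1) * W 0%nat x + Rpower x b * W 1%nat x +
           -1 * (Rpower x b * W 1%nat x)))%C with
           ((RtoC (/ b) * RtoC b) * (Rpower x (b - 1) * W 0%nat x))%C by ring.
        rewrite <- RtoC_mult, Rinv_l by exact Hb; ring.
    + apply Clim_scal, Clim_plus, Clim_scal; try apply Rbar_locally_filter; [|exact B].
      apply Rpower_Sch_Clim, sch_Sch, HW.
  - replace (RtoC (- / b) * L)%C with (RtoC (- / b) * L + RtoC (- / b) * 0)%C by ring.
    apply FP_plus, FP_scal, FP_boundary; try assumption; apply FP_scal, H2.
Qed.

Lemma good_neg a : 0 < a ->
  good (fun x => x < 0) (fun x => x <= - a) (Rbar_locally m_infty) (at_point (- a)).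
Proof.
  intros Ha.
  split; try apply Rbar_locally_filter; try apply (@at_point_filter R_UniformSpace).
  - intros x Hx; apply (open_lt 0 x Hx).
  - intros b c x; lra.
  - intros; lra.
  - intros b c x; lra.
  - exists (- a); intros; lra.
  - unfold at_point; lra.
  - eexists; apply atan_lim_m.
  - eexists; apply filterlim_at_point.
Qed.

Lemma IntFrom_refl e f l : 0 < e -> IntFrom e f l ->
  IntD (fun x => x < 0) (Rbar_locally m_infty) (at_point (- e)) (fun x => f (- x)) l.
Proof.
  intros He (H & la & lb & DH & A & B & ->).
  assert (Ela : la = H e).
  { apply (Clim_unique (at_point e) H); [exact A|apply Clim_at_point]. }
  replace (lb - la)%C with (- H (- - e)%R - - lb)%C by (rewrite Ela, Ropp_involutive; ring).
  apply IntD_prim with (fun x => - H (- x)%R)%C.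
  - intros x Hx; eapply Cder_eq; [apply Cder_opp, Cder_opp_arg, DH; unfold posR; lra|ring].
  - apply (Clim_opp _ (fun x => H (- x))), Clim_comp_opp_p, B.
  - apply (Clim_at_point (fun x => - H (- x)%R)%C).
Qed.

(** Bridge from folded finite parts to those of the statement: [cp] and [cm] are the phases of a
    power on the two half-lines, and the value of [g] at 0 does not enter. *)
Lemma FP1_Pf_val (g f : R -> C) cp cm b L : Sch f ->
  (forall x, 0 < x -> g x = (cp * RtoC (Rpower x b))%C) ->
  (forall x, 0 < x -> g (- x) = (cm * RtoC (Rpower x b))%C) ->
  FP1 b (fun x => cp * f x + cm * f (- x)%R)%C L -> Pf_val g f L.
Proof.
  intros Hf Gp Gm (F & H1 & H2); exists F; split; [|apply FP_finite_part, H2].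
  intros e He.
  destruct (IntFrom_ex b f e Hf He) as [p Hp].
  destruct (IntFrom_ex b (fun x => f (- x)) e (Sch_refl f Hf) He) as [q Hq].
  exists (cm * q)%C, (cp * p)%C; repeat split.
  - eapply (IntD_RInt_gen (good_neg e He)).
    + apply IntFrom_refl; [exact He|].
      apply (IntD_scal (good_from e He)), Hq.
    + intros x Hx.
      destruct (Sch_der _ (Sch_refl f Hf)) as (f' & _ & D).
      eapply Cder_cont, (Cder_opp_arg
        (fun x => cm * (RtoC (Rpower x b) * f (- x)%R))%C).
      apply Cder_scal, Cder_mult; [apply Cder_Rpower; lra|apply D].
    + intros c d x Hc Hd Hx; simpl.
      rewrite <- (Ropp_involutive x) at 1; rewrite Gm by lra.
      rewrite Ropp_involutive; ring.
  - eapply (IntD_RInt_gen (good_from e He)).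
    + apply (IntD_scal (good_from e He)), Hp.
    + intros x Hx.
      apply Ccont_mult; [eapply Cder_cont, Cder_const|apply Rpower_Sch_cont; assumption].
    + intros c d x Hc Hd Hx; simpl.
      rewrite Gp by lra; ring.
  - apply (IntD_unique (good_from e He) _ _ _ (H1 e He)).
    rewrite Cplus_comm.
    eapply IntD_ext; [|apply (IntD_plus (good_from e He));
      apply (IntD_scal (good_from e He)); [apply Hp|apply Hq]].
    intros x _; simpl; ring.
Qed.

(** * The Gamma function *)

(** [(K / p) u^p] is an antiderivative of the bound for either sign of [p], so one estimate serves
    the end at infinity ([p < 0]) and the end at 0 ([p > 0]). *)
Lemma tail_le H h K p u v : p <> 0 -> (forall u, 0 < u -> Cder H u (h u)) ->
  (forall u, 0 < u -> Cmod (h u) <= K * Rpower u (p - 1)) ->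
  0 < u -> u <= v -> Cmod (H v - H u)%C <= K / p * Rpower v p - K / p * Rpower u p.
Proof.
  intros Hp DH B Hu Huv.
  apply (Cder_dom H h (fun t => K / p * Rpower t p) (fun t => K * Rpower t (p - 1)));
    [exact Huv| | |].
  - intros t Ht; apply DH; lra.
  - intros t Ht; replace (K * Rpower t (p - 1)) with (K / p * (p * Rpower t (p - 1)))
      by (field; exact Hp).
    apply is_derive_scal, is_derive_Rpower; lra.
  - intros t Ht; apply B; lra.
Qed.

(** Cauchy criterion with a rate: fixing [u] and moving [v] to the limit turns the two-point bound
    into a distance to [L]. *)
Lemma Clim_of_modulus (F : (R -> Prop) -> Prop) {FF : ProperFilter F} H (g : R -> R) :
  F (fun u => 0 < u) ->
  (forall u v, 0 < u -> 0 < v -> Cmod (H v - H u)%C <= g u + g v) ->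
  filterlim g F (locally 0) ->
  exists L, Clim F H L /\ forall u, 0 < u -> Cmod (H u - L)%C <= g u.
Proof.
  intros F0 HB Hg.
  assert (G : forall e, 0 < e -> F (fun u => 0 < u /\ Rabs (g u) < e)).
  { intros e He; apply filter_and; [exact F0|].
    generalize (proj1 (filterlim_locally g 0) Hg (mkposreal e He)); apply filter_imp.
    intros u Hu; change (Rabs (g u - 0) < e) in Hu; rewrite Rminus_0_r in Hu; exact Hu. }
  destruct (Clim_cauchy F H) as [L HL].
  { intros e He; eexists; split; [apply (G (e / 2)); lra|].
    intros u v [Hu Hu'] [Hv Hv'].
    eapply Rle_lt_trans; [apply HB; assumption|].
    apply Rabs_def2 in Hu'; apply Rabs_def2 in Hv'; lra. }
  exists L; split; [exact HL|].
  intros u Hu; apply le_epsilon; intros e He.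
  destruct (filter_ex (F:=F) _ (filter_and (F:=F) _ _ (G (e / 2) ltac:(lra))
    (HL (e / 2) ltac:(lra)))) as [v [[Hv Hv'] Hv2]].
  apply Rabs_def2 in Hv'.
  replace (H u - L)%C with ((H u - H v) + (H v - L))%C by ring.
  eapply Rle_trans; [apply Cmod_triangle|].
  generalize (HB v u Hv Hu); lra.
Qed.

Lemma tail_infty H h K p : p < 0 -> 0 <= K -> (forall u, 0 < u -> Cder H u (h u)) ->
  (forall u, 0 < u -> Cmod (h u) <= K * Rpower u (p - 1)) ->
  exists L, Clim (Rbar_locally p_infty) H L /\
    forall u, 0 < u -> Cmod (H u - L)%C <= K / (- p) * Rpower u p.
Proof.
  intros Hp HK DH B.
  assert (P : 0 <= K / (- p)) by (apply Rdiv_le_0_compat; lra).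
  apply (Clim_of_modulus _ H (fun u => K / (- p) * Rpower u p)).
  - exists 0; auto.
  - assert (W : forall u v, 0 < u -> u <= v -> Cmod (H v - H u)%C <=
      K / - p * Rpower u p + K / - p * Rpower v p).
    { intros u v Hu Huv; eapply Rle_trans;
        [apply (tail_le H h K p u v); auto; lra|].
      replace (K / p) with (- (K / - p)) by (field; lra).
      assert (0 <= K / - p * Rpower v p)
        by (apply Rmult_le_pos; [exact P|left; apply Rpower_pos]).
      lra. }
    intros u v Hu Hv; destruct (Rle_dec u v); [apply W; auto|].
    rewrite Cmod_minus_sym, Rplus_comm; apply W; lra.
  - apply filterlim_Rscal0, Rpower_lim_infty; [apply Rbar_locally_filter|exact Hp].
Qed.

Lemma tail_zero H h K p : 0 < p -> 0 <= K -> (forall u, 0 < u -> Cder H u (h u)) ->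
  (forall u, 0 < u -> Cmod (h u) <= K * Rpower u (p - 1)) ->
  exists L, Clim (at_right 0) H L /\
    forall u, 0 < u -> Cmod (H u - L)%C <= K / p * Rpower u p.
Proof.
  intros Hp HK DH B.
  assert (P : 0 <= K / p) by (apply Rdiv_le_0_compat; lra).
  apply (Clim_of_modulus _ H (fun u => K / p * Rpower u p)).
  - apply at_right_pos; auto.
  - assert (W : forall u v, 0 < u -> u <= v -> Cmod (H v - H u)%C <=
      K / p * Rpower u p + K / p * Rpower v p).
    { intros u v Hu Huv; eapply Rle_trans;
        [apply (tail_le H h K p u v); auto; lra|].
      assert (0 <= K / p * Rpower u p)
        by (apply Rmult_le_pos; [exact P|left; apply Rpower_pos]).
      lra. }
    intros u v Hu Hv; destruct (Rle_dec u v); [apply W; auto|].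
    rewrite Cmod_minus_sym, Rplus_comm; apply W; lra.
  - apply filterlim_Rscal0, Rpower_lim0; [apply at_right_proper_filter|exact Hp].
Qed.

(** The constant is the maximum of [t^a e^{-t}], attained at [t = a]; the inequality is
    [ln y <= y - 1] at [y = t / a]. *)
Lemma Rpower_exp_bound a : 0 < a ->
  exists K, 0 <= K /\ forall t, 0 < t -> Rpower t a * exp (- t) <= K.
Proof.
  intros Ha; exists (exp (a * ln a - a)); split; [left; apply exp_pos|].
  intros t Ht; unfold Rpower; rewrite <- exp_plus.
  assert (L : ln (t / a) <= t / a - 1).
  { assert (Q : 0 < t / a) by (apply Rdiv_lt_0_compat; assumption).
    assert (X := exp_ineq1_le (ln (t / a))); rewrite exp_ln in X by exact Q; lra. }
  rewrite ln_div in L by assumption.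
  apply (Rmult_le_compat_l a) in L; [|lra].
  replace (a * (t / a - 1)) with (t - a) in L by (field; lra).
  destruct (Req_dec (a * ln t + - t) (a * ln a - a)) as [->|N]; [lra|].
  left; apply exp_increasing; lra.
Qed.

Lemma Clim_real {T} (F : (T -> Prop) -> Prop) {FF : ProperFilter F} (f : T -> C) l :
  (forall x, snd (f x) = 0) -> Clim F f l -> l = RtoC (fst l).
Proof.
  intros E H; destruct (Req_dec (snd l) 0) as [Z|Z].
  - destruct l; simpl in *; subst; reflexivity.
  - destruct (filter_ex (F:=F) _ (H (Rabs (snd l)) ltac:(apply Rabs_pos_lt, Z))) as [x Hx].
    assert (X := snd_le_Cmod (f x - l)%C).
    simpl in X; rewrite E, Rplus_0_l, Rabs_Ropp in X; lra.
Qed.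

Lemma is_RInt_gen_fst (f : R -> C) Fa Fb (l : C) {FFa : Filter Fa} {FFb : Filter Fb} :
  is_RInt_gen f Fa Fb l -> is_RInt_gen (fun x => fst (f x)) Fa Fb (fst l).
Proof.
  intros H P HP.
  assert (Q : locally l (fun z : C => P (fst z))).
  { destruct HP as [eps HP]; exists eps; intros z Hz; apply HP, Hz. }
  generalize (H _ Q); unfold filtermapi; apply filter_imp.
  intros [a b] [y [H1 H2]]; exists (fst y); split; [|exact H2].
  apply (is_RInt_fct_extend_fst f a b y H1).
Qed.

Definition gamma_fun (s u : R) : R := Rpower u (s - 1) * exp (- u).

Lemma gamma_fun_cont s x : 0 < x -> Ccont (fun u => RtoC (gamma_fun s u)) x.
Proof.
  intros Hx; eapply Cder_cont, Cder_RtoC, is_derive_mult_R; [apply is_derive_Rpower, Hx|].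
  auto_derive; [exact I|reflexivity].
Qed.

Lemma gamma_fun_pos s u : 0 <= gamma_fun s u.
Proof. apply Rmult_le_pos; left; [apply Rpower_pos|apply exp_pos]. Qed.

(** [g] is the lower incomplete Gamma function, given with its rate at 0 and its limit at infinity;
    later arguments use only these properties of the Euler integral. *)
Lemma gamma_prim s : 0 < s -> exists g,
  (forall u, 0 < u -> Cder g u (RtoC (gamma_fun s u))) /\
  (forall u, 0 < u -> Cmod (g u) <= / s * Rpower u s) /\
  Clim (Rbar_locally p_infty) g (RtoC (Gamma_Euler s)).
Proof.
  intros Hs.
  destruct (antiderivative_ex good_pos _ (gamma_fun_cont s)) as [H0 DH0].
  (* The imaginary part is a mere constant of integration; dropping it makes the limits real, as the
     comparison with [Gamma_Euler s] demands. *)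
  pose (H := fun u => RtoC (fst (H0 u))).
  assert (DH : forall u, 0 < u -> Cder H u (RtoC (gamma_fun s u))).
  { intros u Hu; apply Cder_RtoC, (DH0 u Hu). }
  assert (B0 : forall u, 0 < u -> Cmod (RtoC (gamma_fun s u)) <= 1 * Rpower u (s - 1)).
  { intros u Hu; rewrite Cmod_R, Rabs_pos_eq by apply gamma_fun_pos.
    rewrite Rmult_comm; apply Rmult_le_compat_l; [left; apply Rpower_pos|].
    rewrite <- exp_0; left; apply exp_increasing; lra. }
  (* The exponent [s + 1] leaves a factor [u^(-2)], integrable at infinity. *)
  destruct (Rpower_exp_bound (s + 1) ltac:(lra)) as (K & PK & HK).
  assert (B1 : forall u, 0 < u -> Cmod (RtoC (gamma_fun s u)) <= K * Rpower u (-1 - 1)).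
  { intros u Hu; rewrite Cmod_R, Rabs_pos_eq by apply gamma_fun_pos; unfold gamma_fun.
    replace (s - 1) with ((s + 1) + (-1 - 1)) by ring; rewrite Rpower_plus.
    replace (Rpower u (s + 1) * Rpower u (-1 - 1) * exp (- u)) with
      (Rpower u (s + 1) * exp (- u) * Rpower u (-1 - 1)) by ring.
    apply Rmult_le_compat_r; [left; apply Rpower_pos|apply HK, Hu]. }
  destruct (tail_zero H _ 1 s Hs ltac:(lra) DH B0) as (L0 & C0 & D0).
  destruct (tail_infty H _ K (-1) ltac:(lra) PK DH B1) as (L1 & C1 & _).
  assert (R0 : L0 = RtoC (fst L0)).
  { apply (Clim_real (at_right 0) H); [reflexivity|exact C0]. }
  assert (R1 : L1 = RtoC (fst L1)).
  { apply (Clim_real (Rbar_locally p_infty) H); [reflexivity|exact C1]. }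
  assert (E : Gamma_Euler s = fst (L1 - L0)%C).
  { unfold Gamma_Euler.
    apply (is_RInt_gen_unique (V := R_CompleteNormedModule)
             (fun t => Rpower t (s - 1) * exp (- t)) (fst (L1 - L0)%C)).
    apply (is_RInt_gen_fst (fun u => RtoC (gamma_fun s u)) _ _ (L1 - L0)%C).
    apply (IntD_RInt_gen good_pos (fun u => RtoC (gamma_fun s u))).
    - apply IntD_prim with H; auto.
    - intros x Hx; apply gamma_fun_cont, Hx.
    - reflexivity. }
  exists (fun u => H u + - L0)%C; split; [|split].
  - intros u Hu; eapply Cder_eq; [apply Cder_plus; [apply DH, Hu|apply Cder_const]|ring].
  - intros u Hu; eapply Rle_trans; [apply (D0 u Hu)|].
    apply Req_le; unfold Rdiv; ring.
  - rewrite E; replace (RtoC (fst (L1 - L0)%C)) with (L1 + - L0)%C.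
    + apply Clim_plus; [apply Rbar_locally_filter|exact C1|].
      apply Clim_const; apply Rbar_locally_filter.
    + rewrite R0, R1; apply injective_projections; simpl; ring.
Qed.

Lemma Clim_gamma_zero s g : 0 < s -> (forall u, 0 < u -> Cmod (g u) <= / s * Rpower u s) ->
  Clim (at_right 0) g 0%C.
Proof.
  intros Hs B; apply (Clim_le _ _ (fun u => / s * Rpower u s)).
  - apply at_right_pos; intros u Hu; replace (g u - 0)%C with (g u) by ring; auto.
  - apply filterlim_Rscal0, Rpower_lim0; [apply at_right_proper_filter|exact Hs].
Qed.

(** Integration by parts: [s g(u) - u^s e^{-u}] is another antiderivative of the integrand for
    [s + 1], and its second term vanishes at both ends. *)
Lemma Gamma_Euler_rec s : 0 < s -> Gamma_Euler (s + 1) = s * Gamma_Euler s.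
Proof.
  intros Hs.
  destruct (gamma_prim s Hs) as (g & D & B & L).
  destruct (gamma_prim (s + 1) ltac:(lra)) as (g' & D' & B' & L').
  apply RtoC_inj; rewrite RtoC_mult.
  apply (IntD_unique good_pos (fun u => RtoC (gamma_fun (s + 1) u))).
  - replace (RtoC (Gamma_Euler (s + 1))) with (Gamma_Euler (s + 1) - 0)%C by ring.
    apply IntD_prim with g'; auto.
    apply (Clim_gamma_zero (s + 1)); auto; lra.
  - replace (s * Gamma_Euler s)%C with
      ((s * Gamma_Euler s + (-1) * 0) - (s * 0 + (-1) * 0))%C by ring.
    apply IntD_prim with (fun u => s * g u + (-1) * RtoC (Rpower u s * exp (- u)))%C.
    + intros u Hu; eapply Cder_eq.
      * apply Cder_plus; apply Cder_scal; [apply D, Hu|].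
        apply Cder_RtoC, is_derive_mult_R; [apply is_derive_Rpower, Hu|].
        auto_derive; [exact I|reflexivity].
      * unfold gamma_fun; replace (s + 1 - 1) with s by ring.
        rewrite <- !RtoC_mult, <- RtoC_plus; f_equal; ring.
    + apply Clim_plus; try apply at_right_proper_filter; apply Clim_scal;
        try apply at_right_proper_filter; [apply (Clim_gamma_zero s); auto|].
      apply (Clim_le _ _ (fun u => 1 * Rpower u s)).
      * apply at_right_pos; intros u Hu.
        replace (RtoC (Rpower u s * exp (- u)) - 0)%C with (RtoC (Rpower u s * exp (- u)))
          by ring.
        rewrite Cmod_R, Rabs_pos_eq
          by (apply Rmult_le_pos; left; [apply Rpower_pos|apply exp_pos]).
        rewrite Rmult_comm; apply Rmult_le_compat_r; [left; apply Rpower_pos|].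
        rewrite <- exp_0; left; apply exp_increasing; lra.
      * apply filterlim_Rscal0, Rpower_lim0; [apply at_right_proper_filter|exact Hs].
    + apply Clim_plus; try apply Rbar_locally_filter; apply Clim_scal;
        try apply Rbar_locally_filter; [exact L|].
      destruct (Rpower_exp_bound (s + 1) ltac:(lra)) as (K & PK & HK).
      apply (Clim_le _ _ (fun u => K * Rpower u (-1))).
      * exists 0; intros u Hu.
        replace (RtoC (Rpower u s * exp (- u)) - 0)%C with (RtoC (Rpower u s * exp (- u)))
          by ring.
        rewrite Cmod_R, Rabs_pos_eq
          by (apply Rmult_le_pos; left; [apply Rpower_pos|apply exp_pos]).
        replace (Rpower u s) with (Rpower u (s + 1) * Rpower u (-1))
          by (rewrite <- Rpower_plus; f_equal; ring).
        replace (Rpower u (s + 1) * Rpower u (-1) * exp (- u)) with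
          (Rpower u (s + 1) * exp (- u) * Rpower u (-1)) by ring.
        apply Rmult_le_compat_r; [left; apply Rpower_pos|apply HK, Hu].
      * apply filterlim_Rscal0, Rpower_lim_infty; [apply Rbar_locally_filter|lra].
Qed.

Lemma shifted_prod_S s n : shifted_prod s (S n) = s * shifted_prod (s + 1) n.
Proof.
  induction n as [|n IH]; [simpl; ring|].
  change (shifted_prod s (S (S n))) with (shifted_prod s (S n) * (s + INR (S n))).
  change (shifted_prod (s + 1) (S n)) with (shifted_prod (s + 1) n * (s + 1 + INR n)).
  rewrite IH, S_INR; ring.
Qed.

Lemma Int_part_plus1 s : Int_part (s + 1) = (Int_part s + 1)%Z.
Proof.
  symmetry; apply Int_part_spec; rewrite plus_IZR.
  destruct (base_Int_part s); lra.
Qed.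

Lemma Gamma_rec s : (forall z : Z, s <> IZR z) -> Gamma (s + 1) = s * Gamma s.
Proof.
  intros Hs; assert (S0 : s <> 0) by apply (Hs 0%Z).
  destruct (base_Int_part s) as [H1 H2].
  unfold Gamma; rewrite Int_part_plus1.
  (* For [s > 0] neither side is shifted and this is the recursion of the Euler integral. Otherwise
     the shift for [s + 1] is one less than for [s], so both sides contain the same Euler integral
     and only the product changes. *)
  destruct (Z_le_gt_dec 0 (Int_part s)) as [Hz|Hz].
  - assert (0 <= IZR (Int_part s)) by (apply IZR_le; exact Hz).
    replace (Z.to_nat (- (Int_part s + 1))) with 0%nat by lia.
    replace (Z.to_nat (- Int_part s)) with 0%nat by lia.
    simpl; rewrite !Rplus_0_r, Gamma_Euler_rec by lra; field.
  - replace (Z.to_nat (- Int_part s)) with (S (Z.to_nat (- (Int_part s + 1)))) by lia.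
    set (n := Z.to_nat (- (Int_part s + 1))).
    rewrite shifted_prod_S, S_INR.
    replace (s + (INR n + 1)) with (s + 1 + INR n) by ring.
    unfold Rdiv; rewrite Rinv_mult.
    generalize (/ shifted_prod (s + 1) n); intros; field; exact S0.
Qed.

Lemma Gamma_neg s : -1 < s < 0 -> Gamma s = Gamma_Euler (s + 1) / s.
Proof.
  intros Hs; unfold Gamma.
  replace (Int_part s) with (-1)%Z.
  - simpl; rewrite Rplus_0_r; f_equal; ring.
  - apply Int_part_spec; simpl; lra.
Qed.

(** * Rotation of the contour of the Gamma integral *)

(** The value of [e^{-z}] at [z = u e^{i th}]. *)
Definition arcexp (u th : R) : C := cexp (- (u * cos th), - (u * sin th)).

(** On the arc [dz = i z dth], whence the exponent [s] instead of [s - 1]. *)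
Definition arcfun (s u th : R) : C :=
  (Ci * RtoC (Rpower u s) * cexp (0, (s * th)%R) * (arcexp u th - 1))%C.

Notation IntArc := (IntD allR (at_point 0) (at_point (PI / 2))).

(* The integral of [i z^s (e^{-z} - 1)] over the quarter circle [z = u e^{i th}]. *)
Definition arcint (s u : R) : C := epsilon (inhabits (RtoC 0)) (IntArc (arcfun s u)).

Lemma PI2_pos : 0 <= PI / 2.
Proof. generalize PI_RGT_0; lra. Qed.

(** Puts a uniform bound on the quarter circle into the weighted form that the integral lemmas
    expect: [PI <= 4] gives [th <= 2], so [1 + th^2 <= 5]. *)
Lemma arc_weight K th : 0 <= K -> 0 <= th <= PI / 2 -> K <= 5 * K / (1 + th²).
Proof.
  intros HK Hth.
  assert (P := one_plus_sqr_pos th).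
  assert (th² <= 4).
  { generalize PI_4; intros; unfold Rsqr; nra. }
  apply Rmult_le_reg_r with (1 + th²); [exact P|].
  replace (5 * K / (1 + th²) * (1 + th²)) with (5 * K) by (field; lra).
  nra.
Qed.

Lemma Cmod_arcexp u th : 0 <= u -> 0 <= th <= PI / 2 -> Cmod (arcexp u th) <= 1.
Proof.
  intros Hu Hth; unfold arcexp; rewrite Cmod_cexp; simpl.
  rewrite <- exp_0.
  assert (0 <= cos th) by (apply cos_ge_0; lra).
  destruct (Req_dec (u * cos th) 0) as [->|N]; [rewrite Ropp_0; lra|].
  left; apply exp_increasing.
  assert (0 <= u * cos th) by (apply Rmult_le_pos; assumption); lra.
Qed.

Lemma arcexp_der_u u th :
  Cder (fun u => arcexp u th) u (- cexp (0, th) * arcexp u th)%C.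
Proof.
  eapply Cder_eq.
  - apply (Cder_cexp (fun u => (- (u * cos th), - (u * sin th))) u (- cos th, - sin th)).
    split; simpl; auto_derive; auto; ring.
  - unfold arcexp; f_equal; unfold cexp; simpl; rewrite exp_0.
    apply injective_projections; simpl; ring.
Qed.

Lemma arcexp_der_th u th :
  Cder (fun th => arcexp u th) th (- Ci * RtoC u * cexp (0, th) * arcexp u th)%C.
Proof.
  eapply Cder_eq.
  - apply (Cder_cexp (fun th => (- (u * cos th), - (u * sin th))) th (u * sin th, - (u * cos th))).
    split; simpl; auto_derive; auto; ring.
  - unfold arcexp; f_equal; unfold cexp; simpl; rewrite exp_0.
    apply injective_projections; simpl; ring.
Qed.

Lemma arcexp_0 th : arcexp 0 th = 1%C.
Proof.
  unfold arcexp; rewrite !Rmult_0_l, Ropp_0; apply cexp_0.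
Qed.

Lemma Cmod_arcexp_1 u th : 0 <= u -> 0 <= th <= PI / 2 ->
  Cmod (arcexp u th - 1)%C <= u.
Proof.
  intros Hu Hth.
  rewrite <- (arcexp_0 th).
  eapply Rle_trans; [apply (Cder_lip (fun u => arcexp u th)
    (fun u => - cexp (0, th) * arcexp u th)%C 1 0 u)|].
  - intros t _; apply arcexp_der_u.
  - intros t; rewrite Rmin_left, Rmax_right by lra; intros Ht.
    rewrite Cmod_mult, Cmod_opp, Cmod_cexp_i, Rmult_1_l; apply Cmod_arcexp; lra.
  - rewrite Rminus_0_r, Rabs_pos_eq by lra; lra.
Qed.

(** The derivative in [u] is a first-order remainder, bounded by [Cmod_arcexp_1]. At [s = -1] the
    first order only keeps the small arc bounded; this second order identifies its limit. *)
Lemma Cmod_arcexp_2 u th : 0 <= u -> 0 <= th <= PI / 2 ->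
  Cmod (arcexp u th - 1 + RtoC u * cexp (0, th))%C <= u * u.
Proof.
  intros Hu Hth.
  replace (arcexp u th - 1 + RtoC u * cexp (0, th))%C with
    ((arcexp u th + RtoC u * cexp (0, th)) - (arcexp 0 th + RtoC 0 * cexp (0, th)))%C
    by (rewrite arcexp_0; ring).
  eapply Rle_trans; [apply (Cder_lip (fun u => arcexp u th + RtoC u * cexp (0, th))%C
    (fun u => - cexp (0, th) * (arcexp u th - 1))%C u 0 u)|].
  - intros t _; eapply Cder_eq.
    + apply Cder_plus; [apply arcexp_der_u|].
      apply Cder_mult; [|apply Cder_const].
      apply Cder_RtoC, (@is_derive_id R_AbsRing).
    + cbv beta; change one with 1; ring.
  - intros t; rewrite Rmin_left, Rmax_right by lra; intros Ht.
    rewrite Cmod_mult, Cmod_opp, Cmod_cexp_i, Rmult_1_l.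
    eapply Rle_trans; [apply Cmod_arcexp_1|]; lra.
  - rewrite Rminus_0_r, Rabs_pos_eq by lra; lra.
Qed.

Lemma Cder_eisx s th : Cder (fun th => cexp (0, s * th)) th (Ci * RtoC s * cexp (0, (s * th)%R))%C.
Proof.
  apply (Cder_eix (fun th => s * th)); auto_derive; [exact I|ring].
Qed.

Lemma Cmod_arcfun s u th :
  Cmod (arcfun s u th) = Rpower u s * Cmod (arcexp u th - 1)%C.
Proof.
  unfold arcfun; rewrite !Cmod_mult, Cmod_Ci, Cmod_Rpower, Cmod_cexp_i; ring.
Qed.

Lemma Cmod_arcexp_le2 u th : 0 <= u -> 0 <= th <= PI / 2 -> Cmod (arcexp u th - 1)%C <= 2.
Proof.
  intros Hu Hth; eapply Rle_trans; [apply Cmod_triangle_minus|].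
  rewrite Cmod_1; generalize (Cmod_arcexp u th Hu Hth); lra.
Qed.

Lemma arcint_spec s u : 0 < u -> IntArc (arcfun s u) (arcint s u).
Proof.
  intros Hu; unfold arcint; apply epsilon_spec.
  apply (IntD_ex (good_seg 0 (PI / 2) PI2_pos) _ (5 * (Rpower u s * 2))).
  - intros x _; unfold arcfun; eapply Cder_cont, Cder_mult.
    + apply Cder_scal, Cder_eisx.
    + apply Cder_minus; [apply arcexp_der_th|apply Cder_const].
  - intros x Hx; rewrite Cmod_arcfun.
    assert (P := Rpower_pos u s).
    eapply Rle_trans; [|apply arc_weight; [lra|exact Hx]].
    apply Rmult_le_compat_l; [lra|apply Cmod_arcexp_le2; lra].
Qed.

Lemma arcint_bound s u K : 0 < u -> 0 <= K ->
  (forall th, 0 <= th <= PI / 2 -> Cmod (arcexp u th - 1)%C <= K) ->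
  Cmod (arcint s u) <= 5 * PI * (Rpower u s * K).
Proof.
  intros Hu HK B.
  assert (P := Rpower_pos u s).
  assert (P2 : 0 <= Rpower u s * K) by (apply Rmult_le_pos; lra).
  replace (5 * PI * (Rpower u s * K)) with (5 * (Rpower u s * K) * PI) by ring.
  apply (IntD_bound (good_seg 0 (PI / 2) PI2_pos) _ _ (5 * (Rpower u s * K)) ltac:(lra)
           (arcint_spec s u Hu)).
  intros x Hx; rewrite Cmod_arcfun.
  eapply Rle_trans; [|apply arc_weight; [exact P2|exact Hx]].
  apply Rmult_le_compat_l; [lra|apply B, Hx].
Qed.

Lemma arcint_infty s u : 0 < u -> Cmod (arcint s u) <= 10 * PI * Rpower u s.
Proof.
  intros Hu; eapply Rle_trans; [apply (arcint_bound s u 2 Hu ltac:(lra))|].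
  - intros th Hth; apply Cmod_arcexp_le2; lra.
  - apply Req_le; ring.
Qed.

Lemma arcint_zero s u : 0 < u -> Cmod (arcint s u) <= 5 * PI * Rpower u (s + 1).
Proof.
  intros Hu; eapply Rle_trans; [apply (arcint_bound s u u Hu ltac:(lra))|].
  - intros th Hth; apply Cmod_arcexp_1; lra.
  - rewrite Rpower_shift1 by exact Hu; lra.
Qed.

(** As [z] tends to 0, [i z^(-1) (e^{-z} - 1)] tends to [-i], so the small quarter circle
    contributes [-i PI/2]; this is the origin of the factor [PI] at integer exponents. *)
Lemma arcint_zero_m1 u : 0 < u ->
  Cmod (arcint (-1) u + Ci * RtoC (PI / 2))%C <= 5 * PI * Rpower u 1.
Proof.
  intros Hu.
  assert (P := Rpower_pos u (-1)).
  rewrite (Rpower_1 u Hu).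
  replace (5 * PI * u) with (5 * u * PI) by ring.
  apply (IntD_bound (good_seg 0 (PI / 2) PI2_pos) (fun th => arcfun (-1) u th + Ci)%C);
    [lra| |].
  - apply (IntD_plus (good_seg 0 (PI / 2) PI2_pos)); [apply arcint_spec, Hu|].
    replace (Ci * RtoC (PI / 2))%C with (Ci * RtoC (PI / 2) - Ci * RtoC 0)%C by ring.
    apply IntD_prim with (fun th => Ci * RtoC th)%C.
    + intros x _; eapply Cder_eq; [apply Cder_scal, Cder_RtoC, (@is_derive_id R_AbsRing)|].
      change one with 1; ring.
    + apply (Clim_at_point (fun th => Ci * RtoC th)%C).
    + apply (Clim_at_point (fun th => Ci * RtoC th)%C).
  - intros th Hth.
    eapply Rle_trans; [|apply arc_weight; [lra|exact Hth]].
    assert (E1 : (RtoC (Rpower u (-1)) * RtoC u = 1)%C).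
    { rewrite <- RtoC_mult; f_equal; rewrite <- (Rpower_1 u Hu) at 2.
      rewrite <- Rpower_plus; replace (-1 + 1) with 0 by ring; apply Rpower_O, Hu. }
    assert (E2 : (cexp (0, (-1 * th)%R) * cexp (0, th) = 1)%C).
    { rewrite <- cexp_plus, <- cexp_0; f_equal; apply injective_projections; simpl; ring. }
    assert (E : (arcfun (-1) u th + Ci = Ci * RtoC (Rpower u (-1)) * cexp (0, (-1 * th)%R)
       * (arcexp u th - 1 + RtoC u * cexp (0, th)))%C).
    { unfold arcfun.
      transitivity (Ci * RtoC (Rpower u (-1)) * cexp (0, (-1 * th)%R) * (arcexp u th - 1)
        + Ci * (RtoC (Rpower u (-1)) * RtoC u) * (cexp (0, (-1 * th)%R) * cexp (0, th)))%C.
      - rewrite E1, E2; ring.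
      - ring. }
    rewrite E, !Cmod_mult, Cmod_Ci, Cmod_Rpower, Cmod_cexp_i.
    apply Rle_trans with (1 * Rpower u (-1) * 1 * (u * u)).
    + apply Rmult_le_compat_l; [lra|apply Cmod_arcexp_2; lra].
    + apply Req_le; rewrite <- RtoC_mult in E1; apply RtoC_inj in E1.
      transitivity (Rpower u (-1) * u * u); [ring|rewrite E1; ring].
Qed.

(* The [u]-derivative of the integrand is the [th]-derivative of
   [u^(s-1) e^{i s th} (e^{-u e^{i th}} - 1)]: both express that [z^(s-1) (e^{-z} - 1)] is
   holomorphic. *)
Lemma arcint_der s u : s <= 0 -> 0 < u ->
  Cder (arcint s) u (RtoC (Rpower u (s - 1)) *
    (cexp (0, (s * (PI / 2))%R) * (cexp (0, (- u)%R) - 1) - (RtoC (exp (- u)) - 1)))%C.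
Proof.
  intros Hs Hu.
  (* [g] and [h] are the first and second [u]-derivatives of [arcfun]; [K] bounds [h] for radii at
     least [u / 2], where powers with exponent at most 0 are largest at [u / 2]. *)
  set (g := fun u th => (Ci * RtoC (s * Rpower u (s - 1)) * cexp (0, (s * th)%R) * (arcexp u th - 1)
    - Ci * RtoC (Rpower u s) * cexp (0, (s * th)%R) * cexp (0, th) * arcexp u th)%C).
  set (h := fun u th => (Ci * RtoC (s * ((s - 1) * Rpower u (s - 1 - 1))) *
      cexp (0, (s * th)%R) * (arcexp u th - 1)
    - 2 * (Ci * RtoC (s * Rpower u (s - 1)) * cexp (0, (s * th)%R) * cexp (0, th) * arcexp u th)
    + Ci * RtoC (Rpower u s) * cexp (0, (s * th)%R) * cexp (0, th) * cexp (0, th) *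
      arcexp u th)%C).
  set (K := Rabs (s * (s - 1)) * Rpower (u / 2) (s - 1 - 1) * 2 +
            2 * (Rabs s * Rpower (u / 2) (s - 1)) + Rpower (u / 2) s).
  assert (PK : 0 <= K).
  { unfold K; generalize (Rabs_pos (s * (s - 1))) (Rabs_pos s) (Rpower_pos (u / 2) (s - 1 - 1))
      (Rpower_pos (u / 2) (s - 1)) (Rpower_pos (u / 2) s); intros.
    assert (0 <= Rabs (s * (s - 1)) * Rpower (u / 2) (s - 1 - 1)) by (apply Rmult_le_pos; lra).
    assert (0 <= Rabs s * Rpower (u / 2) (s - 1)) by (apply Rmult_le_pos; lra).
    lra. }
  assert (U : forall t, Rabs (t - u) < u / 2 -> u / 2 <= t).
  { intros t Ht; apply Rabs_def2 in Ht; lra. }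
  apply (IntD_param (good_seg 0 (PI / 2) PI2_pos) (arcfun s) g h u (u / 2) (5 * K));
    [lra|lra| | | | |].
  - intros t th Ht _; apply U in Ht.
    unfold arcfun, g; eapply Cder_eq.
    + apply Cder_mult.
      * apply Cder_mult; [|apply Cder_const].
        apply Cder_scal, Cder_Rpower; lra.
      * apply Cder_minus; [apply arcexp_der_u|apply Cder_const].
    + cbv beta; ring.
  - intros t th Ht _; apply U in Ht.
    unfold g, h; eapply Cder_eq.
    + apply Cder_minus; apply Cder_mult.
      * apply Cder_mult; [|apply Cder_const].
        apply Cder_scal, Cder_RtoC, is_derive_scal, is_derive_Rpower; lra.
      * apply Cder_minus; [apply arcexp_der_u|apply Cder_const].
      * apply Cder_mult; [|apply Cder_const].
        apply Cder_mult; [|apply Cder_const].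
        apply Cder_scal, Cder_Rpower; lra.
      * apply arcexp_der_u.
    + cbv beta; ring.
  - intros t th Ht Hth; apply U in Ht.
    eapply Rle_trans; [|apply arc_weight; [exact PK|exact Hth]].
    assert (X1 := Cmod_arcexp t th ltac:(lra) Hth).
    assert (X2 := Cmod_arcexp_le2 t th ltac:(lra) Hth).
    assert (Q1 := Rpower_le_neg (u / 2) t (s - 1 - 1) ltac:(lra) Ht ltac:(lra)).
    assert (Q2 := Rpower_le_neg (u / 2) t (s - 1) ltac:(lra) Ht ltac:(lra)).
    assert (Q3 := Rpower_le_neg (u / 2) t s ltac:(lra) Ht ltac:(lra)).
    assert (N1 := Rpower_pos t (s - 1 - 1)).
    assert (N2 := Rpower_pos t (s - 1)).
    assert (N3 := Rpower_pos t s).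
    unfold h, K; eapply Rle_trans; [apply Cmod_triangle|apply Rplus_le_compat].
    + eapply Rle_trans; [apply Cmod_triangle_minus|apply Rplus_le_compat].
      * rewrite !Cmod_mult, Cmod_Ci, Cmod_cexp_i, Cmod_R, Rmult_1_l, Rmult_1_r.
        replace (s * ((s - 1) * Rpower t (s - 1 - 1))) with
          (s * (s - 1) * Rpower t (s - 1 - 1)) by ring.
        rewrite Rabs_mult, (Rabs_pos_eq (Rpower _ _)) by lra.
        apply Rmult_le_compat; [|apply Cmod_ge_0| |exact X2].
        -- apply Rmult_le_pos; [apply Rabs_pos|lra].
        -- apply Rmult_le_compat_l; [apply Rabs_pos|exact Q1].
      * rewrite !Cmod_mult, Cmod_Ci, !Cmod_cexp_i, !Cmod_R, Rmult_1_l, !Rmult_1_r.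
        rewrite (Rabs_pos_eq 2) by lra.
        rewrite Rabs_mult, (Rabs_pos_eq (Rpower _ _)) by lra.
        apply Rmult_le_compat_l; [lra|].
        rewrite <- (Rmult_1_r (Rabs s * Rpower (u / 2) (s - 1))).
        apply Rmult_le_compat; [|apply Cmod_ge_0| |exact X1].
        -- apply Rmult_le_pos; [apply Rabs_pos|lra].
        -- apply Rmult_le_compat_l; [apply Rabs_pos|exact Q2].
    + rewrite !Cmod_mult, Cmod_Ci, !Cmod_cexp_i, Cmod_Rpower, Rmult_1_l, !Rmult_1_r.
      rewrite <- (Rmult_1_r (Rpower (u / 2) s)).
      apply Rmult_le_compat; [lra|apply Cmod_ge_0|exact Q3|exact X1].
  - intros t Ht; apply U in Ht; apply arcint_spec; lra.
  - set (Gp := fun th => (RtoC (Rpower u (s - 1)) * cexp (0, (s * th)%R) * (arcexp u th - 1))%C).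
    replace (RtoC (Rpower u (s - 1)) * (cexp (0, (s * (PI / 2))%R) * (cexp (0, (- u)%R) - 1) -
      (RtoC (exp (- u)) - 1)))%C with (Gp (PI / 2)%R - Gp 0%R)%C.
    + apply IntD_prim with Gp; [|apply Clim_at_point|apply Clim_at_point].
      intros th _; unfold Gp, g; eapply Cder_eq.
      * apply Cder_mult; [apply Cder_scal, Cder_eisx|].
        apply Cder_minus; [apply arcexp_der_th|apply Cder_const].
      * cbv beta.
        replace (Rpower u s) with (Rpower u (s - 1) * u)
          by (rewrite <- Rpower_shift1 by exact Hu; f_equal; ring).
        rewrite !RtoC_mult; ring.
    + unfold Gp, arcexp.
      rewrite cos_PI2, sin_PI2, cos_0, sin_0, !Rmult_0_r, !Rmult_1_r, Ropp_0.
      replace (cexp (0, 0)) with (RtoC 1) by (symmetry; apply cexp_0).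
      replace (cexp (- u, 0)) with (RtoC (exp (- u))).
      * ring.
      * unfold cexp; simpl; rewrite cos_0, sin_0; apply injective_projections; simpl; ring.
Qed.

(** [rho u] is the tail from [u] to infinity of the integral of [t^(s-1) e(t)], and [kappa] its
    value at [0+], approached at rate [u^tau]. The bounds on [e] and [e'] serve differentiation
    under the integral sign; one constant [K] is shared by all estimates. *)
Record kernel (s tau : R) (e rho : R -> C) (kappa : C) (K : R) : Prop := {
  ker_der : forall u, 0 < u -> Cder rho u (- (RtoC (Rpower u (s - 1)) * e u))%C;
  ker_infty : forall u, 0 < u -> Cmod (rho u) <= K * Rpower u s;
  ker_zero : forall u, 0 < u -> Cmod (rho u - kappa)%C <= K * Rpower u tau;
  ker_e : forall u, Cmod (e u) <= K;
  ker_e' : exists e', (forall u, Cder e u (e' u)) /\ (forall u, Cmod (e' u) <= K) }.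

(** At [s = -1] the phase [e^{-i PI/2} = -i] moves [cos u - 1] into the imaginary part of the
    derivative of [arcint]. Taking that part removes [sin u] and [e^{-u} - 1], which over [u^2] are
    not integrable at 0. *)
Lemma cos_kernel : exists rho K,
  kernel (-1) 1 (fun u => RtoC (2 * (cos u - 1))) rho (RtoC (- PI)) K.
Proof.
  exists (fun u => RtoC (2 * snd (arcint (-1) u))), (20 * PI).
  assert (PP := PI_RGT_0).
  assert (P3 : 1 <= PI) by (generalize PI2_1; lra).
  split.
  - intros u Hu; rewrite <- RtoC_mult, <- RtoC_opp; apply Cder_RtoC.
    destruct (arcint_der (-1) u ltac:(lra) Hu) as [_ D].
    evar_last; [apply is_derive_scal, D|].
    unfold cexp; simpl.
    replace (-1 * (PI / 2)) with (- (PI / 2)) by ring.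
    rewrite exp_0, !cos_neg, !sin_neg, cos_PI2, sin_PI2; ring.
  - intros u Hu; rewrite Cmod_R, Rabs_mult, (Rabs_pos_eq 2) by lra.
    generalize (snd_le_Cmod (arcint (-1) u)) (arcint_infty (-1) u Hu); lra.
  - intros u Hu; rewrite <- RtoC_minus, Cmod_R.
    replace (2 * snd (arcint (-1) u) - - PI) with
      (2 * snd (arcint (-1) u + Ci * RtoC (PI / 2))%C) by (simpl; field).
    rewrite Rabs_mult, (Rabs_pos_eq 2) by lra.
    assert (P := Rpower_pos u 1).
    assert (0 <= PI * Rpower u 1) by (apply Rmult_le_pos; lra).
    generalize (snd_le_Cmod (arcint (-1) u + Ci * RtoC (PI / 2))%C) (arcint_zero_m1 u Hu); lra.
  - intros u; rewrite Cmod_R; generalize (COS_bound u); intros.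
    apply Rabs_le; lra.
  - exists (fun u => RtoC (2 * (- sin u))); split.
    + intros u; apply Cder_RtoC; auto_derive; [exact I|ring].
    + intros u; rewrite Cmod_R; generalize (SIN_bound u); intros; apply Rabs_le; lra.
Qed.

(** Rotation of the contour: [e^{i PI s/2}] times the tail along the imaginary axis equals the tail
    along the real axis minus the arc integral. Near 0 the arc disappears and the real tail tends to
    [Gamma s]. *)
Lemma exp_kernel s : -1 < s < 0 -> exists rho K,
  kernel s (s + 1) (fun u => cexp (0, (- u)%R) - 1)%C rho
    (cexp (0, (- (s * (PI / 2)))%R) * RtoC (Gamma s))%C K.
Proof.
  intros Hs.
  assert (PP := PI_RGT_0).
  destruct (gamma_prim (s + 1) ltac:(lra)) as (g & Dg & Bg & Lg).
  set (G := Gamma_Euler (s + 1)) in *.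
  assert (Tg : forall u, 0 < u -> Cmod (g u - RtoC G)%C <= 1 / (- s) * Rpower u s).
  { destruct (tail_infty g _ 1 s ltac:(lra) ltac:(lra) Dg) as (L & CL & HL).
    - intros u Hu; rewrite Cmod_R, Rabs_pos_eq by apply gamma_fun_pos; unfold gamma_fun.
      replace (s + 1 - 1) with ((s - 1) + 1) by ring; rewrite Rpower_shift1 by exact Hu.
      assert (P := Rpower_pos u (s - 1)).
      assert (X : u * exp (- u) <= 1).
      { rewrite exp_Ropp; assert (Y := exp_ineq1_le u); assert (Z := exp_pos u).
        apply Rmult_le_reg_r with (exp u); [exact Z|].
        rewrite Rmult_assoc, Rinv_l by lra; lra. }
      rewrite Rmult_assoc, Rmult_comm; apply Rmult_le_compat_r; lra.
    - rewrite <- (Clim_unique _ g _ _ CL Lg); exact HL. }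
  (* The tail of [u^(s-1) (e^{-u} - 1)] on the real axis after integration by parts; [G - g u] is
     the tail of the Euler integral for [s + 1]. At 0 it gives [G / s = Gamma s]. *)
  set (rho0 := fun u => (RtoC (- / s) * (RtoC (Rpower u s * (exp (- u) - 1)) + (g u - RtoC G)))%C).
  set (c := cexp (0, (- (s * (PI / 2)))%R)).
  assert (Ec : (c * cexp (0, (s * (PI / 2))%R) = 1)%C).
  { unfold c; rewrite <- cexp_plus, <- cexp_0; f_equal; apply injective_projections; simpl; ring. }
  assert (Ns : 0 < - / s) by (rewrite <- Rinv_opp; apply Rinv_0_lt_compat; lra).
  assert (Es : / - s = - / s) by apply Rinv_opp.
  assert (EX : forall u, 0 < u -> -1 <= exp (- u) - 1 <= 0 /\ - u <= exp (- u) - 1).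
  { intros u Hu; generalize (exp_pos (- u)) (exp_ineq1_le (- u)).
    assert (exp (- u) < 1) by (rewrite <- exp_0; apply exp_increasing; lra); lra. }
  (* Chosen to exceed every coefficient met below: the bounds of [rho] at infinity and at 0, and the
     bounds of [e] and [e']. *)
  set (K := - / s * (1 + - / s + / (s + 1)) + 10 * PI + 2).
  assert (PI1 : 0 < / (s + 1)) by (apply Rinv_0_lt_compat; lra).
  assert (A1 : 0 <= - / s * (1 + - / s)) by (apply Rmult_le_pos; lra).
  assert (A2 : 0 <= - / s * (1 + / (s + 1))) by (apply Rmult_le_pos; lra).
  assert (A3 : 0 <= - / s * / (s + 1)) by (apply Rmult_le_pos; lra).
  assert (A4 : 0 <= - / s * - / s) by (apply Rmult_le_pos; lra).
  exists (fun u => c * (rho0 u - arcint s u))%C, K.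
  split.
  - intros u Hu; eapply Cder_eq.
    + apply Cder_scal, Cder_minus; [|apply arcint_der; lra].
      unfold rho0; apply Cder_scal, Cder_plus.
      * apply Cder_RtoC, is_derive_mult_R; [apply is_derive_Rpower, Hu|].
        auto_derive; [exact I|reflexivity].
      * apply Cder_minus; [apply Dg, Hu|apply Cder_const].
    + unfold gamma_fun; replace (s + 1 - 1) with s by ring.
      set (E := cexp (0, (s * (PI / 2))%R)) in *.
      replace (s * Rpower u (s - 1) * (exp (- u) - 1) + Rpower u s * (- (1) * exp (- u)))%R
        with (s * (Rpower u (s - 1) * (exp (- u) - 1)) - Rpower u s * exp (- u))%R by ring.
      rewrite RtoC_minus.
      replace (RtoC (- / s) * (RtoC (s * (Rpower u (s - 1) * (exp (- u) - 1))) -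
         RtoC (Rpower u s * exp (- u)) + (RtoC (Rpower u s * exp (- u)) - 0)))%C
        with (- RtoC (Rpower u (s - 1) * (exp (- u) - 1)))%C.
      * rewrite RtoC_mult, RtoC_minus.
        transitivity (- (RtoC (Rpower u (s - 1)) * ((c * E) * (cexp (0, (- u)%R) - 1))))%C;
          [ring|rewrite Ec; ring].
      * transitivity (RtoC (- / s * (s * (Rpower u (s - 1) * (exp (- u) - 1)))));
          [rewrite <- RtoC_opp; f_equal; field; lra|rewrite (RtoC_mult (- / s)); ring].
  - intros u Hu.
    assert (P := Rpower_pos u s).
    unfold c; rewrite Cmod_mult, Cmod_cexp_i, Rmult_1_l.
    eapply Rle_trans; [apply Cmod_triangle_minus|].
    assert (B0 : Cmod (rho0 u) <= - / s * (1 + - / s) * Rpower u s).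
    { unfold rho0; rewrite Cmod_mult, Cmod_R, Rabs_pos_eq by lra.
      rewrite Rmult_assoc; apply Rmult_le_compat_l; [lra|].
      eapply Rle_trans; [apply Cmod_triangle|].
      rewrite Rmult_plus_distr_r; apply Rplus_le_compat.
      - rewrite Cmod_R, Rabs_mult, Rabs_pos_eq by lra.
        rewrite Rmult_comm; apply Rmult_le_compat_r; [lra|].
        destruct (EX u Hu); apply Rabs_le; lra.
      - eapply Rle_trans; [apply Tg, Hu|]; unfold Rdiv; rewrite Es; lra. }
    generalize (arcint_infty s u Hu); intros B1.
    assert (0 <= (- / s * / (s + 1) + 2) * Rpower u s) by (apply Rmult_le_pos; lra).
    unfold K; nra.
  - intros u Hu.
    assert (P := Rpower_pos u (s + 1)).
    replace (c * (rho0 u - arcint s u) - c * RtoC (Gamma s))%C with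
      (c * ((rho0 u - RtoC (Gamma s)) - arcint s u))%C by ring.
    unfold c; rewrite Cmod_mult, Cmod_cexp_i, Rmult_1_l.
    eapply Rle_trans; [apply Cmod_triangle_minus|].
    assert (B0 : Cmod (rho0 u - RtoC (Gamma s))%C <=
              - / s * (1 + / (s + 1)) * Rpower u (s + 1)).
    { replace (rho0 u - RtoC (Gamma s))%C with
        (RtoC (- / s) * (RtoC (Rpower u s * (exp (- u) - 1)) + g u))%C.
      - rewrite Cmod_mult, Cmod_R, Rabs_pos_eq by lra.
        rewrite Rmult_assoc; apply Rmult_le_compat_l; [lra|].
        eapply Rle_trans; [apply Cmod_triangle|].
        rewrite Rmult_plus_distr_r; apply Rplus_le_compat; [|apply Bg, Hu].
        assert (P' := Rpower_pos u s).
        rewrite Cmod_R, Rabs_mult, Rabs_pos_eq by lra.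
        rewrite Rpower_shift1, Rmult_1_l by exact Hu.
        apply Rmult_le_compat_l; [lra|].
        destruct (EX u Hu); apply Rabs_le; lra.
      - rewrite Gamma_neg by exact Hs; unfold rho0; fold G.
        replace (G / s) with (- / s * - G) by (field; lra).
        rewrite (RtoC_mult (- / s) (- G)), (RtoC_opp G); ring. }
    generalize (arcint_zero s u Hu); intros B1.
    assert (0 <= (- / s * - / s + 2 + 5 * PI) * Rpower u (s + 1)) by (apply Rmult_le_pos; lra).
    unfold K; nra.
  - intros u; eapply Rle_trans; [apply Cmod_triangle_minus|].
    rewrite Cmod_cexp_i, Cmod_1; unfold K; lra.
  - exists (fun u => Ci * RtoC (-1) * cexp (0, (- u)%R))%C; split.
    + intros u; eapply Cder_eq.
      * apply Cder_minus; [|apply Cder_const].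
        apply (Cder_eix Ropp); auto_derive; [exact I|reflexivity].
      * replace (RtoC (-1)) with (RtoC (- (1))) by (f_equal; ring); ring.
    + intros u; rewrite !Cmod_mult, Cmod_cexp_i, Cmod_Ci, Cmod_R.
      rewrite Rabs_left by lra; unfold K; lra.
Qed.

Lemma Cder_conj f x l : Cder f x l -> Cder (fun t => Cconj (f t)) x (Cconj l).
Proof.
  intros [H1 H2]; split; [exact H1|].
  apply (@is_derive_opp R_AbsRing R_NormedModule (fun t => snd (f t))), H2.
Qed.

Lemma Cconj_cexp_i y : Cconj (cexp (0, y)) = cexp (0, - y).
Proof.
  unfold cexp, Cconj; simpl; rewrite cos_neg, sin_neg; apply injective_projections; simpl; ring.
Qed.

(** Supplies the kernel for negative [x], where [e^{-iu}] turns into its conjugate. *)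
Lemma kernel_conj s tau e rho kappa K : kernel s tau e rho kappa K ->
  kernel s tau (fun u => Cconj (e u)) (fun u => Cconj (rho u)) (Cconj kappa) K.
Proof.
  intros [H1 H2 H3 H4 (e' & H5 & H6)]; split.
  - intros u Hu; eapply Cder_eq; [apply Cder_conj, H1, Hu|].
    apply injective_projections; simpl; ring.
  - intros u Hu; rewrite Cmod_conj; auto.
  - intros u Hu; rewrite <- Cminus_conj, Cmod_conj; auto.
  - intros u; rewrite Cmod_conj; auto.
  - exists (fun u => Cconj (e' u)); split; [intros u; apply Cder_conj, H5|].
    intros u; rewrite Cmod_conj; auto.
Qed.

(** * The transform of [x^(s-1)] for [-1 <= s < 0] *)

Lemma Rpower_le_sqr q x : 0 <= q <= 2 -> 0 < x -> Rpower x q <= 1 + x ^ 2.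
Proof.
  intros Hq Hx; destruct (Rle_dec 1 x) as [H|H].
  - assert (X := Rpower_le_pow 1 x q 2 Rlt_0_1 H ltac:(simpl; lra)).
    unfold Rpower in X at 2; rewrite ln_1, Rmult_0_r, exp_0, Rmult_1_l in X; lra.
  - assert (0 <= x ^ 2) by apply pow2_ge_0.
    assert (L : ln x < 0) by (rewrite <- ln_1; apply ln_increasing; lra).
    assert (Rpower x q <= 1); [|lra].
    unfold Rpower; rewrite <- exp_0.
    destruct (Req_dec (q * ln x) 0) as [->|N]; [lra|].
    left; apply exp_increasing; nra.
Qed.

Lemma Sch_decay_Rpower f q : Sch f -> 0 <= q <= 2 ->
  exists M, 0 <= M /\ forall x, 0 < x -> Rpower x q * Cmod (f x) <= M / (1 + x²).
Proof.
  intros Hf Hq.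
  destruct (Sch_decay f 0 Hf) as (M0 & P0 & H0).
  destruct (Sch_decay f 2 Hf) as (M2 & P2 & H2).
  exists (M0 + M2); split; [lra|]; intros x Hx.
  assert (N := Cmod_ge_0 (f x)).
  apply Rle_trans with ((1 + x ^ 2) * Cmod (f x)).
  - apply Rmult_le_compat_r; [exact N|apply Rpower_le_sqr; assumption].
  - generalize (H0 x) (H2 x); rewrite pow2_abs, pow_O; unfold Rdiv; lra.
Qed.

Lemma div_weight K M x : K * (M / (1 + x²)) = K * M / (1 + x²).
Proof. unfold Rdiv; ring. Qed.

Lemma Int0_Rpower_ex f q : Sch f -> 0 <= q <= 2 ->
  exists l, Int0 (fun x => RtoC (Rpower x q) * f x)%C l.
Proof.
  intros Hf Hq; destruct (Sch_decay_Rpower f q Hf Hq) as (M & PM & HM).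
  apply (IntD_ex good_pos _ M).
  - intros x Hx; apply Rpower_Sch_cont; assumption.
  - intros x Hx; rewrite Cmod_mult, Cmod_Rpower; apply HM, Hx.
Qed.

Section KernelIntegral.

Variables (s tau : R) (e rho : R -> C) (kappa : C) (K : R) (phi : R -> C).
Hypotheses (Hs : -1 <= s < 0) (Htau : 0 < tau <= 1) (Hk : kernel s tau e rho kappa K)
  (Hphi : Sch phi).

Let kerfun (N x : R) : C := (RtoC (Rpower x (- s)) * phi x * rho (N * x)%R)%C.

Let kerint (N : R) : C := epsilon (inhabits (RtoC 0)) (Int0 (kerfun N)).

Lemma ker_K_pos : 0 <= K.
Proof. eapply Rle_trans; [apply Cmod_ge_0|apply (ker_e _ _ _ _ _ _ Hk 0)]. Qed.

Lemma kerfun_bound M N x : 0 < N -> 0 < x ->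
  Cmod (phi x) <= M / (1 + x²) -> Cmod (kerfun N x) <= K * Rpower N s * M / (1 + x²).
Proof.
  intros HN Hx HM; unfold kerfun; rewrite !Cmod_mult, Cmod_Rpower.
  assert (HNx : 0 < N * x) by (apply Rmult_lt_0_compat; assumption).
  assert (R := ker_infty _ _ _ _ _ _ Hk (N * x) HNx).
  rewrite <- Rpower_mult_distr in R by assumption.
  assert (E : Rpower x (- s) * Rpower x s = 1).
  { rewrite <- Rpower_plus; replace (- s + s) with 0 by ring; apply Rpower_O, Hx. }
  assert (P := Rpower_pos x (- s)). assert (KP := ker_K_pos).
  apply Rle_trans with (Rpower x (- s) * Cmod (phi x) * (K * (Rpower N s * Rpower x s))).
  - apply Rmult_le_compat_l; [|exact R].
    apply Rmult_le_pos; [lra|apply Cmod_ge_0].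
  - replace (Rpower x (- s) * Cmod (phi x) * (K * (Rpower N s * Rpower x s))) with
      (K * Rpower N s * Cmod (phi x) * (Rpower x (- s) * Rpower x s)) by ring.
    rewrite E, Rmult_1_r, <- div_weight.
    apply Rmult_le_compat_l; [|exact HM].
    apply Rmult_le_pos; [exact KP|left; apply Rpower_pos].
Qed.

Lemma kerint_spec N : 0 < N -> Int0 (kerfun N) (kerint N).
Proof.
  intros HN; unfold kerint; apply epsilon_spec.
  destruct (Sch_decay phi 0 Hphi) as (M & PM & HM).
  apply (IntD_ex good_pos _ (K * Rpower N s * M)).
  - intros x Hx; unfold kerfun; apply Ccont_mult; [apply Rpower_Sch_cont; assumption|].
    eapply Cder_cont, (Cder_comp rho (fun x => N * x)).
    + apply (ker_der _ _ _ _ _ _ Hk), Rmult_lt_0_compat; assumption.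
    + auto_derive; [exact I|reflexivity].
  - intros x Hx; apply kerfun_bound; [exact HN|exact Hx|].
    generalize (HM x); rewrite pow_O, Rmult_1_l; auto.
Qed.

Lemma e_int_ex N : exists V, Int0 (fun x => phi x * e (N * x)%R)%C V.
Proof.
  destruct (Sch_decay phi 0 Hphi) as (M & PM & HM).
  destruct (ker_e' _ _ _ _ _ _ Hk) as (e' & De & _).
  apply (IntD_ex good_pos _ (K * M)).
  - intros x Hx; apply Ccont_mult; [apply Sch_cont, Hphi|].
    eapply Cder_cont, (Cder_comp e (fun x => N * x)); [apply De|].
    auto_derive; [exact I|reflexivity].
  - intros x Hx; rewrite Cmod_mult, Rmult_comm, <- div_weight.
    generalize (HM x); rewrite pow_O, Rmult_1_l; intros.
    apply Rmult_le_compat; try apply Cmod_ge_0; [apply (ker_e _ _ _ _ _ _ Hk)|assumption].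
Qed.

(** The powers of [x] cancel, [x^(-s) x x^(s-1) = 1]. Since it also vanishes at infinity, [kerint N]
    is the iterated integral over frequencies beyond [N], taken in the other order. *)
Lemma kerint_der N V : 0 < N -> Int0 (fun x => phi x * e (N * x)%R)%C V ->
  Cder kerint N (- RtoC (Rpower N (s - 1)) * V)%C.
Proof.
  intros HN HV.
  destruct (Sch_decay phi 0 Hphi) as (M0 & P0 & H0).
  destruct (Sch_decay phi 1 Hphi) as (M1 & P1 & H1).
  destruct (ker_e' _ _ _ _ _ _ Hk) as (e' & De & Be).
  assert (KP := ker_K_pos).
  set (A0 := Rabs (s - 1) * Rpower (N / 2) (s - 1 - 1)).
  set (A1 := Rpower (N / 2) (s - 1)).
  assert (PA0 : 0 <= A0) by (apply Rmult_le_pos; [apply Rabs_pos|left; apply Rpower_pos]).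
  assert (PA1 : 0 <= A1) by (left; apply Rpower_pos).
  assert (U : forall t, Rabs (t - N) < N / 2 -> N / 2 <= t).
  { intros t Ht; apply Rabs_def2 in Ht; lra. }
  apply (IntD_param good_pos kerfun
    (fun t x => - RtoC (Rpower t (s - 1)) * (phi x * e (t * x)%R))%C
    (fun t x => - (RtoC ((s - 1) * Rpower t (s - 1 - 1)) * (phi x * e (t * x)%R) +
         RtoC (Rpower t (s - 1)) * (phi x * (RtoC x * e' (t * x)%R))))%C
    N (N / 2) (A0 * (K * M0) + A1 * (K * M1))); [lra| | | | | |].
  - apply Rplus_le_le_0_compat; (apply Rmult_le_pos; [assumption|apply Rmult_le_pos; assumption]).
  - intros t x Ht Hx; apply U in Ht; unfold posR in Hx.
    assert (Ht0 : 0 < t) by lra.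
    unfold kerfun; eapply Cder_eq.
    + apply Cder_scal, (Cder_comp rho (fun t => t * x)).
      * apply (ker_der _ _ _ _ _ _ Hk), Rmult_lt_0_compat; assumption.
      * auto_derive; [exact I|reflexivity].
    + rewrite Rmult_1_l, <- (Rpower_mult_distr t x (s - 1) Ht0 Hx).
      assert (E : (RtoC (Rpower x (- s)) * RtoC x * RtoC (Rpower x (s - 1)) = 1)%C).
      { rewrite <- !RtoC_mult; f_equal; rewrite <- (Rpower_1 x Hx) at 2.
        rewrite <- !Rpower_plus; replace (- s + 1 + (s - 1)) with 0 by ring.
        apply Rpower_O, Hx. }
      rewrite RtoC_mult.
      transitivity (- RtoC (Rpower t (s - 1)) * (phi x * e (t * x)%R) *
        (RtoC (Rpower x (- s)) * RtoC x * RtoC (Rpower x (s - 1))))%C;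
        [ring|rewrite E; ring].
  - intros t x Ht Hx; apply U in Ht; eapply Cder_eq.
    + apply Cder_mult.
      * apply Cder_opp, Cder_Rpower; lra.
      * apply Cder_scal, (Cder_comp e (fun t => t * x)); [apply De|].
        auto_derive; [exact I|reflexivity].
    + cbv beta; rewrite Rmult_1_l; ring.
  - intros t x Ht Hx; apply U in Ht; unfold posR in Hx.
    rewrite Cmod_opp; eapply Rle_trans; [apply Cmod_triangle|].
    unfold Rdiv; rewrite Rmult_plus_distr_r; apply Rplus_le_compat.
    + rewrite !Cmod_mult, Cmod_R, Rmult_assoc, (Rmult_comm (Cmod (phi x))).
      apply Rmult_le_compat; [apply Rabs_pos|apply Rmult_le_pos; apply Cmod_ge_0| |].
      * rewrite Rabs_mult, (Rabs_pos_eq (Rpower _ _)) by (left; apply Rpower_pos).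
        apply Rmult_le_compat_l; [apply Rabs_pos|apply Rpower_le_neg; lra].
      * rewrite Rmult_assoc; apply Rmult_le_compat; try apply Cmod_ge_0;
          [apply (ker_e _ _ _ _ _ _ Hk)|].
        generalize (H0 x); rewrite pow_O, Rmult_1_l; auto.
    + rewrite !Cmod_mult, Cmod_Rpower, Cmod_R, Rmult_assoc.
      apply Rmult_le_compat; [left; apply Rpower_pos| | |].
      * repeat apply Rmult_le_pos; try apply Cmod_ge_0; apply Rabs_pos.
      * apply Rpower_le_neg; lra.
      * replace (Cmod (phi x) * (Rabs x * Cmod (e' (t * x)))) with
          (Cmod (e' (t * x)) * (Rabs x * Cmod (phi x))) by ring.
        rewrite Rmult_assoc; apply Rmult_le_compat; [apply Cmod_ge_0| |apply Be|].
        -- apply Rmult_le_pos; [apply Rabs_pos|apply Cmod_ge_0].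
        -- generalize (H1 x); rewrite pow_1; auto.
  - intros t Ht; apply U in Ht; apply kerint_spec; lra.
  - apply (IntD_scal good_pos), HV.
Qed.

Lemma kerint_infty : exists M, forall N, 0 < N -> Cmod (kerint N) <= M * Rpower N s.
Proof.
  destruct (Sch_decay phi 0 Hphi) as (M & PM & HM).
  assert (KP := ker_K_pos).
  exists (K * M * PI); intros N HN.
  replace (K * M * PI * Rpower N s) with (K * Rpower N s * M * PI) by ring.
  apply (IntD_bound good_pos _ _ (K * Rpower N s * M) ) with (2 := kerint_spec N HN).
  - repeat apply Rmult_le_pos; auto; left; apply Rpower_pos.
  - intros x Hx; apply kerfun_bound; [exact HN|exact Hx|].
    generalize (HM x); rewrite pow_O, Rmult_1_l; auto.
Qed.

(** The rate of [rho] at 0 leaves the weight [x^(tau - s)], whose exponent lies in [[0, 2]] and is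
    absorbed by the decay of [phi]. *)
Lemma kerint_zero Lam : Int0 (fun x => RtoC (Rpower x (- s)) * (kappa * phi x))%C Lam ->
  exists M, forall N, 0 < N -> Cmod (kerint N - Lam)%C <= M * Rpower N tau.
Proof.
  intros HL.
  destruct (Sch_decay_Rpower phi (tau - s) Hphi ltac:(lra)) as (M & PM & HM).
  assert (KP := ker_K_pos).
  exists (K * M * PI); intros N HN.
  assert (PN := Rpower_pos N tau).
  replace (K * M * PI * Rpower N tau) with (K * Rpower N tau * M * PI) by ring.
  apply (IntD_bound good_pos (fun x => kerfun N x +
    (-1) * (RtoC (Rpower x (- s)) * (kappa * phi x)))%C).
  - repeat apply Rmult_le_pos; auto; lra.
  - replace (kerint N - Lam)%C with (kerint N + (-1) * Lam)%C by ring.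
    apply (IntD_plus good_pos), (IntD_scal good_pos), HL; apply kerint_spec, HN.
  - intros x Hx; unfold posR in Hx.
    assert (HNx : 0 < N * x) by (apply Rmult_lt_0_compat; assumption).
    unfold kerfun.
    replace (RtoC (Rpower x (- s)) * phi x * rho (N * x)%R +
      -1 * (RtoC (Rpower x (- s)) * (kappa * phi x)))%C
      with (RtoC (Rpower x (- s)) * phi x * (rho (N * x)%R - kappa))%C by ring.
    rewrite !Cmod_mult, Cmod_Rpower.
    assert (Z := ker_zero _ _ _ _ _ _ Hk (N * x) HNx).
    rewrite <- Rpower_mult_distr in Z by assumption.
    apply Rle_trans with (Rpower x (- s) * Cmod (phi x) * (K * (Rpower N tau * Rpower x tau))).
    + apply Rmult_le_compat_l; [|exact Z].
      apply Rmult_le_pos; [left; apply Rpower_pos|apply Cmod_ge_0].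
    + rewrite <- div_weight.
      replace (Rpower x (- s) * Cmod (phi x) * (K * (Rpower N tau * Rpower x tau))) with
        (K * Rpower N tau * (Rpower x tau * Rpower x (- s) * Cmod (phi x))) by ring.
      rewrite <- Rpower_plus.
      apply Rmult_le_compat_l; [apply Rmult_le_pos; lra|apply HM, Hx].
Qed.

Lemma kernel_integral : exists (Rk : R -> C) Lam M,
  Int0 (fun x => RtoC (Rpower x (- s)) * (kappa * phi x))%C Lam /\
  (forall N V, 0 < N -> Int0 (fun x => phi x * e (N * x)%R)%C V ->
     Cder Rk N (- RtoC (Rpower N (s - 1)) * V)%C) /\
  (forall N, 0 < N -> Cmod (Rk N) <= M * Rpower N s) /\
  (forall N, 0 < N -> Cmod (Rk N - Lam)%C <= M * Rpower N tau) /\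
  (forall N, exists V, Int0 (fun x => phi x * e (N * x)%R)%C V).
Proof.
  destruct (Int0_Rpower_ex (fun x => kappa * phi x)%C (- s) (Sch_scal _ _ Hphi) ltac:(lra))
    as [Lam HL].
  destruct kerint_infty as [M1 H1].
  destruct (kerint_zero Lam HL) as [M2 H2].
  exists kerint, Lam, (Rmax M1 M2); split; [exact HL|split; [|split; [|split]]].
  - exact kerint_der.
  - intros N HN; eapply Rle_trans; [apply H1, HN|].
    apply Rmult_le_compat_r; [left; apply Rpower_pos|apply Rmax_l].
  - intros N HN; eapply Rle_trans; [apply H2, HN|].
    apply Rmult_le_compat_r; [left; apply Rpower_pos|apply Rmax_r].
  - apply e_int_ex.
Qed.

End KernelIntegral.

Lemma Clim_at_right f x l : Cder f x l -> Clim (at_right x) f (f x).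
Proof.
  intros H e He; generalize (Cder_Clim f x l H e He); apply filter_le_within.
Qed.

(** [H(x) - H(-x)] is an antiderivative of the folded integrand and vanishes at 0. *)
Lemma IntR_fold f l : IntR f l -> Int0 (fun x => f x + f (- x)%R)%C l.
Proof.
  intros (H & la & lb & D & A & B & ->).
  replace (lb - la)%C with ((lb + (-1) * la) - 0)%C by ring.
  apply IntD_prim with (fun x => H x + (-1) * H (- x)%R)%C.
  - intros x _; eapply Cder_eq.
    + apply Cder_plus; [apply D, I|apply Cder_scal, Cder_opp_arg, D, I].
    + ring.
  - replace (RtoC 0) with (H 0%R + (-1) * H (- 0)%R)%C by (rewrite Ropp_0; ring).
    eapply (Clim_at_right (fun x => H x + (-1) * H (- x)%R)%C).
    apply Cder_plus; [apply D, I|apply Cder_scal, Cder_opp_arg, D, I].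
  - apply Clim_plus; [apply Rbar_locally_filter|exact B|].
    apply Clim_scal; [apply Rbar_locally_filter|apply Clim_comp_opp_m, A].
Qed.

(** [e1] acts on the positive half of [phi] and [e2] on the negative half; [(a, b)] is [(1, 0)] for
    the exponential kernel and [(1, 1)] for the cosine. The finite part is the limit at 0 of the two
    kernel integrals. *)
Lemma FP1_kernel s tau e1 e2 rho1 rho2 k1 k2 K1 K2 phi (a b : C) :
  -1 <= s < 0 -> 0 < tau <= 1 -> Sch phi ->
  kernel s tau e1 rho1 k1 K1 -> kernel s tau e2 rho2 k2 K2 ->
  (forall u, e1 u = (a * (cexp (0, (- u)%R) - 1) + b * (cexp (0, u) - 1))%C) ->
  (forall u, e2 u = (a * (cexp (0, u) - 1) + b * (cexp (0, (- u)%R) - 1))%C) ->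
  exists Lam, Int0 (fun x => RtoC (Rpower x (- s)) * (k1 * phi x + k2 * phi (- x)%R))%C Lam /\
    FP1 (s - 1) (fun k => a * Four phi k + b * Four phi (- k)%R)%C Lam.
Proof.
  intros Hs Htau Hphi HK1 HK2 E1 E2.
  destruct (kernel_integral s tau e1 rho1 k1 K1 phi Hs Htau HK1 Hphi)
    as (R1 & L1 & M1 & I1 & D1 & B1 & Z1 & X1).
  destruct (kernel_integral s tau e2 rho2 k2 K2 (fun x => phi (- x)) Hs Htau HK2
    (Sch_refl phi Hphi)) as (R2 & L2 & M2 & I2 & D2 & B2 & Z2 & X2).
  exists (L1 + L2)%C; split.
  { eapply IntD_ext; [|apply (IntD_plus good_pos); [apply I1|apply I2]].
    intros x _; simpl; ring. }
  set (psi := Four phi).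
  (* Glued together, the two half-lines give whole-line transforms; the terms [-1] of the kernels
     produce the subtraction of [psi 0]. *)
  assert (V : forall N V1 V2, Int0 (fun x => phi x * e1 (N * x)%R)%C V1 ->
    Int0 (fun x => phi (- x)%R * e2 (N * x)%R)%C V2 ->
    (V1 + V2 = a * psi N + b * psi (- N)%R + (- (a + b)) * psi 0%R)%C).
  { intros N V1 V2 HV1 HV2.
    apply (IntD_unique good_pos _ _ _ (IntD_plus good_pos _ _ _ _ HV1 HV2)).
    eapply IntD_ext; [|apply IntR_fold, (IntD_plus good_R); [apply (IntD_plus good_R)|];
      apply (IntD_scal good_R), (Four_spec phi), Hphi].
    intros x _; rewrite E1, E2; cbv beta.
    rewrite !Rmult_0_l, Ropp_0.
    replace (- (N * - x)) with (N * x) by ring.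
    replace (- (- N * x)) with (N * x) by ring.
    replace (- (- N * - x)) with (- (N * x)) by ring.
    replace (cexp (0, 0)) with (RtoC 1) by (symmetry; apply cexp_0).
    ring. }
  (* Restores the subtracted [psi 0]: its integral against [x^(s-1)] is a pure power [x^s], which
     vanishes at infinity and is discarded at 0 by [FP_pow]. *)
  set (c := ((a + b) * psi 0%R * RtoC (/ s))%C).
  set (H := fun k => ((-1) * (R1 k + R2 k) + c * RtoC (Rpower k s))%C).
  exists (fun e => 0 - H e)%C; split.
  - intros e He; apply IntD_prim with H; [|apply Clim_at_point|].
    + intros x Hx; unfold posR in Hx.
      destruct (X1 x) as [V1 HV1], (X2 x) as [V2 HV2].
      assert (EV := V x V1 V2 HV1 HV2).
      unfold H; eapply Cder_eq.
      * apply Cder_plus; apply Cder_scal; [|apply Cder_Rpower, Hx].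
        apply Cder_plus; [apply (D1 x V1 Hx HV1)|apply (D2 x V2 Hx HV2)].
      * unfold c; rewrite RtoC_mult.
        transitivity (RtoC (Rpower x (s - 1)) * (V1 + V2) +
          (RtoC (/ s) * RtoC s) * ((a + b) * psi 0%R * RtoC (Rpower x (s - 1))))%C; [ring|].
        rewrite EV, <- RtoC_mult, Rinv_l by lra; ring.
    + apply (Clim_le _ _ (fun x => (M1 + M2 + Cmod c) * Rpower x s)).
      * exists 0; intros x Hx.
        replace (H x - 0)%C with (H x) by ring; unfold H.
        eapply Rle_trans; [apply Cmod_triangle|].
        rewrite !Cmod_mult, Cmod_Rpower, Cmod_R, (Rabs_left (-1)) by lra.
        generalize (Cmod_triangle (R1 x) (R2 x)) (B1 x Hx) (B2 x Hx); lra.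
      * apply filterlim_Rscal0, Rpower_lim_infty; [apply Rbar_locally_filter|lra].
  - replace (L1 + L2)%C with (L1 + L2 + 0)%C by ring.
    apply FP_ext with (fun e => (R1 e + R2 e) + (- c) * RtoC (Rpower e s))%C;
      [intros e _; unfold H; ring|].
    apply FP_plus; [|apply FP_pow; lra].
    apply FP_lim, (Clim_le _ _ (fun x => (M1 + M2) * Rpower x tau)).
    + apply at_right_pos; intros x Hx.
      replace (R1 x + R2 x - (L1 + L2))%C with ((R1 x - L1) + (R2 x - L2))%C by ring.
      eapply Rle_trans; [apply Cmod_triangle|].
      generalize (Z1 x Hx) (Z2 x Hx); lra.
    + apply filterlim_Rscal0, Rpower_lim0; [apply at_right_proper_filter|lra].
Qed.

(** * Non-integer exponents *)

Definition nonint (s : R) : Prop := forall z : Z, s <> IZR z.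

Lemma nonint_plus s z : nonint s -> nonint (s + IZR z).
Proof. intros H y E; apply (H (y - z)%Z); rewrite minus_IZR; lra. Qed.

Lemma nonint_opp s : nonint s -> nonint (- s).
Proof. intros H y E; apply (H (- y)%Z); rewrite opp_IZR; lra. Qed.

Lemma nonint_INR s j : nonint s -> s <> - INR j.
Proof. intros H E; apply (H (- Z.of_nat j)%Z); rewrite opp_IZR, <- INR_IZR_INZ; exact E. Qed.

Lemma Cder_unique f x a b : Cder f x a -> Cder f x b -> a = b.
Proof.
  intros [A1 A2] [B1 B2]; apply injective_projections.
  - rewrite <- (is_derive_unique _ _ _ A1); apply is_derive_unique, B1.
  - rewrite <- (is_derive_unique _ _ _ A2); apply is_derive_unique, B2.
Qed.

Lemma FP1_down_nonint b w w' L : nonint b -> Sch w -> (forall x, Cder w x (w' x)) ->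
  FP1 b w' L -> FP1 (b - 1) w (RtoC (- / b) * L)%C.
Proof.
  intros Hb (W & HW & W0) D H.
  apply (FP1_ext (b - 1) _ (W 0%nat)); [intros x _; rewrite W0; reflexivity|].
  apply FP1_down; [exact HW|apply (Hb 0%Z)| |].
  - intros j E; destruct (nonint_INR b j Hb E).
  - apply (FP1_ext b _ w'); [|exact H].
    intros x _; f_equal.
    apply (Cder_unique w x); [apply D|apply (Cder_ext (W 0%nat)); [exact W0|apply HW]].
Qed.

Lemma Int0_FP1 b w L : Int0 (fun x => RtoC (Rpower x b) * w x)%C L -> FP1 b w L.
Proof.
  intros (H & la & lb & D & A & B & ->).
  exists (fun e => lb - H e)%C; split.
  - intros e He; apply IntD_prim with H; [exact D|apply Clim_at_point|exact B].
  - apply FP_lim, Clim_plus; try apply at_right_proper_filter.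
    + apply Clim_const; apply at_right_proper_filter.
    + apply Clim_opp; [apply at_right_proper_filter|exact A].
Qed.

Lemma cexp_quarter_plus y : cexp (0, y + PI / 2) = (Ci * cexp (0, y))%C.
Proof.
  unfold cexp; simpl; rewrite cos_plus, sin_plus, cos_PI2, sin_PI2, exp_0.
  apply injective_projections; simpl; ring.
Qed.

Lemma cexp_quarter_minus y : cexp (0, y - PI / 2) = (- Ci * cexp (0, y))%C.
Proof.
  unfold cexp; simpl; rewrite cos_minus, sin_minus, cos_PI2, sin_PI2, exp_0.
  apply injective_projections; simpl; ring.
Qed.

Lemma Ci2 : (Ci * Ci = - (1))%C.
Proof. apply injective_projections; simpl; ring. Qed.

(* [s = alpha + 1]: the transform of [x_+^alpha] is [Gamma(s) (i x)^(-s)]. *)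
Definition halfline (s : R) : Prop := forall phi, Sch phi -> exists L,
  FP1 (- s) (fun x => cexp (0, (- (s * (PI / 2)))%R) * phi x +
                      cexp (0, (s * (PI / 2))%R) * phi (- x)%R)%C L /\
  FP1 (s - 1) (Four phi) (RtoC (Gamma s) * L)%C.

Lemma halfline_base s : -1 < s < 0 -> halfline s.
Proof.
  intros Hs phi Hphi.
  destruct (exp_kernel s Hs) as (rho & K & HK).
  assert (HK2 := kernel_conj _ _ _ _ _ _ HK).
  destruct (FP1_kernel s (s + 1) _ _ _ _ _ _ _ _ phi 1%C 0%C ltac:(lra) ltac:(lra) Hphi HK HK2)
    as (Lam & I1 & H1).
  { intros u; ring. }
  { intros u; rewrite Cminus_conj, Cconj_cexp_i, Ropp_involutive.
    replace (Cconj (RtoC 1)) with (RtoC 1) by (apply injective_projections; simpl; ring); ring. }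
  destruct (Int0_Rpower_ex (fun x => cexp (0, (- (s * (PI / 2)))%R) * phi x +
                      cexp (0, (s * (PI / 2))%R) * phi (- x)%R)%C (- s)) as [L HL].
  { apply Sch_plus; apply Sch_scal; [exact Hphi|apply Sch_refl, Hphi]. }
  { lra. }
  exists L; split; [apply Int0_FP1, HL|].
  replace (RtoC (Gamma s) * L)%C with Lam.
  - eapply FP1_ext; [|apply H1]; intros x _; simpl; ring.
  - apply (IntD_unique good_pos _ _ _ I1).
    eapply IntD_ext; [|apply (IntD_scal good_pos (RtoC (Gamma s))), HL].
    intros x _; cbv beta.
    rewrite Cmult_conj, Cconj_cexp_i, Ropp_involutive.
    replace (Cconj (RtoC (Gamma s))) with (RtoC (Gamma s))
      by (apply injective_projections; simpl; ring).
    ring.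
Qed.

(** The formula at [s] is tested on [-i x phi], whose transform is [psi']; [FP1_down] lowers the
    exponent there. On the other side [x] joins the power, and [-i x] against the quarter turns of
    the phases leaves [-1]. The constants match by [Gamma s = (s - 1) Gamma (s - 1)]. *)
Lemma halfline_down s : nonint s -> halfline s -> halfline (s - 1).
Proof.
  intros Hs H phi Hphi.
  destruct (H _ (Sch_mulix 1 phi Hphi)) as (L & H1 & H2).
  exists ((-1) * L)%C; split.
  - eapply FP1_ext; [|apply (FP1_scal _ (-1)%C), H1].
    intros x Hx; unfold mulix; cbv beta.
    replace (- (s - 1)) with (- s + 1) by ring.
    rewrite Rpower_shift1 by exact Hx.
    replace (- ((s - 1) * (PI / 2))) with (- (s * (PI / 2)) + PI / 2) by ring.
    replace ((s - 1) * (PI / 2)) with (s * (PI / 2) - PI / 2) by ring.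
    rewrite cexp_quarter_plus, cexp_quarter_minus, RtoC_mult, RtoC_opp; ring.
  - assert (Hb : nonint (s - 1)) by apply (nonint_plus s (-1)), Hs.
    assert (X := FP1_down (s - 1) _ _ (sch_Four phi Hphi) (Hb 0%Z)
      (fun j E => False_ind _ (nonint_INR _ j Hb E)) H2).
    simpl mulix in X.
    replace (RtoC (Gamma (s - 1)) * (-1 * L))%C with
      (RtoC (- / (s - 1)) * (RtoC (Gamma s) * L))%C; [exact X|].
    replace (Gamma s) with ((s - 1) * Gamma (s - 1))
      by (rewrite <- Gamma_rec by exact Hb; f_equal; ring).
    transitivity (RtoC (- / (s - 1) * ((s - 1) * Gamma (s - 1))) * L)%C.
    + rewrite (RtoC_mult (- / (s - 1))); ring.
    + replace (- / (s - 1) * ((s - 1) * Gamma (s - 1))) with (- Gamma (s - 1))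
        by (field; generalize (Hb 0%Z); lra).
      rewrite RtoC_opp; ring.
Qed.

Lemma Four_mulk phi phi' k : Sch phi -> Sch phi' -> (forall x, Cder phi x (phi' x)) ->
  Four (fun x => - Ci * phi' x)%C k = (RtoC k * Four phi k)%C.
Proof.
  intros H H' D; rewrite Four_scal, (Four_derivative phi phi') by assumption.
  transitivity (- (Ci * Ci) * (RtoC k * Four phi k))%C; [ring|rewrite Ci2; ring].
Qed.

(** Dual to the downward step: the test function is [-i phi'], whose transform [k psi] raises the
    exponent, and the integration by parts now takes place on the side of [phi]. *)
Lemma halfline_up s : nonint s -> halfline s -> halfline (s + 1).
Proof.
  intros Hs H phi Hphi.
  assert (S0 : s <> 0) by apply (Hs 0%Z).
  destruct (Sch_der phi Hphi) as (phi' & Hphi' & D).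
  destruct (H _ (Sch_scal (- Ci)%C phi' Hphi')) as (L & H1 & H2).
  exists (RtoC (- / - s) * L)%C; split.
  - set (w := fun x => (- Ci * (cexp (0, (- (s * (PI / 2)))%R) * phi x +
                      (-1) * (cexp (0, (s * (PI / 2))%R) * phi (- x)%R)))%C).
    eapply FP1_ext; [|eapply (FP1_down_nonint (- s) w); [| | |exact H1]].
    + intros x Hx; unfold w.
      replace (- (s + 1)) with (- s - 1) by ring.
      replace (- ((s + 1) * (PI / 2))) with (- (s * (PI / 2)) - PI / 2) by ring.
      replace ((s + 1) * (PI / 2)) with (s * (PI / 2) + PI / 2) by ring.
      rewrite cexp_quarter_plus, cexp_quarter_minus; ring.
    + apply nonint_opp, Hs.
    + unfold w; apply Sch_scal, Sch_plus; apply Sch_scal; [exact Hphi|].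
      apply (Sch_scal _ (fun x => phi (- x))), Sch_refl, Hphi.
    + intros x; unfold w; eapply Cder_eq.
      * apply Cder_scal, Cder_plus; apply Cder_scal; [apply D|].
        apply Cder_scal, Cder_opp_arg, D.
      * ring.
  - replace (s + 1 - 1) with (s - 1 + 1) by ring.
    replace (RtoC (Gamma (s + 1)) * (RtoC (- / - s) * L))%C with (RtoC (Gamma s) * L)%C.
    + eapply FP1_ext; [|exact H2].
      intros x Hx; rewrite (Four_mulk phi phi' x Hphi Hphi' D).
      rewrite Rpower_shift1, RtoC_mult by exact Hx; ring.
    + rewrite Gamma_rec by exact Hs.
      transitivity (RtoC (s * Gamma s * - / - s) * L)%C; [|rewrite !RtoC_mult; ring].
      f_equal; f_equal; field; exact S0.
Qed.

Lemma halfline_shift s (n : nat) : nonint s -> halfline s ->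
  halfline (s + INR n) /\ halfline (s - INR n).
Proof.
  intros Hs H; induction n as [|n [IH1 IH2]].
  - simpl; rewrite Rplus_0_r, Rminus_0_r; auto.
  - rewrite S_INR; split.
    + replace (s + (INR n + 1)) with (s + INR n + 1) by ring.
      apply halfline_up; [|exact IH1].
      rewrite INR_IZR_INZ; apply nonint_plus, Hs.
    + replace (s - (INR n + 1)) with (s - INR n - 1) by ring.
      apply halfline_down; [|exact IH2].
      rewrite INR_IZR_INZ; unfold Rminus; rewrite <- opp_IZR; apply nonint_plus, Hs.
Qed.

Lemma halfline_all s : nonint s -> halfline s.
Proof.
  intros Hs.
  (* The integer that shifts [s] into [(-1, 0)]; the bounds are strict because [s] is not an
     integer. *)
  set (z := (Int_part s + 1)%Z).
  destruct (base_Int_part s) as [B1 B2].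
  assert (Ez : IZR z = IZR (Int_part s) + 1) by apply plus_IZR.
  assert (N1 : s <> IZR (Int_part s)) by apply Hs.
  set (s0 := s - IZR z).
  assert (R0 : -1 < s0 < 0) by (unfold s0; lra).
  assert (N0 : nonint s0) by (unfold s0, Rminus; rewrite <- opp_IZR; apply nonint_plus, Hs).
  destruct (halfline_shift s0 (Z.abs_nat z) N0 (halfline_base s0 R0)) as [Hp Hm].
  rewrite INR_IZR_INZ, Zabs2Nat.id_abs in *.
  destruct (Z_le_gt_dec 0 z).
  - rewrite Z.abs_eq in Hp by lia; replace s with (s0 + IZR z) by (unfold s0; ring); exact Hp.
  - rewrite Z.abs_neq, opp_IZR in Hm by lia.
    replace s with (s0 - - IZR z) by (unfold s0; ring); exact Hm.
Qed.

(** * Integer exponents *)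

Lemma pow_m1_sqr n : (-1) ^ n * (-1) ^ n = 1.
Proof. rewrite <- Rpow_mult_distr; replace (-1 * -1) with 1 by ring; apply pow1. Qed.

(* [alpha = - (m + 1)] *)
Definition negint (m : nat) : Prop := forall phi, Sch phi -> exists I,
  Int0 (fun x => RtoC (x ^ m) * (phi x + RtoC ((-1) ^ S m) * phi (- x)%R))%C I /\
  FP1 (- INR (S m)) (fun k => Four phi k + RtoC ((-1) ^ S m) * Four phi (- k)%R)%C
    (RtoC (PI / INR (fact m)) * (cexp (0, (- INR (S m) * (PI / 2))%R) * I))%C.

Lemma negint_base : negint 1.
Proof.
  intros phi Hphi.
  destruct cos_kernel as (rho & K & HK).
  assert (E : forall u, RtoC (2 * (cos u - 1)) =
     (1 * (cexp (0, (- u)%R) - 1) + 1 * (cexp (0, u) - 1))%C).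
  { intros u; unfold cexp; simpl; rewrite exp_0, cos_neg, sin_neg.
    apply injective_projections; simpl; ring. }
  destruct (FP1_kernel (-1) 1 _ _ _ _ _ _ _ _ phi 1%C 1%C ltac:(lra) ltac:(lra) Hphi HK HK)
    as (Lam & I1 & H1).
  { exact E. }
  { intros u; rewrite E; ring. }
  assert (PP := PI_RGT_0).
  (* Divides by the value [-PI] of the kernel at 0; the sign returns through the phase
     [e^{-i PI} = -1]. *)
  exists (RtoC (- / PI) * Lam)%C; split.
  - eapply IntD_ext; [|apply (IntD_scal good_pos (RtoC (- / PI))), I1].
    intros x Hx; cbv beta.
    replace (- -1) with 1 by ring; rewrite (Rpower_1 x Hx), pow_1.
    replace ((-1) ^ 2) with 1 by ring.
    transitivity (RtoC (- / PI * - PI) * (RtoC x * (phi x + 1 * phi (- x)%R)))%C.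
    + rewrite (RtoC_mult (- / PI)); ring.
    + replace (- / PI * - PI) with 1 by (field; lra); ring.
  - replace (- INR 2) with (-1 - 1) by (simpl; ring).
    replace (RtoC (PI / INR (fact 1)) * (cexp (0, ((-1 - 1) * (PI / 2))%R) *
      (RtoC (- / PI) * Lam)))%C with Lam.
    + eapply FP1_ext; [|exact H1].
      intros x _; replace ((-1) ^ 2) with 1 by ring; ring.
    + replace ((-1 - 1) * (PI / 2)) with (- PI) by field.
      replace (cexp (0, (- PI)%R)) with (RtoC (-1)).
      * simpl fact; simpl INR.
        transitivity (RtoC (PI / 1 * -1 * - / PI) * Lam)%C; [|rewrite !RtoC_mult; ring].
        replace (PI / 1 * -1 * - / PI) with 1 by (field; lra); ring.
      * unfold cexp; simpl; rewrite exp_0, cos_neg, sin_neg, cos_PI, sin_PI.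
        apply injective_projections; simpl; ring.
Qed.

Lemma negint_down m : negint m -> negint (S m).
Proof.
  intros H phi Hphi.
  destruct (H _ (Sch_mulix 1 phi Hphi)) as (I1 & A & B).
  exists (Ci * I1)%C; split.
  - eapply IntD_ext; [|apply (IntD_scal good_pos Ci), A].
    intros x _; unfold mulix; cbv beta; rewrite <- !tech_pow_Rmult, !RtoC_mult, RtoC_opp.
    transitivity (- (Ci * Ci) * (RtoC x * RtoC (x ^ m) *
      (phi x + - RtoC (-1) * - RtoC (-1) * (RtoC (-1) * RtoC ((-1) ^ m)) * - phi (- x)%R)))%C.
    + replace (RtoC (-1)) with (- (1))%C by (rewrite <- RtoC_opp; f_equal; ring); ring.
    + rewrite Ci2; replace (RtoC (-1)) with (- (1))%C by (rewrite <- RtoC_opp; f_equal; ring); ring.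
  - set (b := - INR (S m)).
    assert (Pb : 0 < INR (S m)) by (apply lt_0_INR; lia).
    set (W := fun n k => (Four (mulix n phi) k +
      RtoC ((-1) ^ S (S m)) * (RtoC ((-1) ^ n) * Four (mulix n phi) (- k)%R))%C).
    assert (HW : sch W).
    { apply sch_plus; [apply sch_Four, Hphi|apply sch_scal].
      apply (sch_refl (fun n => Four (mulix n phi))), sch_Four, Hphi. }
    assert (X : FP1 (b - 1) (W 0%nat) (RtoC (- / b) *
      (RtoC (PI / INR (fact m)) * (cexp (0, (- INR (S m) * (PI / 2))%R) * I1)))%C).
    { apply FP1_down; [exact HW|unfold b; lra| |].
      (* The critical order is [m + 1]. [W 0] has the parity of [m], so its derivative of order
         [m + 1] is odd and vanishes at 0. *)
      - intros j E; assert (j = S m) as -> by (apply INR_eq; unfold b in E; lra).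
        unfold W; rewrite Ropp_0.
        transitivity ((1 + RtoC ((-1) ^ S (S m) * (-1) ^ S m)) * Four (mulix (S m) phi) 0%R)%C;
          [rewrite RtoC_mult; ring|].
        replace ((-1) ^ S (S m) * (-1) ^ S m) with (- ((-1) ^ S m * (-1) ^ S m)) by (simpl; ring).
        rewrite pow_m1_sqr, RtoC_opp; ring.
      - eapply FP1_ext; [|exact B].
        intros x _; f_equal; unfold W; f_equal.
        rewrite Cmult_assoc, <- RtoC_mult; f_equal; f_equal; simpl; ring. }
    replace (- INR (S (S m))) with (b - 1) by (unfold b; rewrite (S_INR (S m)); ring).
    match goal with |- FP1 _ _ ?z => match type of X with FP1 _ _ ?y => replace z with y end end.
    + eapply FP1_ext; [|exact X].
      intros x _; unfold W; simpl mulix; simpl pow; ring.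
    + replace ((b - 1) * (PI / 2)) with (- INR (S m) * (PI / 2) - PI / 2) by (unfold b; ring).
      rewrite cexp_quarter_minus.
      set (E := cexp _).
      transitivity (RtoC (- / b * (PI / INR (fact m))) * (E * I1))%C;
        [rewrite RtoC_mult; ring|].
      transitivity (- (Ci * Ci) * (RtoC (PI / INR (fact (S m))) * (E * I1)))%C;
        [rewrite Ci2|ring].
      replace (- / b * (PI / INR (fact m))) with (PI / INR (fact (S m))); [ring|].
      rewrite fact_simpl, mult_INR; unfold b; field.
      split; [apply INR_fact_neq_0|lra].
Qed.

(** Exponent -1 lies above the base exponent -2 and is reached by testing the base case on
    [-i phi'], whose transform is [k psi]. The remaining integration by parts has boundary term
    [x (phi(x) - phi(-x))], zero at both ends. *)
Lemma negint_0 : negint 0.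
Proof.
  intros phi Hphi.
  destruct (Sch_der phi Hphi) as (phi' & Hphi' & D).
  destruct (negint_base _ (Sch_scal (- Ci)%C phi' Hphi')) as (I1 & A & B).
  set (w := fun x => (phi x + (-1) * phi (- x)%R)%C).
  assert (Sw : Sch w).
  { unfold w; apply Sch_plus; [exact Hphi|].
    apply (Sch_scal _ (fun x => phi (- x))), Sch_refl, Hphi. }
  assert (Dw : forall x, Cder (fun x => RtoC x * w x)%C x
     (w x + RtoC x * (phi' x + phi' (- x)%R))%C).
  { intros x; unfold w; eapply Cder_eq.
    - apply Cder_mult; [apply Cder_RtoC, (@is_derive_id R_AbsRing)|].
      apply Cder_plus; [apply D|apply Cder_scal, Cder_opp_arg, D].
    - cbv beta; change one with 1; ring. }
  exists ((0 - RtoC 0 * w 0%R) + (- Ci) * I1)%C; split.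
  - eapply IntD_ext; [|apply (IntD_plus good_pos); [|apply (IntD_scal good_pos (- Ci)%C), A]].
    + intros x _; instantiate (1 := fun x => (w x + RtoC x * (phi' x + phi' (- x)%R))%C).
      cbv beta; rewrite pow_1, pow_O; replace ((-1) ^ 2) with 1 by ring.
      transitivity (w x + (1 + Ci * Ci) * (RtoC x * (phi' x + phi' (- x)%R)))%C; [ring|].
      rewrite Ci2, pow_1; unfold w; ring.
    + apply IntD_prim with (fun x => RtoC x * w x)%C.
      * intros x _; apply Dw.
      * eapply (Clim_at_right (fun x => RtoC x * w x)%C), Dw.
      * apply Sch_Clim_p, Sch_mulx, Sw.
  - replace (RtoC (PI / INR (fact 0)) * (cexp (0, (- INR 1 * (PI / 2))%R) *
      ((0 - 0 * w 0%R) + (- Ci) * I1)))%C with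
      (RtoC (PI / INR (fact 1)) * (cexp (0, (- INR 2 * (PI / 2))%R) * I1))%C.
    + eapply FP1_ext; [|exact B].
      intros x Hx; cbv beta; rewrite !(Four_mulk phi phi' _ Hphi Hphi' D), RtoC_opp.
      replace (- INR 1) with (- INR 2 + 1) by (simpl; ring).
      rewrite Rpower_shift1 by exact Hx.
      replace ((-1) ^ 2) with 1 by ring; rewrite pow_1.
      replace (RtoC (-1)) with (- (1))%C by (rewrite <- RtoC_opp; f_equal; ring).
      rewrite RtoC_mult; ring.
    + replace (- INR 2 * (PI / 2)) with (- INR 1 * (PI / 2) - PI / 2) by (simpl; field).
      rewrite cexp_quarter_minus; simpl fact; ring.
Qed.

Lemma negint_all m : negint m.
Proof.
  destruct m as [|m]; [exact negint_0|].
  induction m as [|m IH]; [exact negint_base|apply negint_down, IH].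
Qed.

(** Every step up replaces [F] by [-i] times its derivatives, which multiplies the transform by [k].
    The base case starts from exponent -1 and is Fourier inversion at 0. *)
Lemma posint_all n F : sch F ->
  FP1 (INR n) (fun k => Four (F 0%nat) k + RtoC ((-1) ^ n) * Four (F 0%nat) (- k)%R)%C
    (RtoC (2 * PI) * (cexp (0, (INR n * (PI / 2))%R) * (RtoC ((-1) ^ n) * F n 0%R)))%C.
Proof.
  revert F; induction n as [|n IH]; intros F HF.
  - set (phi := F 0%nat).
    assert (Hphi : Sch phi) by apply sch_Sch, HF.
    assert (Hphi' : Sch (F 1%nat)) by apply (sch_Sch _ (sch_shift F HF)).
    assert (D : forall x, Cder phi x (F 1%nat x)) by (intros; apply HF).
    destruct (negint_0 _ (Sch_scal (- Ci)%C _ Hphi')) as (I1 & A & B).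
    (* With [phi'] as test function, the half-line integral of [phi'(x) - phi'(-x)] is [-2 phi 0]:
       the delta arises here. *)
    assert (EI : I1 = (- Ci * (0 - (phi 0%R + phi (- 0)%R)))%C).
    { apply (IntD_unique good_pos _ _ _ A).
      apply IntD_ext with (fun x => - Ci * (F 1%nat x + - F 1%nat (- x)%R))%C.
      - intros x _; rewrite pow_1, pow_O.
        replace (RtoC (-1)) with (- (1))%C by (rewrite <- RtoC_opp; f_equal; ring); ring.
      - apply (IntD_scal good_pos), IntD_prim with (fun x => phi x + phi (- x)%R)%C.
        + intros x _; apply Cder_plus; [apply D|apply Cder_opp_arg, D].
        + eapply (Clim_at_right (fun x => phi x + phi (- x)%R)%C), Cder_plus;
            [apply D|apply Cder_opp_arg, D].
        + apply (Sch_Clim_p (fun x => phi x + phi (- x)%R)%C), Sch_plus, Sch_refl; assumption. }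
    match goal with |- FP1 _ _ ?z => match type of B with FP1 _ _ ?y => replace z with y end end.
    + eapply FP1_ext; [|exact B].
      intros x Hx; cbv beta; rewrite !(Four_mulk phi (F 1%nat) _ Hphi Hphi' D), RtoC_opp.
      replace (INR 0) with (- INR 1 + 1) by (simpl; ring).
      rewrite Rpower_shift1, pow_1, pow_O by exact Hx.
      replace (RtoC (-1)) with (- (1))%C by (rewrite <- RtoC_opp; f_equal; ring).
      rewrite RtoC_mult; fold phi; ring.
    + rewrite EI, Ropp_0, pow_O.
      replace (- INR 1 * (PI / 2)) with (0 - PI / 2) by (simpl; field).
      replace (INR 0 * (PI / 2)) with 0 by (simpl; ring).
      rewrite cexp_quarter_minus.
      replace (cexp (0, 0)) with (RtoC 1) by (symmetry; apply cexp_0).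
      replace (PI / INR (fact 0)) with PI by (simpl; field).
      transitivity (- (Ci * Ci) * (RtoC PI * (2 * phi 0%R)))%C; [ring|].
      rewrite Ci2, (RtoC_mult 2); fold phi; ring.
  - assert (HG : sch (fun n x => - Ci * F (S n) x)%C) by apply sch_scal, sch_shift, HF.
    assert (Hphi : Sch (F 0%nat)) by apply sch_Sch, HF.
    assert (Hphi' : Sch (F 1%nat)) by apply (sch_Sch _ (sch_shift F HF)).
    assert (D : forall x, Cder (F 0%nat) x (F 1%nat x)) by (intros; apply HF).
    assert (X := IH _ HG); cbv beta in X.
    match goal with |- FP1 _ _ ?z => match type of X with FP1 _ _ ?y => replace z with y end end.
    + eapply FP1_ext; [|exact X].
      intros x Hx; cbv beta; rewrite !(Four_mulk _ _ _ Hphi Hphi' D), RtoC_opp.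
      rewrite S_INR, Rpower_shift1 by exact Hx.
      rewrite <- tech_pow_Rmult, !RtoC_mult.
      replace (RtoC (-1)) with (- (1))%C by (rewrite <- RtoC_opp; f_equal; ring); ring.
    + replace (INR (S n) * (PI / 2)) with (INR n * (PI / 2) + PI / 2) by (rewrite S_INR; ring).
      rewrite cexp_quarter_plus, <- tech_pow_Rmult, (RtoC_mult (-1)).
      replace (RtoC (-1)) with (- (1))%C by (rewrite <- RtoC_opp; f_equal; ring); ring.
Qed.

(** * Complex powers *)

Lemma cpow_polar z a : cpow z a = (RtoC (Rpower (Cmod z) a) * cexp (0, (a * carg z)%R))%C.
Proof.
  unfold cpow, clog, cexp, Rpower; simpl.
  replace (a * ln (Cmod z) - 0 * carg z) with (a * ln (Cmod z)) by ring.
  replace (a * carg z + 0 * ln (Cmod z)) with (a * carg z) by ring.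
  rewrite exp_0; apply injective_projections; simpl; ring.
Qed.

Lemma carg_pos x : 0 < x -> carg (RtoC x) = 0.
Proof.
  intros H; unfold carg; simpl.
  destruct (Rlt_dec 0 0); [lra|]; destruct (Rlt_dec x 0); [lra|reflexivity].
Qed.

Lemma carg_neg x : 0 < x -> carg (RtoC (- x)) = - PI.
Proof.
  intros H; unfold carg; simpl.
  destruct (Rlt_dec 0 0); [lra|]; destruct (Rlt_dec (- x) 0); [reflexivity|lra].
Qed.

Lemma carg_i_pos y : 0 < y -> carg (0, y) = PI / 2.
Proof.
  intros H; unfold carg; simpl.
  destruct (Rlt_dec 0 y); [|lra].
  unfold Rdiv at 1; rewrite Rmult_0_l; apply acos_0.
Qed.

Lemma carg_i_neg y : 0 < y -> carg (0, - y) = - (PI / 2).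
Proof.
  intros H; unfold carg; simpl.
  destruct (Rlt_dec 0 (- y)); [lra|]; destruct (Rlt_dec (- y) 0); [|lra].
  unfold Rdiv at 1; rewrite Rmult_0_l, acos_0; reflexivity.
Qed.

Lemma Cmod_i y : Cmod (0, y) = Rabs y.
Proof.
  replace ((0, y) : C) with (Ci * RtoC y)%C by (apply injective_projections; simpl; ring).
  rewrite Cmod_mult, Cmod_Ci, Cmod_R; ring.
Qed.

Lemma xpow_pos a x : 0 < x -> xpow a x = (1 * RtoC (Rpower x a))%C.
Proof.
  intros H; unfold xpow; rewrite cpow_polar, carg_pos, Cmod_R, Rabs_pos_eq, Rmult_0_r by lra.
  replace (cexp (0, 0)) with (RtoC 1) by (symmetry; apply cexp_0); ring.
Qed.

(** The branch gives negative reals the argument [-PI], hence the minus sign in the phase. *)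
Lemma xpow_neg a x : 0 < x -> xpow a (- x) = (cexp (0, (- (PI * a))%R) * RtoC (Rpower x a))%C.
Proof.
  intros H; unfold xpow; rewrite cpow_polar, carg_neg, Cmod_R, Rabs_Ropp, Rabs_pos_eq by lra.
  replace (a * - PI) with (- (PI * a)) by ring; ring.
Qed.

Lemma cpow_Ci a : cpow Ci a = cexp (0, a * (PI / 2)).
Proof.
  rewrite cpow_polar, Cmod_Ci; unfold Ci; rewrite carg_i_pos by lra.
  unfold Rpower; rewrite ln_1, Rmult_0_r, exp_0; ring.
Qed.

Lemma Cinv_polar r y : r <> 0 ->
  Cinv (RtoC r * cexp (0, y))%C = (cexp (0, (- y)%R) * RtoC (/ r))%C.
Proof.
  intros Hr.
  assert (E : ((RtoC r * cexp (0, y)) * (cexp (0, (- y)%R) * RtoC (/ r)) = 1)%C).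
  { transitivity (RtoC (r * / r) * (cexp (0, y) * cexp (0, (- y)%R)))%C;
      [rewrite RtoC_mult; ring|].
    rewrite Rinv_r, <- cexp_plus by exact Hr.
    replace ((0, y) + (0, (- y)%R))%C with (RtoC 0)
      by (apply injective_projections; simpl; ring).
    rewrite cexp_0; ring. }
  assert (N : (RtoC r * cexp (0, y))%C <> 0%C).
  { intros Z; apply (f_equal Cmod) in Z.
    rewrite Cmod_mult, Cmod_cexp_i, Cmod_R, Cmod_0, Rmult_1_r in Z.
    apply Rabs_no_R0 in Hr; contradiction. }
  transitivity (/ (RtoC r * cexp (0, y)) *
    ((RtoC r * cexp (0, y)) * (cexp (0, (- y)%R) * RtoC (/ r))))%C.
  - rewrite E; ring.
  - rewrite Cmult_assoc, Cinv_l by exact N; ring.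
Qed.

Lemma Cinv_cpow_i_pos a x : 0 < x ->
  Cinv (cpow (0, x) a) = (cexp (0, (- (a * (PI / 2)))%R) * RtoC (Rpower x (- a)))%C.
Proof.
  intros H; rewrite cpow_polar, carg_i_pos, Cmod_i, Rabs_pos_eq by lra.
  rewrite Cinv_polar, Rpower_Ropp; [reflexivity|].
  apply Rgt_not_eq, Rpower_pos.
Qed.

Lemma Cinv_cpow_i_neg a x : 0 < x ->
  Cinv (cpow (0, - x) a) = (cexp (0, (a * (PI / 2))%R) * RtoC (Rpower x (- a)))%C.
Proof.
  intros H; rewrite cpow_polar, carg_i_neg, Cmod_i, Rabs_Ropp, Rabs_pos_eq by lra.
  rewrite Cinv_polar, Rpower_Ropp by (apply Rgt_not_eq, Rpower_pos).
  replace (- (a * - (PI / 2))) with (a * (PI / 2)) by ring; reflexivity.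
Qed.

Lemma cexp_PI_pow n : cexp (0, - (PI * INR n)) = RtoC ((-1) ^ n).
Proof.
  induction n as [|n IH].
  - simpl; rewrite Rmult_0_r, Ropp_0; apply cexp_0.
  - rewrite S_INR.
    replace (0, - (PI * (INR n + 1))) with ((0, (- (PI * INR n))%R) + (0, (- PI)%R))%C
      by (apply injective_projections; simpl; ring).
    rewrite cexp_plus, IH, <- tech_pow_Rmult, RtoC_mult, Cmult_comm; f_equal.
    unfold cexp; simpl; rewrite exp_0, cos_neg, sin_neg, cos_PI, sin_PI.
    apply injective_projections; simpl; ring.
Qed.

Lemma cexp_PI_pow_opp n : cexp (0, - (PI * - INR n)) = RtoC ((-1) ^ n).
Proof.
  replace (- (PI * - INR n)) with (- - (PI * INR n)) by ring.
  rewrite <- Cconj_cexp_i, cexp_PI_pow; apply injective_projections; simpl; ring.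
Qed.

(** * Integrals over the whole line *)

Lemma Sch_pow m f : Sch f -> Sch (fun x => RtoC (x ^ m) * f x)%C.
Proof.
  intros H; induction m as [|m IH].
  - apply (Sch_ext f); [intros x; rewrite pow_O; ring|exact H].
  - apply (Sch_ext (fun x => RtoC x * (RtoC (x ^ m) * f x))%C); [|apply Sch_mulx, IH].
    intros x; rewrite <- tech_pow_Rmult, RtoC_mult; ring.
Qed.

Lemma good_ge0 : good allR (fun x => 0 <= x) (at_point 0) (Rbar_locally p_infty).
Proof.
  split; try (unfold convex; intros; exact I); try apply Rbar_locally_filter;
    try apply (@at_point_filter R_UniformSpace).
  - intros; apply filter_forall; intros; exact I.
  - intros b c x; lra.
  - unfold at_point; lra.
  - exists 0; intros; lra.
  - eexists; apply filterlim_at_point.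
  - eexists; apply atan_lim_p.
Qed.

Lemma good_le0 : good allR (fun x => x <= 0) (Rbar_locally m_infty) (at_point 0).
Proof.
  split; try (unfold convex; intros; exact I); try apply Rbar_locally_filter;
    try apply (@at_point_filter R_UniformSpace).
  - intros; apply filter_forall; intros; exact I.
  - intros b c x; lra.
  - exists 0; intros; lra.
  - unfold at_point; lra.
  - eexists; apply atan_lim_m.
  - eexists; apply filterlim_at_point.
Qed.

(** The integrand jumps at 0 because of [sgn], so the line is cut there; on each side it coincides
    with a smooth function, [c q] or [- c q]. *)
Lemma T_val_fold g q phi c l : Sch q ->
  (forall x, 0 < x -> (g x * phi x = c * q x)%C) ->
  (forall x, x < 0 -> (g x * phi x = - c * q x)%C) ->
  Int0 (fun x => q x + (-1) * q (- x)%R)%C l -> T_val g phi (c * l)%C.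
Proof.
  intros Hq Gp Gm HI.
  destruct (Sch_decay q 0 Hq) as (M & PM & HM).
  assert (B : forall x, Cmod (q x) <= M / (1 + x²)).
  { intros x; generalize (HM x); rewrite pow_O, Rmult_1_l; auto. }
  destruct (IntD_ex good_ge0 q M) as [p Hp]; [intros; apply Sch_cont, Hq|auto|].
  destruct (IntD_ex good_le0 q M) as [n Hn]; [intros; apply Sch_cont, Hq|auto|].
  assert (Cc : forall d x, Ccont (fun x => d * q x)%C x).
  { intros d x; apply Ccont_mult; [eapply Cder_cont, Cder_const|apply Sch_cont, Hq]. }
  (* [HI] approaches 0 from the right, while the cut needs integrals ending at the point 0 itself;
     antiderivatives are continuous there, so the values agree. *)
  assert (E : l = (p + (-1) * n)%C).
  { apply (IntD_unique good_pos _ _ _ HI), (IntD_plus good_pos).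
    - destruct Hp as (H & la & lb & D & A & B' & ->).
      rewrite (Clim_unique _ _ _ _ A (Clim_at_point H 0)).
      apply IntD_prim with H; [intros; apply D, I| |exact B'].
      eapply Clim_at_right, D, I.
    - apply (IntD_scal good_pos).
      destruct Hn as (H & la & lb & D & A & B' & ->).
      rewrite (Clim_unique _ _ _ _ B' (Clim_at_point H 0)).
      replace (H 0%R - la)%C with (- la - - H (- 0)%R)%C by (rewrite Ropp_0; ring).
      apply IntD_prim with (fun x => - H (- x)%R)%C.
      + intros x _; eapply Cder_eq; [apply Cder_opp, Cder_opp_arg, D, I|ring].
      + eapply (Clim_at_right (fun x => - H (- x)%R)%C), Cder_opp, Cder_opp_arg, D, I.
      + apply (Clim_opp _ (fun x => H (- x))), Clim_comp_opp_m, A. }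
  rewrite E; replace (c * (p + -1 * n))%C with ((- c) * n + c * p)%C by ring.
  unfold T_val.
  apply (is_RInt_gen_Chasles (V := prod_NormedModule R_AbsRing R_NormedModule R_NormedModule)
    (fun x => g x * phi x)%C 0 (- c * n)%C (c * p)%C).
  - apply (IntD_RInt_gen good_le0 (fun x => - c * q x)%C);
      [apply (IntD_scal good_le0), Hn|intros; apply Cc|].
    intros a b x _ Hb Hx; apply Gm; lra.
  - apply (IntD_RInt_gen good_ge0 (fun x => c * q x)%C);
      [apply (IntD_scal good_ge0), Hp|intros; apply Cc|].
    intros a b x Ha _ Hx; apply Gp; lra.
Qed.

Theorem theorem3p2 (alpha : R) (phi : R -> C) (Hphi : Schwartz phi) :
  exists psi : R -> C, is_fourier phi psi /\
  (* (F Pf x^alpha)[phi] = (Pf x^alpha)[hat phi] *)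
  ((forall n : nat, alpha = INR n ->
      Pf_val (xpow alpha) psi
        (Cmult (RtoC (2 * PI)) (Cmult (cpow Ci alpha) (Dn_delta n phi)))) /\
   (forall m : nat, alpha = - INR (S m) ->
      exists L : C,
        T_val (fun x => Cmult (RtoC (PI * sgn x / INR (Factorial.fact m)))
                              (Cmult (cpow Ci alpha) (xpow (- alpha - 1) x))) phi L /\
        Pf_val (xpow alpha) psi L) /\
   ((forall z : Z, alpha <> IZR z) ->
      exists L1 L2 : C,
        Pf_val (fun x => Cinv (cpow (Cmult (Copp Ci) (RtoC x)) (alpha + 1))) phi L1 /\
        Pf_val (fun x => Cinv (cpow (Cmult Ci (RtoC x)) (alpha + 1))) phi L2 /\
        Pf_val (xpow alpha) psi
          (Cmult (RtoC (Gamma (alpha + 1)))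
                 (Cplus (Cmult (cexp (0, - (PI * alpha))) L1) L2)))).
Proof.
  assert (HF := Schwartz_sch phi Hphi).
  assert (E0 : forall x, Dn 0 phi x = phi x) by (intros x; symmetry; apply surjective_pairing).
  assert (Sphi : Sch phi) by (eapply Sch_ext, sch_Sch, HF; exact E0).
  assert (Spsi := Sch_Four phi Sphi).
  exists (Four phi); split; [|split; [|split]].
  - intros k; eapply (IntD_RInt_gen good_R); [apply Four_spec, Sphi| |reflexivity].
    intros x _; apply Ccont_mult; [apply Sch_cont, Sphi|apply eikx_cont].
  - intros n ->.
    apply (FP1_Pf_val _ _ 1%C (RtoC ((-1) ^ n)) (INR n)).
    + exact Spsi.
    + intros x Hx; apply xpow_pos, Hx.
    + intros x Hx; rewrite xpow_neg, cexp_PI_pow by exact Hx; reflexivity.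
    + rewrite cpow_Ci; unfold Dn_delta.
      eapply FP1_ext; [|apply (posint_all n (fun n => Dn n phi) HF)].
      intros x _; cbv beta.
      rewrite !(Four_ext (Dn 0 phi) phi) by (first [exact E0|apply (sch_Sch _ HF)]); ring.
  - intros m ->.
    destruct (negint_all m phi Sphi) as (I1 & A & B).
    set (c := (RtoC (PI / INR (fact m)) * cexp (0, (- INR (S m) * (PI / 2))%R))%C).
    exists (c * I1)%C; split.
    + apply (T_val_fold _ (fun x => RtoC (x ^ m) * phi x)%C).
      * apply Sch_pow, Sphi.
      * intros x Hx; rewrite cpow_Ci; unfold sgn; destruct (Rlt_dec 0 x); [|lra].
        replace (- - INR (S m) - 1) with (INR m) by (rewrite S_INR; ring).
        rewrite xpow_pos, Rpower_pow, Rmult_1_r by exact Hx; unfold c; ring.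
      * intros x Hx; rewrite cpow_Ci; unfold sgn.
        destruct (Rlt_dec 0 x); [lra|]; destruct (Rlt_dec x 0); [|lra].
        replace (- - INR (S m) - 1) with (INR m) by (rewrite S_INR; ring).
        replace (xpow (INR m) x) with (RtoC (x ^ m)).
        -- replace (PI * -1 / INR (fact m)) with (- (PI / INR (fact m))) by (unfold Rdiv; ring).
           rewrite RtoC_opp; unfold c; ring.
        -- rewrite <- (Ropp_involutive x) at 2.
           rewrite xpow_neg, cexp_PI_pow, Rpower_pow, <- RtoC_mult, <- Rpow_mult_distr by lra.
           f_equal; f_equal; ring.
      (* The sign from [sgn] and the parity of [x^m] combine into the factor [(-1)^(m+1)] of
         [negint]. *)
      * eapply IntD_ext; [|exact A].
        intros x _; cbv beta.
        replace (- x) with (-1 * x) at 2 by ring.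
        rewrite Rpow_mult_distr, <- tech_pow_Rmult, !RtoC_mult; ring.
    + apply (FP1_Pf_val _ _ 1%C (RtoC ((-1) ^ S m)) (- INR (S m))).
      * exact Spsi.
      * intros x Hx; apply xpow_pos, Hx.
      * intros x Hx; rewrite xpow_neg, cexp_PI_pow_opp by exact Hx; reflexivity.
      * unfold c; rewrite <- Cmult_assoc.
        eapply FP1_ext; [|exact B]; intros x _; cbv beta; ring.
  - intros Ha.
    assert (Hs : nonint (alpha + 1)) by (apply (nonint_plus alpha 1); exact Ha).
    (* Pairing [(-ix)^(-s)] with [phi] amounts to pairing [(ix)^(-s)] with the reflected [phi], so
       [L2] comes from [phi] and [L1] from its reflection. *)
    destruct (halfline_all _ Hs phi Sphi) as (L2 & A2 & B2).
    destruct (halfline_all _ Hs _ (Sch_refl phi Sphi)) as (L1 & A1 & B1).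
    exists L1, L2; split; [|split].
    + apply (FP1_Pf_val _ _ (cexp (0, (alpha + 1) * (PI / 2)))
        (cexp (0, - ((alpha + 1) * (PI / 2)))) (- (alpha + 1))).
      * exact Sphi.
      * intros x Hx; rewrite <- Cinv_cpow_i_neg by exact Hx; do 2 f_equal.
        apply injective_projections; simpl; ring.
      * intros x Hx; rewrite <- Cinv_cpow_i_pos by exact Hx; do 2 f_equal.
        apply injective_projections; simpl; ring.
      * eapply FP1_ext; [|exact A1].
        intros x _; cbv beta; rewrite Ropp_involutive; ring.
    + apply (FP1_Pf_val _ _ (cexp (0, - ((alpha + 1) * (PI / 2))))
        (cexp (0, (alpha + 1) * (PI / 2))) (- (alpha + 1))).
      * exact Sphi.
      * intros x Hx; rewrite <- Cinv_cpow_i_pos by exact Hx; do 2 f_equal.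
        apply injective_projections; simpl; ring.
      * intros x Hx; rewrite <- Cinv_cpow_i_neg by exact Hx; do 2 f_equal.
        apply injective_projections; simpl; ring.
      * exact A2.
    + apply (FP1_Pf_val _ _ 1%C (cexp (0, - (PI * alpha))) alpha).
      * exact Spsi.
      * intros x Hx; apply xpow_pos, Hx.
      * intros x Hx; apply xpow_neg, Hx.
      (* On the chosen branch [x^alpha] is its positive half plus [e^{-i PI alpha}] times the
         reflection of that half; reflection commutes with the transform ([Four_refl]). *)
      * replace (alpha + 1 - 1) with alpha in B1, B2 by ring.
        replace (RtoC (Gamma (alpha + 1)) * (cexp (0, (- (PI * alpha))%R) * L1 + L2))%C with
          (RtoC (Gamma (alpha + 1)) * L2 +
           cexp (0, (- (PI * alpha))%R) * (RtoC (Gamma (alpha + 1)) * L1))%C by ring.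
        eapply FP1_ext; [|apply FP1_plus; [exact B2|apply FP1_scal, B1]].
        intros x _; cbv beta; rewrite (Four_refl phi x Sphi); ring.
Qed.
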